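(* Let $\alpha\geqslant\frac2\pi\big(1+\frac{1}{3\sqrt\pi}\big)$ and let $\zeta_*\in L^2$ be a non-negative solution of $\zeta_*=\varPhi(\zeta_* )$ with $\|\zeta_*\|\leqslant\frac{9\sqrt\pi}{2}$. Define $\theta(\sigma)=\frac13(H\zeta_* )(\sigma)$ and $\tau(\sigma)=\log\frac\pi2+\frac13\int_0^\sigma\zeta_*(s)\,ds$ for $\sigma\in[0,\pi/2]$. Then: 1. $(\tau'(\sigma)\sin\sigma)'\in L^2$ with $\|(\tau'\sin\sigma)'\|\leqslant 7/(\alpha\sqrt\pi)$, $\tau'(\pi/2)=0$, and $\tau\in C^{1,1/2}[\delta,\pi/2]$ for every $\delta\in(0,\pi/2)$; 2. $(\theta'(\sigma)\sin\sigma)'\in L^2$ with $\|(\theta'\sin\sigma)'\|\leqslant 7/(\alpha\sqrt\pi)$, and $\theta\in C^{1,1/2}[\delta,\pi/2]$ for every $\delta\in(0,\pi/2)$.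
   Context: $L^2$ denotes $L^2(0,\pi/2)$ with norm $\|f\|=\big(\int_0^{\pi/2}|f(\sigma)|^2\,d\sigma\big)^{1/2}$. The kernel is $K(s,\sigma)=\log\Big|\frac{\sin(s+\sigma)}{\sin(s-\sigma)}\Big|$ for $s,\sigma\in(0,\pi/2)$, $s\neq\sigma$, and for $w\in L^2$ the operator $H$ is $(Hw)(\sigma)=\frac1\pi\int_0^{\pi/2}K(s,\sigma)\,w(s)\,ds$, $\sigma\in[0,\pi/2]$. For a parameter $\alpha>0$ the nonlinear operator $\varPhi$ is defined for $\zeta\in L^2$ by $$\varPhi(\zeta)(\sigma)=\frac{3}{\alpha\pi}\,\frac{\sin\big(\sigma+\frac13(H\zeta)(\sigma)\big)\cot\sigma}{\exp\int_0^\sigma\zeta(s)\,ds},\qquad\sigma\in(0,\pi/2].$$ (Such a $\zeta_*$ exists for these $\alpha$.) $C^{1,1/2}[a,b]$ denotes continuously differentiable functions whose derivative is Hölder continuous with exponent $1/2$; derivatives are weak derivatives and $\tau'=\zeta_*/3$, with $\zeta_*$ taken as $\varPhi(\zeta_* )$ pointwise. *)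

(* Defs.v *)
From Stdlib Require Import Reals Lra List ClassicalEpsilon.
Import ListNotations.
Open Scope R_scope.

(* A tagged partition of [a,b] is a list of (tag t_i, right endpoint x_i). *)
Fixpoint fine_part (delta : R -> R) (a b : R) (p : list (R * R)) : Prop :=
  match p with
  | nil => a = b
  | (t, x) :: q =>
      a < x /\ a <= t <= x /\ t - delta t < a /\ x < t + delta t /\
      fine_part delta x b q
  end.

Fixpoint rsum (f : R -> R) (a : R) (p : list (R * R)) : R :=
  match p with
  | nil => 0
  | (t, x) :: q => f t * (x - a) + rsum f x q
  end.

Definition HKint (f : R -> R) (a b I : R) : Prop :=
  a <= b /\
  forall eps, 0 < eps -> exists delta : R -> R,
    (forall x, 0 < delta x) /\
    forall p, fine_part delta a b p -> Rabs (rsum f a p - I) < eps.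

(* The integral (the unique I when it exists). *)
Definition integral (f : R -> R) (a b : R) : R :=
  epsilon (inhabits 0) (HKint f a b).

Definition L1 (f : R -> R) (a b : R) : Prop :=
  (exists I, HKint f a b I) /\ (exists J, HKint (fun x => Rabs (f x)) a b J).

Definition L2 (f : R -> R) (a b : R) : Prop :=
  L1 f a b /\ exists I, HKint (fun x => f x ^ 2) a b I.

Definition L2norm (f : R -> R) (a b : R) : R :=
  sqrt (integral (fun x => f x ^ 2) a b).

Definition test_fun (phi : R -> R) (a b : R) : Prop :=
  (exists D : nat -> R -> R, D 0%nat = phi /\
     forall n x, derivable_pt_lim (D n) x (D (S n) x)) /\
  exists c d, a < c /\ c < d /\ d < b /\
    forall x, (x < c \/ d < x) -> phi x = 0.

Definition weak_deriv (f g : R -> R) (a b : R) : Prop :=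
  (forall c d, a < c -> c < d -> d < b -> L1 f c d /\ L1 g c d) /\
  forall phi dphi, test_fun phi a b ->
    (forall x, derivable_pt_lim phi x (dphi x)) ->
    integral (fun x => f x * dphi x) a b = - integral (fun x => g x * phi x) a b.

Definition deriv_within (f : R -> R) (a b x l : R) : Prop :=
  forall eps, 0 < eps -> exists eta, 0 < eta /\
    forall y, a <= y <= b -> 0 < Rabs (y - x) < eta ->
      Rabs ((f y - f x) / (y - x) - l) < eps.

Definition left_deriv (f : R -> R) (x l : R) : Prop :=
  forall eps, 0 < eps -> exists eta, 0 < eta /\
    forall y, x - eta < y < x -> Rabs ((f y - f x) / (y - x) - l) < eps.

Definition C11half (f : R -> R) (a b : R) : Prop :=
  exists df : R -> R,
    (forall x, a <= x <= b -> deriv_within f a b x (df x)) /\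
    exists C, forall x y, a <= x <= b -> a <= y <= b ->
      Rabs (df x - df y) <= C * sqrt (Rabs (x - y)).

Definition Kker (s sigma : R) : R :=
  ln (Rabs (sin (s + sigma) / sin (s - sigma))).

Definition Hop (w : R -> R) (sigma : R) : R :=
  / PI * integral (fun s => Kker s sigma * w s) 0 (PI / 2).

Definition Phi (alpha : R) (zeta : R -> R) (sigma : R) : R :=
  3 / (alpha * PI) *
  (sin (sigma + / 3 * Hop zeta sigma) * (cos sigma / sin sigma)) /
  exp (integral zeta 0 sigma).

(* Main.v *)
Require Import Defs.
From Stdlib Require Import Reals Lra Lia List ClassicalEpsilon Classical.
From Coquelicot Require Import Coquelicot.
Import ListNotations.
Open Scope R_scope.

(** Write [b_n] for the coefficients of [zeta] in the system [sin (2 n s)].  The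
    logarithmic kernel is [K(s,sigma) = sum 2 sin(2ns) sin(2n sigma) / n], so
    [H zeta = sum b_n sin(2n sigma) / (2n)]: conjugation [sin -> cos] turns [zeta]
    into [(H zeta)'], and by Bessel and Riesz-Fischer [||(H zeta)'|| <= ||zeta||].
    Hence [theta] is absolutely continuous with derivative in L2, and the fixed
    point equation exhibits [tau' sin s = zeta sin s / 3] as
    [sin (s + theta) cos s exp (- int zeta) / (alpha pi)], whose derivative [h] is
    bounded by the weighted Cauchy-Schwarz inequality with weights 1, 3/2, 9/2.
    Multiplication by [sin s] moves even frequencies to odd ones; after an
    integration by parts and an Abel summation, [theta' sin s] is the primitive of
    the conjugate of [h] in the odd system, so its derivative has norm at most
    [||h||].  Hoelder continuity is the Cauchy-Schwarz inequality on [[x,y]]. *)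

(** * Henstock-Kurzweil primitives *)

(** Two versions of [theta'] are used. The L2 limit [v] is determined only up to null sets, but it
    has to come first: it makes [theta] absolutely continuous, so that the profile can be
    differentiated and [h] estimated. Only then does the pointwise version [Q s / sin s] become
    available; it is Hoelder continuous on each [delta, PI/2] and carries the second half of the
    theorem.

    The constant 7 is Minkowski's inequality in units of sqrt(PI): the three terms of the derivative
    of the profile have norms at most 1, 3/2 (one third of the bound on [zeta]) and 9/2. Taking
    these same numbers as Cauchy-Schwarz weights yields the sum of the norms without handling roots.

    Measurability never appears. Integrable means that the function and its absolute value have
    gauge primitives; squares, products and limits are reached by lattice operations and Fatou's
    lemma.

    At 0 nothing is known about [zeta]. The argument therefore runs through [zeta s * sin s], which
    vanishes there, and through intervals [delta, PI/2]. *)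

Lemma fine_part_le delta a b p : fine_part delta a b p -> a <= b.
Proof.
  revert a; induction p as [|[t x] q IH]; intros a H; simpl in H; [lra|].
  destruct H as (H1 & _ & _ & _ & H5). apply IH in H5. lra.
Qed.

Lemma fine_part_app delta a b c p q :
  fine_part delta a b p -> fine_part delta b c q -> fine_part delta a c (p ++ q).
Proof.
  revert a; induction p as [|[t x] p IH]; intros a H H'; simpl in *.
  - now subst.
  - intuition.
Qed.

Lemma rsum_app delta f a b p q :
  fine_part delta a b p -> rsum f a (p ++ q) = rsum f a p + rsum f b q.
Proof.
  revert a; induction p as [|[t x] p IH]; intros a H; simpl in *.
  - subst; lra.
  - rewrite IH by intuition. lra.
Qed.

Lemma fine_part_mono d1 d2 a b p :
  (forall x, d1 x <= d2 x) -> fine_part d1 a b p -> fine_part d2 a b p.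
Proof.
  intros Hd; revert a; induction p as [|[t x] p IH]; intros a H; simpl in *; auto.
  destruct H as (H1 & H2 & H3 & H4 & H5). specialize (Hd t).
  repeat split; try lra. now apply IH.
Qed.

Lemma fine_part_min_l d1 d2 a b p :
  fine_part (fun x => Rmin (d1 x) (d2 x)) a b p -> fine_part d1 a b p.
Proof. apply fine_part_mono. intro; apply Rmin_l. Qed.

Lemma fine_part_min_r d1 d2 a b p :
  fine_part (fun x => Rmin (d1 x) (d2 x)) a b p -> fine_part d2 a b p.
Proof. apply fine_part_mono. intro; apply Rmin_r. Qed.

(** Compactness of [a,b] in gauge form. The supremum [m] of the reachable endpoints is itself
    reachable, because an interval tagged at [m] may start at any reachable point close enough to
    [m]; and if [m < b], another interval tagged at [m] would reach beyond it. *)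
Lemma cousin delta a b :
  (forall x, 0 < delta x) -> a <= b -> exists p, fine_part delta a b p.
Proof.
  intros Hd Hab.
  set (E := fun x => a <= x <= b /\ exists p, fine_part delta a x p).
  assert (Ea : E a) by (split; [lra | exists nil; reflexivity]).
  destruct (completeness E) as [m [Hub Hlub]].
  { exists b. intros x [Hx _]; lra. }
  { now exists a. }
  assert (Ham : a <= m) by (apply Hub, Ea).
  assert (Hmb : m <= b) by (apply Hlub; intros x [Hx _]; lra).
  pose proof (Hd m) as Hdm.
  assert (Hx : exists x, E x /\ m - delta m < x).
  { apply NNPP; intro Hn.
    assert (m <= m - delta m); [|lra].
    apply Hlub. intros x Ex.
    apply Rnot_lt_le; intro; apply Hn; exists x; split; [exact Ex | lra]. }
  destruct Hx as (x & [Hxab [p Hp]] & Hxm).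
  assert (Hxle : x <= m) by (apply Hub; split; eauto).
  assert (Hm : exists p', fine_part delta a m p').
  { destruct (Req_dec x m) as [->|Hne]; [eauto|].
    exists (p ++ [(m, m)]). eapply fine_part_app; [exact Hp|]. simpl. lra. }
  destruct Hm as [p' Hp'].
  destruct (Req_dec m b) as [->|Hne]; [eauto|].
  exfalso.
  set (y := Rmin b (m + delta m / 2)).
  assert (Hy : m < y <= b /\ y < m + delta m).
  { unfold y; split; [split|]; unfold Rmin; destruct Rle_dec; lra. }
  assert (y <= m); [|lra].
  apply Hub. split; [lra|]. exists (p' ++ [(m, y)]).
  eapply fine_part_app; [exact Hp'|]. simpl. lra.
Qed.

Lemma rsum_opp f a p : rsum (fun x => - f x) a p = - rsum f a p.
Proof. revert a; induction p as [|[t x] p IH]; intro a; simpl; [|rewrite IH]; ring. Qed.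

Lemma HKint_unique f a b I J : HKint f a b I -> HKint f a b J -> I = J.
Proof.
  intros [Hab HI] [_ HJ].
  apply cond_eq; intros e He.
  destruct (HI (e / 2)) as (d1 & P1 & Q1); [lra|].
  destruct (HJ (e / 2)) as (d2 & P2 & Q2); [lra|].
  destruct (cousin (fun x => Rmin (d1 x) (d2 x)) a b) as [p Hp]; auto.
  { intro; apply Rmin_pos; auto. }
  specialize (Q1 p (fine_part_min_l _ _ _ _ _ Hp)).
  specialize (Q2 p (fine_part_min_r _ _ _ _ _ Hp)).
  split_Rabs; lra.
Qed.

Lemma integral_eq f a b I : HKint f a b I -> integral f a b = I.
Proof.
  intro H. apply (HKint_unique f a b); [|exact H].
  unfold integral. apply epsilon_spec. now exists I.
Qed.

(** Two fine partitions of [c,d], completed by the same partitions of [a,c] and [d,b], have Riemann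
    sums that differ exactly as their parts on [c,d] do. Hence the sums over [c,d] satisfy a Cauchy
    condition. *)
Lemma HKint_sub f a b I c d :
  HKint f a b I -> a <= c -> c <= d -> d <= b -> exists J, HKint f c d J.
Proof.
  intros [Hab HI] Hac Hcd Hdb.
  assert (Hc : forall eps, 0 < eps -> exists delta, (forall x, 0 < delta x) /\
    forall p q, fine_part delta c d p -> fine_part delta c d q ->
    rsum f c p <= rsum f c q + eps).
  { intros eps He. destruct (HI (eps / 2)) as (dl & Hd & Hp); [lra|].
    exists dl; split; [exact Hd|]. intros p q Fp Fq.
    destruct (cousin dl a c) as [l Hl]; auto.
    destruct (cousin dl d b) as [r Hr]; auto.
    assert (H1 := Hp _ (fine_part_app _ _ _ _ _ _ Hl (fine_part_app _ _ _ _ _ _ Fp Hr))).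
    assert (H2 := Hp _ (fine_part_app _ _ _ _ _ _ Hl (fine_part_app _ _ _ _ _ _ Fq Hr))).
    rewrite (rsum_app dl _ _ c) in H1, H2 by auto.
    rewrite (rsum_app dl _ _ d) in H1 by auto.
    rewrite (rsum_app dl _ _ d) in H2 by auto.
    split_Rabs; lra. }
  (* The numbers lying below all sufficiently fine Riemann sums. Their supremum is the lower
     integral, which gives the limit of the Cauchy condition without choosing a sequence of
     gauges. *)
  set (A := fun z => exists delta, (forall x, 0 < delta x) /\
    forall p, fine_part delta c d p -> z <= rsum f c p).
  destruct (Hc 1) as (d0 & Hd0 & H0); [lra|].
  destruct (cousin d0 c d) as [p0 Hp0]; auto.
  assert (Hcross : forall dl e p z, (forall x, 0 < dl x) ->
    (forall p q, fine_part dl c d p -> fine_part dl c d q ->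
      rsum f c p <= rsum f c q + e) -> fine_part dl c d p -> A z ->
    z <= rsum f c p + e).
  { intros dl e p z Hdl H Fp (d' & Hd' & Hz).
    destruct (cousin (fun x => Rmin (dl x) (d' x)) c d) as [q Hq]; auto.
    { intro; apply Rmin_pos; auto. }
    assert (H1 := H q p (fine_part_min_l _ _ _ _ _ Hq) Fp).
    assert (H2 := Hz q (fine_part_min_r _ _ _ _ _ Hq)). lra. }
  destruct (completeness A) as [J [Hub Hlub]].
  { exists (rsum f c p0 + 1). intros z Az. eapply Hcross; eauto. }
  { exists (rsum f c p0 - 1). exists d0. split; auto. intros p Fp.
    specialize (H0 p0 p Hp0 Fp). lra. }
  exists J. split; [exact Hcd|]. intros eps He.
  destruct (Hc (eps / 2)) as (dl & Hd & Hp); [lra|].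
  exists dl; split; auto. intros p Fp.
  assert (J <= rsum f c p + eps / 2) by (apply Hlub; intros z Az; eapply Hcross; eauto).
  assert (rsum f c p - eps / 2 <= J).
  { apply Hub. exists dl; split; auto. intros q Fq. specialize (Hp p q Fp Fq). lra. }
  split_Rabs; lra.
Qed.

Lemma HKint_chasles f a b c A B C :
  HKint f a b A -> HKint f b c B -> HKint f a c C -> C = A + B.
Proof.
  intros [Hab HA] [Hbc HB] [_ HC].
  apply cond_eq; intros e He.
  destruct (HA (e / 3)) as (d1 & P1 & Q1); [lra|].
  destruct (HB (e / 3)) as (d2 & P2 & Q2); [lra|].
  destruct (HC (e / 3)) as (d3 & P3 & Q3); [lra|].
  set (dl := fun x => Rmin (d1 x) (Rmin (d2 x) (d3 x))).
  assert (Hdl : forall x, 0 < dl x) by (intro; repeat apply Rmin_pos; auto).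
  destruct (cousin dl a b) as [p Hp]; auto.
  destruct (cousin dl b c) as [q Hq]; auto.
  assert (H3 := fine_part_app _ _ _ _ _ _ Hp Hq).
  specialize (Q1 p (fine_part_min_l _ _ _ _ _ Hp)).
  specialize (Q2 q (fine_part_min_l _ _ _ _ _ (fine_part_min_r _ _ _ _ _ Hq))).
  specialize (Q3 _ (fine_part_min_r _ _ _ _ _ (fine_part_min_r _ _ _ _ _ H3))).
  rewrite (rsum_app dl _ _ b) in Q3 by auto.
  split_Rabs; lra.
Qed.

Definition incr (G : R -> R) (a b : R) : Prop :=
  forall x y, a <= x -> x <= y -> y <= b -> G x <= G y.

(* Perron-type description of the Henstock-Kurzweil primitive: the error
   [f t * (y - t) - (F y - F t)] is controlled by the increments of a monotone
   function of arbitrarily small total variation.  It turns statements about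
   Riemann sums into statements about a single tagged interval. *)
Definition prim (f F : R -> R) (a b : R) : Prop :=
  forall eps, 0 < eps -> exists delta G : R -> R,
    (forall x, 0 < delta x) /\ incr G a b /\ G b - G a <= eps /\
    forall t y, a <= t <= b -> a <= y <= b -> Rabs (y - t) < delta t ->
      Rabs (f t * (y - t) - (F y - F t)) <= Rabs (G y - G t).

(** Each tagged interval is cut at its tag. The errors of the two halves are bounded by the
    increments of [G] over them, and these telescope along the partition. *)
Lemma prim_HKint f F a b : a <= b -> prim f F a b -> HKint f a b (F b - F a).
Proof.
  intros Hab HP. split; [exact Hab|]. intros eps He.
  destruct (HP (eps / 2)) as (dl & G & Hd & HG & HGe & Ht); [lra|].
  exists dl; split; auto.
  assert (H : forall p x, a <= x -> fine_part dl x b p ->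
    Rabs (rsum f x p - (F b - F x)) <= G b - G x).
  { intro p; induction p as [|[t y] p IH]; intros x Hx Hp; simpl in *.
    - subst. split_Rabs; lra.
    - destruct Hp as (H1 & H2 & H3 & H4 & H5).
      assert (H6 := fine_part_le _ _ _ _ H5).
      specialize (IH y ltac:(lra) H5).
      assert (T1 := Ht t x ltac:(lra) ltac:(lra) ltac:(split_Rabs; lra)).
      assert (T2 := Ht t y ltac:(lra) ltac:(lra) ltac:(split_Rabs; lra)).
      assert (I1 := HG x t ltac:(lra) ltac:(lra) ltac:(lra)).
      assert (I2 := HG t y ltac:(lra) ltac:(lra) ltac:(lra)).
      rewrite (Rabs_left1 (G x - G t)) in T1 by lra.
      rewrite (Rabs_pos_eq (G y - G t)) in T2 by lra.
      replace (f t * (y - x) + rsum f y p - (F b - F x)) with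
        ((f t * (y - t) - (F y - F t)) - (f t * (x - t) - (F x - F t))
         + (rsum f y p - (F b - F y))) by ring.
      split_Rabs; lra. }
  intros p Hp. specialize (H p a ltac:(lra) Hp). lra.
Qed.

(** * Major functions and the Saks-Henstock lemma *)

Definition sup (E : R -> Prop) : R := epsilon (inhabits 0) (is_lub E).

Lemma sup_lub E : bound E -> (exists x, E x) -> is_lub E (sup E).
Proof.
  intros H1 H2. unfold sup. apply epsilon_spec.
  destruct (completeness E H1 H2) as [m Hm]. now exists m.
Qed.

(** Perron's major function attached to a gauge: the largest fine Riemann sum over [a,x].
    Concatenation of partitions makes it superadditive in [x]; applied to [- f] it gives, up to
    sign, the minor function. *)
Definition upper_sum (delta f : R -> R) (a x : R) : R :=
  sup (fun z => exists p, fine_part delta a x p /\ z = rsum f a p).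

Section UpperSum.
Variables (delta f : R -> R) (a b M : R).
Hypothesis Hd : forall x, 0 < delta x.
Hypothesis Hab : a <= b.
Hypothesis HM : forall p, fine_part delta a b p -> rsum f a p <= M.

Lemma upper_sum_lub x : a <= x <= b ->
  is_lub (fun z => exists p, fine_part delta a x p /\ z = rsum f a p)
    (upper_sum delta f a x).
Proof.
  intros Hx. apply sup_lub.
  - destruct (cousin delta x b) as [q Hq]; [auto|lra|].
    exists (M - rsum f x q). intros z (p & Hp & ->).
    assert (H := HM _ (fine_part_app _ _ _ _ _ _ Hp Hq)).
    rewrite (rsum_app delta _ _ x) in H by auto. lra.
  - destruct (cousin delta a x) as [q Hq]; [auto|lra|]. eauto.
Qed.

Lemma upper_sum_step x y q : a <= x -> y <= b -> fine_part delta x y q ->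
  upper_sum delta f a x + rsum f x q <= upper_sum delta f a y.
Proof.
  intros Hx Hy Hq. assert (Hxy := fine_part_le _ _ _ _ Hq).
  destruct (upper_sum_lub x) as [_ H1]; [lra|].
  destruct (upper_sum_lub y) as [H2 _]; [lra|].
  assert (upper_sum delta f a x <= upper_sum delta f a y - rsum f x q); [|lra].
  apply H1. intros z (p & Hp & ->).
  assert (rsum f a p + rsum f x q <= upper_sum delta f a y); [|lra].
  apply H2. exists (p ++ q). split; [eapply fine_part_app; eauto|].
  symmetry; eapply rsum_app; eauto.
Qed.

Lemma upper_sum_right : upper_sum delta f a b <= M.
Proof.
  destruct (upper_sum_lub b) as [_ H]; [lra|].
  apply H. intros z (p & Hp & ->). auto.
Qed.

Lemma upper_sum_left : 0 <= upper_sum delta f a a.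
Proof.
  destruct (upper_sum_lub a) as [H _]; [lra|].
  apply H. exists nil. now split.
Qed.
End UpperSum.

(** The Saks-Henstock lemma. With [U] and [L] the major functions of [f] and [- f] for one gauge,
    [U + L] is monotone. It rises by at most eps, since [U b] and [L b] exceed [I] and [- I] by at
    most eps/2. *)
Lemma HKint_prim f a b I : HKint f a b I -> prim f (integral f a) a b.
Proof.
  intros HI eps He. assert (Hab := proj1 HI).
  destruct (proj2 HI (eps / 2)) as (dl & Hd & Hp); [lra|].
  set (U := upper_sum dl f a). set (L := upper_sum dl (fun x => - f x) a).
  assert (HU : forall p, fine_part dl a b p -> rsum f a p <= I + eps / 2).
  { intros p Fp. specialize (Hp p Fp). split_Rabs; lra. }
  assert (HL : forall p, fine_part dl a b p -> rsum (fun x => - f x) a p <= - I + eps / 2).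
  { intros p Fp. specialize (Hp p Fp). rewrite rsum_opp. split_Rabs; lra. }
  assert (SU : forall x y q, a <= x -> y <= b -> fine_part dl x y q ->
    U x + rsum f x q <= U y) by (intros; eapply upper_sum_step; eauto).
  assert (SL : forall x y q, a <= x -> y <= b -> fine_part dl x y q ->
    L x - rsum f x q <= L y).
  { intros x y q H1 H2 H3. unfold Rminus; rewrite <- rsum_opp.
    eapply upper_sum_step; eauto. }
  assert (Hinc : incr (fun x => U x + L x) a b).
  { intros x y H1 H2 H3. destruct (cousin dl x y) as [q Hq]; auto.
    specialize (SU x y q H1 H3 Hq). specialize (SL x y q H1 H3 Hq). lra. }
  exists dl, (fun x => U x + L x). split; [auto|]. split; [auto|]. split.
  { assert (U b <= I + eps / 2) by (eapply upper_sum_right; eauto).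
    assert (L b <= - I + eps / 2) by (eapply upper_sum_right; eauto).
    assert (0 <= U a) by (eapply upper_sum_left; eauto).
    assert (0 <= L a) by (eapply upper_sum_left; eauto). lra. }
  (* Both the candidate value [v] and the true integral over [x,y] lie between [L x - L y] and
     [U y - U x], an interval whose length is the increment of [U + L]. *)
  assert (Hinter : forall x y v, a <= x -> x < y -> y <= b ->
    U x + v <= U y -> L x - v <= L y ->
    Rabs (v - (integral f a y - integral f a x)) <= U y + L y - (U x + L x)).
  { intros x y v Hx Hxy Hy H1 H2.
    destruct (HKint_sub f a b I a x) as [A HA]; try lra; auto.
    destruct (HKint_sub f a b I a y) as [C HC]; try lra; auto.
    destruct (HKint_sub f a b I x y) as [B HB]; try lra; auto.
    rewrite (integral_eq _ _ _ _ HA), (integral_eq _ _ _ _ HC).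
    rewrite (HKint_chasles _ _ _ _ _ _ _ HA HB HC).
    assert (HBU : B <= U y - U x /\ L x - L y <= B).
    { assert (forall e, 0 < e -> B - e <= U y - U x /\ L x - L y <= B + e).
      { intros e Hee. destruct (proj2 HB e Hee) as (d' & Hd' & Hp').
        destruct (cousin (fun x => Rmin (dl x) (d' x)) x y) as [q Hq]; [|lra|].
        { intro; apply Rmin_pos; auto. }
        specialize (Hp' q (fine_part_min_r _ _ _ _ _ Hq)).
        apply fine_part_min_l in Hq.
        specialize (SU x y q Hx Hy Hq). specialize (SL x y q Hx Hy Hq).
        split_Rabs; lra. }
      split; apply le_epsilon; intros e Hee; specialize (H e Hee); lra. }
    split_Rabs; lra. }
  intros t y Ht Hy Hty. pose proof (Hd t) as Hdt.
  destruct (Rtotal_order t y) as [Hlt|[->|Hgt]].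
  - assert (Fq : fine_part dl t y [(t, y)]) by (simpl; split_Rabs; lra).
    assert (H1 := SU t y _ ltac:(lra) ltac:(lra) Fq).
    assert (H2 := SL t y _ ltac:(lra) ltac:(lra) Fq). simpl in H1, H2.
    rewrite (Rabs_pos_eq (_ + _ - _)).
    + apply Hinter; lra.
    + assert (H := Hinc t y ltac:(lra) ltac:(lra) ltac:(lra)). simpl in H. lra.
  - replace (f y * (y - y) - (integral f a y - integral f a y)) with 0 by ring.
    rewrite Rabs_R0. apply Rabs_pos.
  - assert (Fq : fine_part dl y t [(t, t)]) by (simpl; split_Rabs; lra).
    assert (H1 := SU y t _ ltac:(lra) ltac:(lra) Fq).
    assert (H2 := SL y t _ ltac:(lra) ltac:(lra) Fq). simpl in H1, H2.
    assert (H := Hinc y t ltac:(lra) ltac:(lra) ltac:(lra)). simpl in H.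
    rewrite (Rabs_left1 (U y + _ - _)) by lra.
    rewrite <- Rabs_Ropp.
    replace (- (f t * (y - t) - (integral f a y - integral f a t))) with
      (f t * (t - y) - (integral f a t - integral f a y)) by ring.
    replace (- (U y + L y - (U t + L t))) with (U t + L t - (U y + L y)) by ring.
    apply Hinter; lra.
Qed.

Lemma incr_abs_plus G H a b t y :
  incr G a b -> incr H a b -> a <= t <= b -> a <= y <= b ->
  Rabs (G y - G t) + Rabs (H y - H t) = Rabs (G y + H y - (G t + H t)).
Proof.
  intros HG HH Ht Hy. destruct (Rle_dec t y).
  - assert (A := HG t y ltac:(lra) ltac:(lra) ltac:(lra)).
    assert (B := HH t y ltac:(lra) ltac:(lra) ltac:(lra)). split_Rabs; lra.
  - assert (A := HG y t ltac:(lra) ltac:(lra) ltac:(lra)).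
    assert (B := HH y t ltac:(lra) ltac:(lra) ltac:(lra)). split_Rabs; lra.
Qed.

Lemma incr_plus G H a b : incr G a b -> incr H a b -> incr (fun x => G x + H x) a b.
Proof. intros HG HH x y H1 H2 H3. apply Rplus_le_compat; auto. Qed.

Lemma incr_scal c G a b : 0 <= c -> incr G a b -> incr (fun x => c * G x) a b.
Proof. intros Hc HG x y H1 H2 H3. apply Rmult_le_compat_l; auto. Qed.

Lemma incr_abs_scal c (G : R -> R) t y : 0 <= c ->
  c * Rabs (G y - G t) = Rabs (c * G y - c * G t).
Proof.
  intros Hc. rewrite <- Rmult_minus_distr_l, Rabs_mult, (Rabs_pos_eq c); auto.
Qed.

Lemma prim_intro C f F a b : 0 <= C ->
  (forall eps, 0 < eps -> exists delta G : R -> R,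
    (forall x, 0 < delta x) /\ incr G a b /\ G b - G a <= C * eps /\
    forall t y, a <= t <= b -> a <= y <= b -> Rabs (y - t) < delta t ->
      Rabs (f t * (y - t) - (F y - F t)) <= Rabs (G y - G t)) ->
  prim f F a b.
Proof.
  intros HC H eps He.
  assert (He' : 0 < eps / (C + 1)) by (apply Rdiv_lt_0_compat; lra).
  destruct (H _ He') as (dl & G & Hd & HG & HGe & Ht).
  exists dl, G. repeat split; auto.
  apply Rle_trans with (1 := HGe).
  apply Rmult_le_reg_r with (C + 1); [lra|].
  replace (C * (eps / (C + 1)) * (C + 1)) with (C * eps) by (field; lra). lra.
Qed.

Lemma prim_sub f F a b c d : prim f F a b -> a <= c -> c <= d -> d <= b -> prim f F c d.
Proof.
  intros HP Hac Hcd Hdb eps He.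
  destruct (HP eps He) as (dl & G & Hd & HG & HGe & Ht).
  exists dl, G. split; [auto|]. split; [|split].
  - intros x y H1 H2 H3; apply HG; lra.
  - assert (A := HG a c ltac:(lra) ltac:(lra) ltac:(lra)).
    assert (B := HG d b ltac:(lra) ltac:(lra) ltac:(lra)). lra.
  - intros t y H1 H2 H3. apply Ht; auto; lra.
Qed.

Lemma prim_ext f g F G a b :
  (forall x, a <= x <= b -> f x = g x) -> (forall x, a <= x <= b -> F x = G x) ->
  prim f F a b -> prim g G a b.
Proof.
  intros Hf HF HP eps He. destruct (HP eps He) as (dl & H & Hd & HG & HGe & Ht).
  exists dl, H. repeat split; auto.
  intros t y H1 H2 H3. rewrite <- Hf, <- !HF by auto. auto.
Qed.

Lemma prim_ext_l f g F a b :
  (forall x, a <= x <= b -> f x = g x) -> prim f F a b -> prim g F a b.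
Proof. intros H. apply prim_ext; auto. Qed.

Lemma prim_plus f F g G a b :
  prim f F a b -> prim g G a b -> prim (fun x => f x + g x) (fun x => F x + G x) a b.
Proof.
  intros HF HG. apply prim_intro with 2; [lra|]. intros eps He.
  destruct (HF eps He) as (d1 & G1 & Hd1 & I1 & E1 & T1).
  destruct (HG eps He) as (d2 & G2 & Hd2 & I2 & E2 & T2).
  exists (fun x => Rmin (d1 x) (d2 x)), (fun x => G1 x + G2 x).
  split; [intro; apply Rmin_pos; auto|]. split; [now apply incr_plus|].
  split; [lra|]. intros t y Ht Hy Hty.
  rewrite <- (incr_abs_plus G1 G2 a b) by auto.
  assert (A := T1 t y Ht Hy (Rlt_le_trans _ _ _ Hty (Rmin_l _ _))).
  assert (B := T2 t y Ht Hy (Rlt_le_trans _ _ _ Hty (Rmin_r _ _))).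
  replace ((f t + g t) * (y - t) - (F y + G y - (F t + G t))) with
    ((f t * (y - t) - (F y - F t)) + (g t * (y - t) - (G y - G t))) by ring.
  eapply Rle_trans; [apply Rabs_triang|]. lra.
Qed.

Lemma prim_scal c f F a b : prim f F a b -> prim (fun x => c * f x) (fun x => c * F x) a b.
Proof.
  intros HF. apply prim_intro with (Rabs c); [apply Rabs_pos|]. intros eps He.
  destruct (HF eps He) as (d1 & G1 & Hd1 & I1 & E1 & T1).
  exists d1, (fun x => Rabs c * G1 x). split; [auto|].
  split; [apply incr_scal; auto; apply Rabs_pos|]. split.
  { rewrite <- Rmult_minus_distr_l. apply Rmult_le_compat_l; auto. apply Rabs_pos. }
  intros t y Ht Hy Hty. rewrite <- incr_abs_scal by apply Rabs_pos.
  replace (c * f t * (y - t) - (c * F y - c * F t)) with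
    (c * (f t * (y - t) - (F y - F t))) by ring.
  rewrite Rabs_mult. apply Rmult_le_compat_l; auto. apply Rabs_pos.
Qed.

Lemma prim_opp f F a b : prim f F a b -> prim (fun x => - f x) (fun x => - F x) a b.
Proof.
  intro H. apply (prim_scal (-1)) in H.
  revert H; apply prim_ext; intros; ring.
Qed.

Lemma prim_minus f F g G a b :
  prim f F a b -> prim g G a b -> prim (fun x => f x - g x) (fun x => F x - G x) a b.
Proof.
  intros HF HG. apply prim_opp in HG. generalize (prim_plus _ _ _ _ _ _ HF HG).
  apply prim_ext; intros; ring.
Qed.

Lemma prim_integral f F a b : a <= b -> prim f F a b -> integral f a b = F b - F a.
Proof. intros. now apply integral_eq, prim_HKint. Qed.

Lemma rsum_ge0 delta f a b p : (forall x, a <= x <= b -> 0 <= f x) ->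
  fine_part delta a b p -> 0 <= rsum f a p.
Proof.
  revert a; induction p as [|[t x] p IH]; intros a Hf Hp; simpl in *; [lra|].
  destruct Hp as (H1 & H2 & H3 & H4 & H5). assert (H6 := fine_part_le _ _ _ _ H5).
  assert (0 <= f t * (x - a)) by (apply Rmult_le_pos; [apply Hf|]; lra).
  assert (0 <= rsum f x p); [|lra]. apply IH; auto. intros; apply Hf; lra.
Qed.

Lemma prim_ge0 f F a b : a <= b -> prim f F a b ->
  (forall x, a <= x <= b -> 0 <= f x) -> 0 <= F b - F a.
Proof.
  intros Hab HF Hf. apply prim_HKint in HF; auto.
  apply le_epsilon. intros e He.
  destruct (proj2 HF e He) as (dl & Hd & Hp).
  destruct (cousin dl a b) as [p Fp]; auto.
  specialize (Hp p Fp). assert (H := rsum_ge0 _ _ _ _ _ Hf Fp).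
  split_Rabs; lra.
Qed.

Lemma prim_le f F g G a b : a <= b -> prim f F a b -> prim g G a b ->
  (forall x, a <= x <= b -> f x <= g x) -> F b - F a <= G b - G a.
Proof.
  intros Hab HF HG Hfg.
  assert (H := prim_ge0 _ _ _ _ Hab (prim_minus _ _ _ _ _ _ HG HF)).
  simpl in H. assert (forall x, a <= x <= b -> 0 <= g x - f x) by
    (intros x Hx; specialize (Hfg x Hx); lra).
  specialize (H H0). lra.
Qed.

Lemma prim_le_sub f F g G a b x y : prim f F a b -> prim g G a b ->
  (forall x, a <= x <= b -> f x <= g x) -> a <= x -> x <= y -> y <= b ->
  F y - F x <= G y - G x.
Proof.
  intros HF HG Hfg Hx Hxy Hy.
  apply (prim_le f F g G x y); auto; try (eapply prim_sub; eauto).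
  intros z Hz; apply Hfg; lra.
Qed.

Lemma prim_ge0_incr f F a b : prim f F a b ->
  (forall x, a <= x <= b -> 0 <= f x) -> incr F a b.
Proof.
  intros HF Hf x y Hx Hxy Hy.
  assert (0 <= F y - F x); [|lra].
  apply (prim_ge0 f); auto; [eapply prim_sub; eauto|]. intros; apply Hf; lra.
Qed.

Lemma prim_abs_le_sub f F u U a b x y : prim f F a b -> prim u U a b ->
  (forall x, a <= x <= b -> Rabs (f x) <= u x) -> a <= x <= b -> a <= y <= b ->
  Rabs (F y - F x) <= Rabs (U y - U x).
Proof.
  intros HF HU Hfu.
  assert (K : forall x y, a <= x -> x <= y -> y <= b -> Rabs (F y - F x) <= U y - U x).
  { intros p q Hp Hpq Hq.
    assert (A : F q - F p <= U q - U p).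
    { apply (prim_le_sub f F u U a b); auto.
      intros z Hz; specialize (Hfu z Hz); split_Rabs; lra. }
    assert (B : (- F q) - (- F p) <= U q - U p).
    { apply (prim_le_sub (fun x => - f x) (fun x => - F x) u U a b); auto.
      - now apply prim_opp.
      - intros z Hz; specialize (Hfu z Hz); split_Rabs; lra. }
    split_Rabs; lra. }
  intros Hx Hy. destruct (Rle_dec x y).
  - specialize (K x y). split_Rabs; lra.
  - specialize (K y x). split_Rabs; lra.
Qed.

(** The gauge integral integrates every derivative: differentiability at the tag gives an error of
    at most [eps * Rabs (y - t)], an increment of the linear function [eps * x]. Integrability of
    [f] is part of the conclusion. *)
Lemma prim_derive f F a b :
  (forall x, a <= x <= b -> is_derive F x (f x)) -> prim f F a b.
Proof.
  intros HF. destruct (Rle_dec a b) as [Hab|Hab].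
  2:{ intros eps He. exists (fun _ => 1), (fun _ => 0).
      split; [intro; lra|]. split; [intros x y; lra|]. split; [lra|]. intros; lra. }
  apply prim_intro with (b - a); [lra|]. intros eps He.
  assert (H : forall x, exists d, 0 < d /\ (a <= x <= b -> forall y, Rabs (y - x) < d ->
    Rabs (f x * (y - x) - (F y - F x)) <= eps * Rabs (y - x))).
  { intro x. destruct (classic (a <= x <= b)) as [Hx|Hx].
    - destruct (HF x Hx) as [_ H]. specialize (H x (fun P HP => HP) (mkposreal eps He)).
      destruct H as [d Hd]. exists d. split; [apply cond_pos|]. intros _ y Hy.
      specialize (Hd y Hy). simpl in Hd.
      unfold norm, minus, plus, opp, scal in Hd; simpl in Hd.
      unfold abs, mult in Hd; simpl in Hd.
      rewrite <- Rabs_Ropp.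
      replace (- (f x * (y - x) - (F y - F x))) with (F y + - F x + - ((y + - x) * f x)) by ring.
      exact Hd.
    - exists 1. split; [lra|]. tauto. }
  apply ClassicalEpsilon.choice in H. destruct H as [dl Hdl].
  exists dl, (fun x => eps * x). split; [apply Hdl|]. split.
  { intros x y _ Hxy _. apply Rmult_le_compat_l; lra. }
  split; [lra|]. intros t y Ht Hy Hty.
  rewrite <- (incr_abs_scal eps (fun x => x)) by lra. apply Hdl; auto.
Qed.

Lemma prim_continuous f F a b t : prim f F a b -> a <= t <= b ->
  forall eps, 0 < eps -> exists eta, 0 < eta /\
    forall y, a <= y <= b -> Rabs (y - t) < eta -> Rabs (F y - F t) < eps.
Proof.
  intros HF Ht eps He.
  destruct (HF (eps / 2)) as (dl & G & Hd & HG & HGe & HT); [lra|].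
  set (c := Rabs (f t) + 1).
  assert (Hc : 0 < c) by (unfold c; assert (H := Rabs_pos (f t)); lra).
  exists (Rmin (dl t) (eps / 2 / c)). split.
  { apply Rmin_pos; auto. apply Rdiv_lt_0_compat; lra. }
  intros y Hy Hty.
  assert (A := HT t y Ht Hy (Rlt_le_trans _ _ _ Hty (Rmin_l _ _))).
  assert (B := Rlt_le_trans _ _ _ Hty (Rmin_r _ _)).
  assert (C : Rabs (f t * (y - t)) < eps / 2).
  { rewrite Rabs_mult. apply Rle_lt_trans with (c * Rabs (y - t)).
    - apply Rmult_le_compat_r; [apply Rabs_pos|unfold c; lra].
    - apply Rmult_lt_compat_l with (r := c) in B; auto.
      replace (c * (eps / 2 / c)) with (eps / 2) in B by (field; lra). exact B. }
  assert (D : Rabs (G y - G t) <= eps / 2).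
  { destruct (Rle_dec t y).
    - assert (H1 := HG a t ltac:(lra) ltac:(lra) ltac:(lra)).
      assert (H2 := HG t y ltac:(lra) ltac:(lra) ltac:(lra)).
      assert (H3 := HG y b ltac:(lra) ltac:(lra) ltac:(lra)). split_Rabs; lra.
    - assert (H1 := HG a y ltac:(lra) ltac:(lra) ltac:(lra)).
      assert (H2 := HG y t ltac:(lra) ltac:(lra) ltac:(lra)).
      assert (H3 := HG t b ltac:(lra) ltac:(lra) ltac:(lra)). split_Rabs; lra. }
  split_Rabs; lra.
Qed.

(** Continuity relative to [a,b], so one-sided at the endpoints. [continuous] would also constrain
    values outside the interval, about which a primitive says nothing. *)
Definition cont_on (f : R -> R) (a b : R) : Prop :=
  forall x, a <= x <= b -> forall eps, 0 < eps -> exists eta, 0 < eta /\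
    forall y, a <= y <= b -> Rabs (y - x) < eta -> Rabs (f y - f x) < eps.

Lemma cont_on_continuous (f : R -> R) a b :
  (forall x, a <= x <= b -> continuous f x) -> cont_on f a b.
Proof.
  intros H x Hx eps He. specialize (H x Hx).
  apply continuity_pt_filterlim in H.
  destruct (H eps He) as (al & Hal & Hc).
  exists al; split; auto. intros y Hy Hyx.
  destruct (Req_dec y x) as [->|Hne].
  - rewrite Rminus_diag, Rabs_R0; auto.
  - apply Hc. split; auto. split; [exact I|auto].
Qed.

Lemma cont_on_clamp f a b : a <= b -> cont_on f a b ->
  forall x, continuous (fun x => f (Rmax a (Rmin b x))) x.
Proof.
  intros Hab Hf x. apply continuity_pt_filterlim. intros eps He.
  assert (Hcl : forall z, a <= Rmax a (Rmin b z) <= b).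
  { intro z; unfold Rmax, Rmin; repeat destruct Rle_dec; lra. }
  destruct (Hf _ (Hcl x) eps He) as (eta & Heta & H).
  exists eta; split; auto. intros y [_ Hy]. apply H; auto.
  apply Rle_lt_trans with (2 := Hy). simpl. unfold R_dist.
  unfold Rmax, Rmin; repeat destruct Rle_dec; split_Rabs; lra.
Qed.

Lemma prim_cont_on f a b : a <= b -> cont_on f a b -> exists F, prim f F a b.
Proof.
  intros Hab Hf. assert (Hc := cont_on_clamp f a b Hab Hf).
  set (g := fun x => f (Rmax a (Rmin b x))) in Hc.
  exists (RInt g a). apply prim_ext_l with g.
  { intros x Hx. unfold g. f_equal. unfold Rmax, Rmin; repeat destruct Rle_dec; lra. }
  apply prim_derive. intros x Hx. apply (is_derive_RInt g (RInt g a) a x).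
  - exists (mkposreal 1 Rlt_0_1). intros y _. apply (RInt_correct (V := R_CompleteNormedModule)).
    apply (ex_RInt_continuous (V := R_CompleteNormedModule)). intros; apply Hc.
  - apply Hc.
Qed.

Lemma prim_point f c a b : a <= b -> (forall x, a <= x <= b -> x <> c -> f x = 0) ->
  prim f (fun _ => 0) a b.
Proof.
  intros Hab Hf. apply prim_intro with (2 * Rabs (f c)).
  { assert (H := Rabs_pos (f c)); lra. }
  intros eps He.
  (* The identity clipped to [c - eps, c + eps]. From [c] to a nearby [y] it rises by exactly
     [y - c], which pays for the arbitrary value [f c], while its total rise is at most 2 eps. *)
  set (cl := fun x => Rmax (c - eps) (Rmin (c + eps) x)).
  exists (fun _ => eps), (fun x => Rabs (f c) * cl x).
  split; [auto|]. split.
  { apply incr_scal; [apply Rabs_pos|]. intros x y _ Hxy _. unfold cl, Rmax, Rmin.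
    repeat destruct Rle_dec; lra. }
  split.
  { rewrite <- Rmult_minus_distr_l.
    replace (2 * Rabs (f c) * eps) with (Rabs (f c) * (2 * eps)) by ring.
    apply Rmult_le_compat_l; [apply Rabs_pos|].
    unfold cl, Rmax, Rmin; repeat destruct Rle_dec; lra. }
  intros t y Ht Hy Hty. rewrite <- incr_abs_scal by apply Rabs_pos.
  destruct (Req_dec t c) as [->|Hne].
  - replace (f c * (y - c) - (0 - 0)) with (f c * (y - c)) by ring.
    rewrite Rabs_mult. apply Rmult_le_compat_l; [apply Rabs_pos|].
    unfold cl, Rmax, Rmin; repeat destruct Rle_dec; split_Rabs; lra.
  - rewrite Hf by auto. replace (0 * (y - t) - (0 - 0)) with 0 by ring.
    rewrite Rabs_R0. apply Rmult_le_pos; apply Rabs_pos.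
Qed.

Lemma prim_ext_point f g F c a b : a <= b ->
  (forall x, a <= x <= b -> x <> c -> f x = g x) -> prim f F a b -> prim g F a b.
Proof.
  intros Hab Hfg HF.
  assert (H : prim (fun x => g x - f x) (fun _ => 0) a b).
  { apply prim_point with c; auto. intros x Hx Hc. rewrite Hfg by auto. ring. }
  generalize (prim_plus _ _ _ _ _ _ HF H). apply prim_ext; intros; ring.
Qed.

(** * Total variation and the primitive of the absolute value *)

Fixpoint chain (p : R) (l : list R) : Prop :=
  match l with nil => True | q :: l' => p <= q /\ chain q l' end.

(** The variation of [F] over the nodes of [l] to the left of [x], the last piece being cut off at
    [x]. Keeping [x] variable turns a lower approximation of the total variation into a function
    whose increments can be compared with it. *)
Fixpoint var_along (F : R -> R) (p : R) (l : list R) (x : R) : R :=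
  match l with
  | nil => Rabs (F x - F p)
  | q :: l' => if Rle_dec x q then Rabs (F x - F p)
               else Rabs (F q - F p) + var_along F q l' x
  end.

Lemma var_along_self F p l : chain p l -> var_along F p l p = 0.
Proof.
  destruct l as [|q l]; simpl; intro H.
  - rewrite Rminus_diag; apply Rabs_R0.
  - destruct Rle_dec; [rewrite Rminus_diag; apply Rabs_R0|lra].
Qed.

Lemma var_along_le F D b l : forall p, chain p l ->
  (forall x y, p <= x -> x <= y -> y <= b -> Rabs (F y - F x) <= D y - D x) ->
  forall x y, p <= x -> x <= y -> y <= b ->
    var_along F p l y - var_along F p l x <= D y - D x.
Proof.
  induction l as [|q l IH]; intros p Hl HD x y Hx Hxy Hy; simpl in *.
  - specialize (HD x y Hx Hxy Hy). split_Rabs; lra.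
  - destruct Hl as [Hpq Hl].
    assert (HD' : forall x y, q <= x -> x <= y -> y <= b -> Rabs (F y - F x) <= D y - D x)
      by (intros; apply HD; lra).
    specialize (IH q Hl HD').
    repeat destruct Rle_dec; try lra.
    + specialize (HD x y Hx Hxy Hy). split_Rabs; lra.
    + assert (A := IH q y ltac:(lra) ltac:(lra) ltac:(lra)).
      rewrite var_along_self in A by auto.
      assert (B := HD x q ltac:(lra) ltac:(lra) ltac:(lra)). split_Rabs; lra.
    + assert (A := IH x y ltac:(lra) ltac:(lra) ltac:(lra)). lra.
Qed.

Lemma var_along_extend F l : forall p x y, chain p l -> p <= x -> x <= y ->
  exists l', chain p l' /\ var_along F p l' y = var_along F p l x + Rabs (F y - F x).
Proof.
  induction l as [|q l IH]; intros p x y Hl Hpx Hxy; simpl in *.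
  - exists [x]. simpl. split; [auto|]. destruct Rle_dec; [|lra].
    replace y with x by lra. rewrite Rminus_diag, Rabs_R0; lra.
  - destruct Hl as [Hpq Hl]. destruct (Rle_dec x q) as [Hxq|Hxq].
    + exists [x]. simpl. split; [auto|]. destruct Rle_dec; [|lra].
      replace y with x by lra. rewrite Rminus_diag, Rabs_R0; lra.
    + destruct (IH q x y Hl ltac:(lra) Hxy) as (l' & Hl' & E).
      exists (q :: l'). simpl. split; [auto|]. destruct Rle_dec; lra.
Qed.

(** Between two consecutive nodes [var_along] is a constant plus [Rabs (F x - F q)], [q] being the
    left node, and the reverse triangle inequality applies. The gauge at [t] keeps [y] on the same
    side of every node other than [t] itself. *)
Lemma var_along_gauge F l : forall p, chain p l -> exists delta : R -> R,
  (forall x, 0 < delta x) /\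
  forall t y, p <= t -> p <= y -> Rabs (y - t) < delta t ->
    Rabs (var_along F p l y - var_along F p l t) <= Rabs (F y - F t).
Proof.
  induction l as [|q l IH]; intros p Hl; simpl in *.
  - exists (fun _ => 1). split; [intro; lra|]. intros; split_Rabs; lra.
  - destruct Hl as [Hpq Hl]. destruct (IH q Hl) as (dl & Hd & H).
    exists (fun t => if Req_dec_T t q then dl t else Rmin (Rabs (t - q)) (dl t)).
    split.
    + intro x. destruct Req_dec_T; auto. apply Rmin_pos; auto. apply Rabs_pos_lt; lra.
    + intros t y Ht Hy Hty. destruct Req_dec_T as [->|Hne].
      * destruct (Rle_dec q q); [|lra]. destruct Rle_dec; [split_Rabs; lra|].
        specialize (H q y ltac:(lra) ltac:(lra) Hty). rewrite var_along_self in H by auto.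
        split_Rabs; lra.
      * assert (A := Rlt_le_trans _ _ _ Hty (Rmin_l _ _)).
        assert (B := Rlt_le_trans _ _ _ Hty (Rmin_r _ _)).
        repeat destruct Rle_dec.
        -- split_Rabs; lra.
        -- exfalso; split_Rabs; lra.
        -- exfalso; split_Rabs; lra.
        -- specialize (H t y ltac:(lra) ltac:(lra) B). split_Rabs; lra.
Qed.

(** The primitive is the total variation [V] of [F], finite because [U] dominates its increments.
    Locally [Rabs (F y - F t)] is close to [Rabs (f t) * Rabs (y - t)], and it lies between the
    increments of [W] and of [V] in absolute value. The remaining error is thus an increment of
    [V - W], a monotone function. *)
Lemma prim_abs f F u U a b : a <= b -> prim f F a b -> prim u U a b ->
  (forall x, a <= x <= b -> Rabs (f x) <= u x) ->
  exists V, prim (fun x => Rabs (f x)) V a b.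
Proof.
  intros Hab HF HU Hfu.
  assert (HFU : forall x y, a <= x -> x <= y -> y <= b -> Rabs (F y - F x) <= U y - U x).
  { intros x y Hx Hxy Hy.
    assert (A := prim_abs_le_sub f F u U a b x y HF HU Hfu ltac:(lra) ltac:(lra)).
    assert (B : incr U a b).
    { apply (prim_ge0_incr u); auto. intros z Hz. specialize (Hfu z Hz).
      assert (C := Rabs_pos (f z)). lra. }
    specialize (B x y Hx Hxy Hy). rewrite (Rabs_pos_eq (U y - U x)) in A by lra. lra. }
  set (E := fun x z => exists l, chain a l /\ z = var_along F a l x).
  set (V := fun x => sup (E x)).
  assert (HV : forall x, a <= x <= b -> is_lub (E x) (V x)).
  { intros x Hx. apply sup_lub.
    - exists (U x - U a). intros z (l & Hl & ->).
      assert (A := var_along_le F U b l a Hl HFU a x ltac:(lra) ltac:(lra) ltac:(lra)).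
      rewrite var_along_self in A by auto. lra.
    - exists (var_along F a nil x). exists nil. now split. }
  assert (HVF : forall x y, a <= x -> x <= y -> y <= b -> Rabs (F y - F x) <= V y - V x).
  { intros x y Hx Hxy Hy. destruct (HV x) as [_ H1]; [lra|]. destruct (HV y) as [H2 _]; [lra|].
    assert (V x <= V y - Rabs (F y - F x)); [|lra]. apply H1. intros z (l & Hl & ->).
    destruct (var_along_extend F l a x y Hl Hx Hxy) as (l' & Hl' & E').
    assert (var_along F a l' y <= V y); [|lra]. apply H2. now exists l'. }
  exists V. apply prim_intro with 2; [lra|]. intros eps He.
  destruct (HF eps He) as (d1 & G1 & Hd1 & I1 & E1 & T1).
  (* One nearly optimal list of nodes on the whole interval suffices: since [V - W] is increasing, a
     deficit below eps at [b] bounds its total rise. *)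
  assert (Hl : exists l, chain a l /\ V b - eps < var_along F a l b).
  { apply NNPP; intro Hn. destruct (HV b) as [_ H1]; [lra|].
    assert (V b <= V b - eps); [|lra]. apply H1. intros z (l & Hl & ->).
    apply Rnot_lt_le; intro; apply Hn; eauto. }
  destruct Hl as (l & Hl & Hlb).
  destruct (var_along_gauge F l a Hl) as (d2 & Hd2 & T2).
  set (W := var_along F a l) in *.
  assert (I2 : incr (fun x => V x - W x) a b).
  { intros x y Hx Hxy Hy. assert (A := var_along_le F V b l a Hl HVF x y Hx Hxy Hy).
    unfold W; lra. }
  exists (fun x => Rmin (d1 x) (d2 x)), (fun x => G1 x + (V x - W x)).
  split; [intro; apply Rmin_pos; auto|]. split; [now apply incr_plus|]. split.
  { assert (Va : 0 <= V a).
    { destruct (HV a) as [H1 _]; [lra|]. apply H1. exists nil. split; [exact I|].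
      simpl. rewrite Rminus_diag, Rabs_R0; auto. }
    assert (W a = 0) by (apply var_along_self; auto). lra. }
  intros t y Ht Hy Hty.
  assert (A := T1 t y Ht Hy (Rlt_le_trans _ _ _ Hty (Rmin_l _ _))).
  assert (B := T2 t y ltac:(lra) ltac:(lra) (Rlt_le_trans _ _ _ Hty (Rmin_r _ _))).
  rewrite <- (incr_abs_plus G1 (fun x => V x - W x) a b) by auto.
  assert (C : Rabs (Rabs (f t) * Rabs (y - t) - Rabs (F y - F t)) <= Rabs (G1 y - G1 t)).
  { rewrite <- Rabs_mult. eapply Rle_trans; [apply Rabs_triang_inv2|]. exact A. }
  destruct (Rle_dec t y).
  - assert (D := HVF t y ltac:(lra) ltac:(lra) ltac:(lra)).
    rewrite (Rabs_pos_eq (y - t)) in C by lra. split_Rabs; lra.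
  - assert (D := HVF y t ltac:(lra) ltac:(lra) ltac:(lra)).
    rewrite (Rabs_left1 (y - t)) in C by lra.
    replace (Rabs (f t) * (y - t)) with (- (Rabs (f t) * - (y - t))) by ring.
    set (w := Rabs (f t) * - (y - t)) in *. clearbody w. split_Rabs; lra.
Qed.

(** * Convergence theorems *)

Lemma Series_ge0 (a : nat -> R) : (forall n, 0 <= a n) -> ex_series a -> 0 <= Series a.
Proof.
  intros Ha Hs.
  assert (E : forall n, Rabs (a n) = a n) by (intro; apply Rabs_pos_eq; auto).
  assert (H : ex_series (fun n => Rabs (a n))).
  { revert Hs; apply ex_series_ext; intro; now rewrite E. }
  assert (H1 := Series_Rabs a H). rewrite (Series_ext _ _ E) in H1.
  assert (H2 := Rabs_pos (Series a)). lra.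
Qed.

Lemma Series_ge_term (a : nat -> R) k :
  (forall n, 0 <= a n) -> ex_series a -> a k <= Series a.
Proof.
  intros Ha Hs. rewrite (Series_incr_n a (S k)); [|lia|auto].
  assert (H : 0 <= Series (fun n => a (S k + n)%nat)).
  { apply Series_ge0; auto. now apply (ex_series_incr_n a (S k)). }
  change (pred (S k)) with k.
  assert (a k <= sum_f_R0 a k); [|lra].
  destruct k; simpl; [lra|].
  assert (0 <= sum_f_R0 a k) by (apply cond_pos_sum; auto). lra.
Qed.

Lemma is_series_half eps : is_series (fun n => eps * (1/2) ^ S n) eps.
Proof.
  assert (H : is_series (fun n => (1/2) ^ n) (/ (1 - 1/2))).
  { apply is_series_geom. rewrite Rabs_pos_eq; lra. }
  assert (H2 : is_series (fun n => eps / 2 * (1/2) ^ n) (eps / 2 * / (1 - 1/2)))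
    by exact (is_series_scal_l (eps / 2) _ _ H).
  replace (eps / 2 * / (1 - 1 / 2)) with eps in H2 by field.
  revert H2; apply is_series_ext. intro n. simpl. field.
Qed.

(** The k-th primitive receives the share eps / 2^(k+1), and the controlling monotone functions are
    added up. A single [G] then serves all indices, so a later gauge may pick a different index at
    every tag. *)
Lemma prim_family (f F : nat -> R -> R) a b eps : a <= b ->
  (forall k, prim (f k) (F k) a b) -> 0 < eps ->
  exists (delta : nat -> R -> R) (G : R -> R),
    (forall k x, 0 < delta k x) /\ incr G a b /\ G b - G a <= eps /\
    forall k t y, a <= t <= b -> a <= y <= b -> Rabs (y - t) < delta k t ->
      Rabs (f k t * (y - t) - (F k y - F k t)) <= Rabs (G y - G t).
Proof.
  intros Hab HF He.
  assert (H : forall k, exists dG : (R -> R) * (R -> R),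
    (forall x, 0 < fst dG x) /\ incr (snd dG) a b /\
    snd dG b - snd dG a <= eps * (1/2) ^ S k /\
    forall t y, a <= t <= b -> a <= y <= b -> Rabs (y - t) < fst dG t ->
      Rabs (f k t * (y - t) - (F k y - F k t)) <= Rabs (snd dG y - snd dG t)).
  { intro k. destruct (HF k (eps * (1/2) ^ S k)) as (d & G & H).
    - apply Rmult_lt_0_compat; auto. apply pow_lt; lra.
    - now exists (d, G). }
  apply ClassicalEpsilon.choice in H. destruct H as [dG H].
  (* Normalised to vanish at [a]: only the increments are bounded by the geometric shares, and the
     series of functions needs bounded values to converge. *)
  set (H0 := fun k x => snd (dG k) x - snd (dG k) a).
  assert (B : forall k x, a <= x <= b -> 0 <= H0 k x <= eps * (1/2) ^ S k).
  { intros k x Hx. destruct (H k) as (_ & I & E & _). unfold H0.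
    assert (A := I a x ltac:(lra) ltac:(lra) ltac:(lra)).
    assert (C := I x b ltac:(lra) ltac:(lra) ltac:(lra)). lra. }
  assert (Hex : forall x, a <= x <= b -> ex_series (fun k => H0 k x)).
  { intros x Hx. apply (ex_series_le (V := R_CompleteNormedModule)) with (fun n => eps * (1/2) ^ S n).
    - intro n. specialize (B n x Hx). change (Rabs (H0 n x) <= eps * (1/2) ^ S n).
      rewrite Rabs_pos_eq; lra.
    - eexists; apply is_series_half. }
  exists (fun k => fst (dG k)), (fun x => Series (fun k => H0 k x)).
  split; [intros k x; apply (H k)|].
  assert (D : forall k x y, a <= x -> x <= y -> y <= b ->
    H0 k y - H0 k x <= Series (fun k => H0 k y) - Series (fun k => H0 k x)).
  { intros k x y Hx Hxy Hy. rewrite <- Series_minus by (apply Hex; lra).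
    apply (Series_ge_term (fun k => H0 k y - H0 k x)).
    - intro n. destruct (H n) as (_ & I & _). specialize (I x y Hx Hxy Hy). unfold H0; lra.
    - apply (ex_series_minus (V := R_NormedModule)); apply Hex; lra. }
  split; [|split].
  - intros x y Hx Hxy Hy. specialize (D 0%nat x y Hx Hxy Hy).
    destruct (H 0%nat) as (_ & I & _). specialize (I x y Hx Hxy Hy). unfold H0 in *; lra.
  - assert (A : Series (fun k => H0 k b) <= eps).
    { rewrite <- (is_series_unique _ _ (is_series_half eps)).
      apply Series_le; [|eexists; apply is_series_half]. intro n; apply B; lra. }
    assert (C : 0 <= Series (fun k => H0 k a)).
    { apply Series_ge0; [intro; apply B|apply Hex]; lra. }
    lra.
  - intros k t y Ht Hy Hty. destruct (H k) as (_ & I & _ & T).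
    eapply Rle_trans; [apply T; auto|].
    destruct (Rle_dec t y).
    + specialize (D k t y). specialize (I t y). unfold H0 in *. split_Rabs; lra.
    + specialize (D k y t). specialize (I y t). unfold H0 in *. split_Rabs; lra.
Qed.

Lemma seq_incr_le (u : nat -> R) n m : (forall k, u k <= u (S k)) -> (n <= m)%nat -> u n <= u m.
Proof. intros Hu H; induction H; [lra|]. specialize (Hu m); lra. Qed.

Lemma prim_mono_limit (f F : nat -> R -> R) a b C : a <= b ->
  (forall k, prim (f k) (F k) a b) ->
  (forall k x, a <= x <= b -> f k x <= f (S k) x) ->
  (forall k, F k b - F k a <= C) ->
  exists Phi : R -> R, (forall x, a <= x <= b -> is_lim_seq (fun k => F k x - F k a) (Phi x)) /\
    forall k x y, a <= x -> x <= y -> y <= b -> F k y - F k x <= Phi y - Phi x.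
Proof.
  intros Hab HF Hf HC.
  assert (Hm : forall x y, a <= x -> x <= y -> y <= b -> forall k,
    F k y - F k x <= F (S k) y - F (S k) x).
  { intros x y Hx Hxy Hy k. apply (prim_le_sub (f k) _ (f (S k)) _ a b); auto. }
  assert (Hl : forall x, a <= x <= b -> is_lim_seq (fun k => F k x - F k a)
    (real (Lim_seq (fun k => F k x - F k a)))).
  { intros x Hx. apply Lim_seq_correct', (ex_finite_lim_seq_incr _ (C - (F 0%nat b - F 0%nat x))).
    - intro k; apply Hm; lra.
    - intro k. specialize (HC k).
      assert (A := seq_incr_le (fun k => F k b - F k x) 0 k (Hm x b ltac:(lra) ltac:(lra) ltac:(lra)) (Nat.le_0_l k)).
      simpl in A. lra. }
  exists (fun x => real (Lim_seq (fun k => F k x - F k a))). split; [exact Hl|].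
  intros k x y Hx Hxy Hy.
  apply (is_lim_seq_incr_compare (fun k => F k y - F k x)); [|apply Hm; auto].
  assert (A := is_lim_seq_minus' _ _ _ _ (Hl y ltac:(lra)) (Hl x ltac:(lra))).
  revert A; apply is_lim_seq_ext; intro; ring.
Qed.

(** At each tag [t] the gauge is that of an index [k t] for which [f (k t) t] is within eps of
    [g t]. Three errors arise: that of replacing [g t], the Henstock error of [f (k t)], and the gap
    between the increments of [Phi] and [F (k t)]. *)
Lemma monotone_convergence (f F : nat -> R -> R) (g : R -> R) a b C : a <= b ->
  (forall k, prim (f k) (F k) a b) ->
  (forall k x, a <= x <= b -> f k x <= f (S k) x) ->
  (forall k, F k b - F k a <= C) ->
  (forall x, a <= x <= b -> is_lim_seq (fun k => f k x) (g x)) ->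
  exists Phi, prim g Phi a b /\ Phi b - Phi a <= C.
Proof.
  intros Hab HF Hf HC Hg.
  destruct (prim_mono_limit f F a b C) as (Phi & HPhi & Hinc); auto.
  exists Phi. split.
  2:{ assert (A := is_lim_seq_minus' _ _ _ _ (HPhi b ltac:(lra)) (HPhi a ltac:(lra))).
      apply (fun H => is_lim_seq_le _ (fun _ => C) _ (Finite C) H A (is_lim_seq_const C)).
      intro n. specialize (HC n). lra. }
  apply prim_intro with ((b - a) + 1 + 1); [lra|]. intros eps He.
  destruct (prim_family f F a b eps) as (dl & G & Hd & HG & HGe & HT); auto.
  assert (Hk0 : exists k0, (Phi b - Phi a) - (F k0 b - F k0 a) <= eps).
  { assert (A := is_lim_seq_minus' _ _ _ _ (HPhi b ltac:(lra)) (HPhi a ltac:(lra))).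
    apply is_lim_seq_spec in A. destruct (A (mkposreal eps He)) as [N HN].
    exists N. specialize (HN N (le_n _)). simpl in HN. split_Rabs; lra. }
  destruct Hk0 as [k0 Hk0].
  assert (Hk : forall t, exists k, a <= t <= b -> (k0 <= k)%nat /\ Rabs (f k t - g t) <= eps).
  { intro t. destruct (classic (a <= t <= b)) as [Ht|Ht]; [|exists 0%nat; tauto].
    assert (A := Hg t Ht). apply is_lim_seq_spec in A.
    destruct (A (mkposreal eps He)) as [N HN]. exists (N + k0)%nat. intros _.
    split; [lia|]. specialize (HN (N + k0)%nat ltac:(lia)). simpl in HN. lra. }
  apply ClassicalEpsilon.choice in Hk. destruct Hk as [k Hk].
  assert (Hdiff : incr (fun x => Phi x - F k0 x) a b).
  { intros x y Hx Hxy Hy. specialize (Hinc k0 x y Hx Hxy Hy). lra. }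
  assert (Hlin : incr (fun x => eps * x) a b).
  { intros x y _ Hxy _. apply Rmult_le_compat_l; lra. }
  exists (fun t => dl (k t) t), (fun x => (eps * x + G x) + (Phi x - F k0 x)).
  split; [intro; apply Hd|]. split.
  { apply (incr_plus (fun x => eps * x + G x) (fun x => Phi x - F k0 x)); auto.
    now apply incr_plus. }
  split; [lra|].
  intros t y Ht Hy Hty. destruct (Hk t Ht) as [Hkk Hkg].
  specialize (HT (k t) t y Ht Hy Hty).
  rewrite <- (incr_abs_plus (fun x => eps * x + G x) (fun x => Phi x - F k0 x) a b) by
    (auto; now apply incr_plus).
  rewrite <- (incr_abs_plus (fun x => eps * x) G a b) by auto.
  rewrite <- (incr_abs_scal eps (fun x => x)) by lra.
  (* Since [k0 <= k t], the increments of [F (k t)] lie between those of [F k0] and [Phi]. So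
     whichever index was chosen, the gap is charged to the fixed monotone function [Phi - F k0],
     whose total rise is at most eps. *)
  assert (A : Rabs ((Phi y - Phi t) - (F (k t) y - F (k t) t)) <=
              Rabs (Phi y - F k0 y - (Phi t - F k0 t))).
  { assert (Hmon : forall x z, a <= x -> x <= z -> z <= b ->
      F k0 z - F k0 x <= F (k t) z - F (k t) x /\ F (k t) z - F (k t) x <= Phi z - Phi x).
    { intros x z Hx Hxz Hz. split; [|auto].
      apply (seq_incr_le (fun k => F k z - F k x)); auto.
      intro j. apply (prim_le_sub (f j) _ (f (S j)) _ a b); auto. }
    destruct (Rle_dec t y).
    - specialize (Hmon t y). split_Rabs; lra.
    - specialize (Hmon y t). split_Rabs; lra. }
  replace (g t * (y - t) - (Phi y - Phi t)) with
    ((f (k t) t * (y - t) - (F (k t) y - F (k t) t)) - (f (k t) t - g t) * (y - t)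
     - ((Phi y - Phi t) - (F (k t) y - F (k t) t))) by ring.
  assert (B : Rabs ((f (k t) t - g t) * (y - t)) <= eps * Rabs (y - t)).
  { rewrite Rabs_mult. apply Rmult_le_compat_r; [apply Rabs_pos|auto]. }
  unfold Rminus at 1. eapply Rle_trans; [apply Rabs_triang|]. rewrite Rabs_Ropp.
  apply Rplus_le_compat; [|exact A].
  unfold Rminus at 1. eapply Rle_trans; [apply Rabs_triang|]. rewrite Rabs_Ropp. lra.
Qed.

(* "Null" is expressed by: every function supported on the set has primitive [0]. *)
Lemma prim_divergence_set (f F : nat -> R -> R) g a b C : a <= b ->
  (forall k, prim (f k) (F k) a b) ->
  (forall k x, a <= x <= b -> f k x <= f (S k) x) ->
  (forall k x, a <= x <= b -> 0 <= f k x) ->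
  (forall k, F k b - F k a <= C) ->
  (forall x, a <= x <= b -> g x <> 0 -> forall M, exists k, M <= f k x) ->
  prim g (fun _ => 0) a b.
Proof.
  intros Hab HF Hf Hf0 HC Hg.
  destruct (prim_mono_limit f F a b C) as (Phi & HPhi & Hinc); auto.
  assert (HF0 : forall k, incr (F k) a b) by (intro; apply (prim_ge0_incr (f k)); auto).
  assert (IP : incr Phi a b).
  { intros x y Hx Hxy Hy. specialize (Hinc 0%nat x y Hx Hxy Hy).
    specialize (HF0 0%nat x y Hx Hxy Hy). lra. }
  apply prim_intro with (Phi b - Phi a + 1).
  { specialize (IP a b). lra. }
  intros eps He.
  (* A budget of 1 is enough: the index chosen next makes [f (k t) t] at least [Rabs (g t) / eps],
     so the whole estimate is multiplied by eps at the end. *)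
  destruct (prim_family f F a b 1) as (dl & G & Hd & HG & HGe & HT); auto; [lra|].
  assert (Hk : forall t, exists k, a <= t <= b -> g t <> 0 -> Rabs (g t) <= eps * f k t).
  { intro t. destruct (classic (a <= t <= b /\ g t <> 0)) as [[Ht Hgt]|Ht].
    - destruct (Hg t Ht Hgt (Rabs (g t) / eps)) as [k Hk]. exists k. intros _ _.
      apply Rmult_le_compat_l with (r := eps) in Hk; [|lra].
      replace (eps * (Rabs (g t) / eps)) with (Rabs (g t)) in Hk by (field; lra). exact Hk.
    - exists 0%nat. tauto. }
  apply ClassicalEpsilon.choice in Hk. destruct Hk as [k Hk].
  exists (fun t => dl (k t) t), (fun x => eps * (Phi x + G x)).
  split; [intro; apply Hd|]. split; [apply incr_scal; [lra|now apply incr_plus]|].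
  split; [nra|].
  intros t y Ht Hy Hty. rewrite <- (incr_abs_scal eps (fun x => Phi x + G x)) by lra.
  rewrite <- (incr_abs_plus Phi G a b) by auto.
  assert (P1 := Rabs_pos (Phi y - Phi t)). assert (P2 := Rabs_pos (G y - G t)).
  replace (g t * (y - t) - (0 - 0)) with (g t * (y - t)) by ring.
  destruct (Req_dec (g t) 0) as [E|Hgt].
  { rewrite E, Rmult_0_l, Rabs_R0. apply Rmult_le_pos; lra. }
  specialize (HT (k t) t y Ht Hy Hty). specialize (Hk t Ht Hgt).
  rewrite Rabs_mult.
  apply Rle_trans with (eps * f (k t) t * Rabs (y - t)).
  { apply Rmult_le_compat_r; [apply Rabs_pos|auto]. }
  rewrite Rmult_assoc. apply Rmult_le_compat_l; [lra|].
  assert (A : Rabs (F (k t) y - F (k t) t) <= Rabs (Phi y - Phi t)).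
  { destruct (Rle_dec t y).
    - specialize (Hinc (k t) t y). specialize (HF0 (k t) t y). split_Rabs; lra.
    - specialize (Hinc (k t) y t). specialize (HF0 (k t) y t). split_Rabs; lra. }
  rewrite <- (Rabs_pos_eq (f (k t) t)) by auto. rewrite <- Rabs_mult.
  replace (f (k t) t * (y - t)) with
    ((f (k t) t * (y - t) - (F (k t) y - F (k t) t)) + (F (k t) y - F (k t) t)) by ring.
  eapply Rle_trans; [apply Rabs_triang|]. lra.
Qed.

(** Lebesgue integrability as absolute gauge integrability, recorded through primitives rather than
    values so that it restricts to subintervals at once. *)
Definition Lone (f : R -> R) (a b : R) : Prop :=
  exists F V, prim f F a b /\ prim (fun x => Rabs (f x)) V a b.

Section Lone.
Variables a b : R.
Hypothesis Hab : a <= b.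

Lemma Lone_dom f F u U : prim f F a b -> prim u U a b ->
  (forall x, a <= x <= b -> Rabs (f x) <= u x) -> Lone f a b.
Proof.
  intros HF HU H. destruct (prim_abs f F u U a b) as [V HV]; auto. now exists F, V.
Qed.

Lemma Lone_ge0 f F : prim f F a b -> (forall x, a <= x <= b -> 0 <= f x) -> Lone f a b.
Proof.
  intros HF H. apply (Lone_dom f F f F); auto.
  intros x Hx; rewrite Rabs_pos_eq; [lra|auto].
Qed.

Lemma Lone_ext f g : (forall x, a <= x <= b -> f x = g x) -> Lone f a b -> Lone g a b.
Proof.
  intros H (F & V & HF & HV). exists F, V. split.
  - now apply prim_ext_l with f.
  - apply prim_ext_l with (2 := HV). intros x Hx. now rewrite H.
Qed.

Lemma Lone_plus f g : Lone f a b -> Lone g a b -> Lone (fun x => f x + g x) a b.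
Proof.
  intros (F & V & HF & HV) (G & W & HG & HW).
  apply (Lone_dom _ _ _ _ (prim_plus _ _ _ _ _ _ HF HG) (prim_plus _ _ _ _ _ _ HV HW)).
  intros; apply Rabs_triang.
Qed.

Lemma Lone_scal c f : Lone f a b -> Lone (fun x => c * f x) a b.
Proof.
  intros (F & V & HF & HV).
  apply (Lone_dom _ _ _ _ (prim_scal c _ _ _ _ HF) (prim_scal (Rabs c) _ _ _ _ HV)).
  intros. rewrite Rabs_mult; lra.
Qed.

Lemma Lone_minus f g : Lone f a b -> Lone g a b -> Lone (fun x => f x - g x) a b.
Proof.
  intros HF HG. apply (Lone_scal (-1)) in HG. generalize (Lone_plus _ _ HF HG).
  apply Lone_ext; intros; ring.
Qed.

Lemma Lone_abs f : Lone f a b -> Lone (fun x => Rabs (f x)) a b.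
Proof. intros (F & V & HF & HV). apply (Lone_ge0 _ V); auto. intros; apply Rabs_pos. Qed.

Lemma Lone_cont f : cont_on f a b -> Lone f a b.
Proof.
  intros H. destruct (prim_cont_on f a b) as [F HF]; auto.
  destruct (prim_cont_on (fun x => Rabs (f x)) a b) as [V HV]; auto.
  - intros x Hx eps He. destruct (H x Hx eps He) as (eta & Heta & H').
    exists eta; split; auto. intros y Hy Hyx. specialize (H' y Hy Hyx).
    eapply Rle_lt_trans; [apply Rabs_triang_inv2|auto].
  - now exists F, V.
Qed.

Lemma Lone_continuous f : (forall x, a <= x <= b -> continuous f x) -> Lone f a b.
Proof. intro; now apply Lone_cont, cont_on_continuous. Qed.

Lemma Lone_const c : Lone (fun _ => c) a b.
Proof. apply Lone_continuous. intros; apply continuous_const. Qed.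

Lemma Lone_max f g : Lone f a b -> Lone g a b -> Lone (fun x => Rmax (f x) (g x)) a b.
Proof.
  intros HF HG.
  generalize (Lone_scal (/2) _ (Lone_plus _ _ (Lone_plus _ _ HF HG) (Lone_abs _ (Lone_minus _ _ HF HG)))).
  apply Lone_ext. intros x _. unfold Rmax; destruct Rle_dec; split_Rabs; lra.
Qed.

Lemma Lone_min f g : Lone f a b -> Lone g a b -> Lone (fun x => Rmin (f x) (g x)) a b.
Proof.
  intros HF HG.
  generalize (Lone_scal (/2) _ (Lone_minus _ _ (Lone_plus _ _ HF HG) (Lone_abs _ (Lone_minus _ _ HF HG)))).
  apply Lone_ext. intros x _. unfold Rmin; destruct Rle_dec; split_Rabs; lra.
Qed.

Lemma Lone_prim f : Lone f a b -> prim f (integral f a) a b.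
Proof.
  intros (F & V & HF & HV). apply (HKint_prim f a b (F b - F a)). now apply prim_HKint.
Qed.

Lemma Lone_HKint f : Lone f a b -> HKint f a b (integral f a b).
Proof.
  intros HL. assert (HF := Lone_prim f HL). apply prim_HKint in HF; auto.
  now rewrite (integral_eq _ _ _ _ HF) at 1.
Qed.

Lemma integral_plus f g : Lone f a b -> Lone g a b ->
  integral (fun x => f x + g x) a b = integral f a b + integral g a b.
Proof.
  intros (F & ? & HF & _) (G & ? & HG & _).
  rewrite (prim_integral _ _ _ _ Hab (prim_plus _ _ _ _ _ _ HF HG)),
    (prim_integral _ _ _ _ Hab HF), (prim_integral _ _ _ _ Hab HG). ring.
Qed.

Lemma integral_scal c f : Lone f a b ->
  integral (fun x => c * f x) a b = c * integral f a b.
Proof.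
  intros (F & ? & HF & _).
  rewrite (prim_integral _ _ _ _ Hab (prim_scal c _ _ _ _ HF)),
    (prim_integral _ _ _ _ Hab HF). ring.
Qed.

Lemma integral_minus f g : Lone f a b -> Lone g a b ->
  integral (fun x => f x - g x) a b = integral f a b - integral g a b.
Proof.
  intros (F & ? & HF & _) (G & ? & HG & _).
  rewrite (prim_integral _ _ _ _ Hab (prim_minus _ _ _ _ _ _ HF HG)),
    (prim_integral _ _ _ _ Hab HF), (prim_integral _ _ _ _ Hab HG). ring.
Qed.

Lemma integral_ext f g : (forall x, a <= x <= b -> f x = g x) -> Lone f a b ->
  integral f a b = integral g a b.
Proof.
  intros H (F & ? & HF & _). rewrite (prim_integral _ _ _ _ Hab HF).
  symmetry; apply prim_integral; auto. now apply prim_ext_l with f.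
Qed.

Lemma integral_le f g : Lone f a b -> Lone g a b ->
  (forall x, a <= x <= b -> f x <= g x) -> integral f a b <= integral g a b.
Proof.
  intros (F & ? & HF & _) (G & ? & HG & _) H.
  rewrite (prim_integral _ _ _ _ Hab HF), (prim_integral _ _ _ _ Hab HG).
  now apply (prim_le f F g G).
Qed.

Lemma integral_ge0 f : Lone f a b -> (forall x, a <= x <= b -> 0 <= f x) -> 0 <= integral f a b.
Proof.
  intros (F & ? & HF & _) H. rewrite (prim_integral _ _ _ _ Hab HF).
  now apply (prim_ge0 f).
Qed.

Lemma integral_const c : integral (fun _ => c) a b = c * (b - a).
Proof.
  rewrite (prim_integral _ (fun x => c * x)); [ring|auto|].
  apply prim_derive. intros x _. auto_derive; auto; ring.
Qed.

(** Monotone convergence is used twice: downwards, on the negatives of finite minima, to integrate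
    each tail infimum, and upwards along the tail infima, which converge to [g]. The uniform bound
    [C] takes the place of a dominating function and yields integrability of [g] as well. *)
Lemma fatou (f : nat -> R -> R) (g : R -> R) C :
  (forall k, Lone (f k) a b) -> (forall k x, a <= x <= b -> 0 <= f k x) ->
  (forall k, integral (f k) a b <= C) ->
  (forall x, a <= x <= b -> is_lim_seq (fun k => f k x) (g x)) ->
  Lone g a b /\ integral g a b <= C.
Proof.
  intros HL H0 HC Hg.
  (* [m k j x] is the minimum of [f k x], ..., [f (k + j) x]; it decreases in [j] to the tail
     infimum [inf k x]. *)
  set (m := fun k => fix m j x := match j with
    | O => f k x | S j' => Rmin (m j' x) (f (k + S j')%nat x) end).
  assert (mL : forall k j, Lone (m k j) a b).
  { intros k j; induction j as [|j IH]; [apply HL|].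
    apply (Lone_min _ _ IH (HL (k + S j)%nat)). }
  assert (m0 : forall k j x, a <= x <= b -> 0 <= m k j x).
  { intros k j x Hx; induction j as [|j IH]; simpl; [auto|]. apply Rmin_glb; auto. }
  assert (mdec : forall k j x, m k (S j) x <= m k j x) by (intros; apply Rmin_l).
  assert (mshift : forall k j x, m k (S j) x <= m (S k) j x).
  { intros k j x; induction j as [|j IH]; simpl.
    - replace (k + 1)%nat with (S k) by lia. apply Rmin_r.
    - simpl in IH. apply Rmin_glb; [eapply Rle_trans; [apply Rmin_l|apply IH]|].
      replace (k + S (S j))%nat with (S (k + S j))%nat by lia. apply Rmin_r. }
  assert (mlow : forall k j x c, (forall i, (k <= i)%nat -> c <= f i x) -> c <= m k j x).
  { intros k j x c Hc; induction j as [|j IH]; simpl; [auto|].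
    apply Rmin_glb; auto. apply Hc; lia. }
  set (inf := fun k x => real (Lim_seq (fun j => m k j x))).
  assert (Hinf : forall k x, a <= x <= b -> is_lim_seq (fun j => m k j x) (inf k x)).
  { intros k x Hx. apply Lim_seq_correct', (ex_finite_lim_seq_decr _ 0); auto. }
  assert (infle : forall k x, a <= x <= b -> inf k x <= f k x).
  { intros k x Hx. apply (is_lim_seq_decr_compare (fun j => m k j x) (inf k x)) with (n := 0%nat); auto. }
  assert (inflow : forall k x c, a <= x <= b -> (forall i, (k <= i)%nat -> c <= f i x) -> c <= inf k x).
  { intros k x c Hx Hc.
    apply (is_lim_seq_le (fun _ => c) (fun j => m k j x) c (inf k x)); auto.
    apply is_lim_seq_const. }
  assert (infprim : forall k, exists G, prim (inf k) G a b).
  { intro k.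
    destruct (monotone_convergence (fun j x => - m k j x)
      (fun j x => - integral (m k j) a x) (fun x => - inf k x) a b 0) as (G & HG & _); auto.
    - intro j. apply prim_opp, Lone_prim, mL.
    - intros j x Hx. specialize (mdec k j x). lra.
    - intro j. assert (A := prim_ge0 _ _ _ _ Hab (Lone_prim _ (mL k j)) (m0 k j)). lra.
    - intros x Hx. apply (is_lim_seq_opp _ (Finite (inf k x))). auto.
    - exists (fun x => - G x). apply prim_opp in HG. revert HG; apply prim_ext_l; intros; ring. }
  apply ClassicalEpsilon.choice in infprim. destruct infprim as [G HG].
  destruct (monotone_convergence inf G g a b C) as (Phi & HPhi & HPC); auto.
  - intros k x Hx.
    apply (is_lim_seq_le (fun j => m k (S j) x) (fun j => m (S k) j x) (inf k x) (inf (S k) x)); auto.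
    now apply (is_lim_seq_incr_1 (fun j => m k j x)), Hinf.
  - intro k. specialize (HC k).
    assert (A := prim_le _ _ _ _ _ _ Hab (HG k) (Lone_prim _ (HL k)) (infle k)).
    assert (B := prim_integral _ _ _ _ Hab (Lone_prim _ (HL k))). lra.
  - intros x Hx. assert (A := Hg x Hx). apply is_lim_seq_spec in A. apply is_lim_seq_spec.
    intro e. destruct (A e) as [N HN]. assert (He := cond_pos e).
    destruct (A (pos_div_2 e)) as [N2 HN2].
    exists (N + N2)%nat. intros n Hn.
    assert (B : g x - e / 2 <= inf n x).
    { apply inflow; auto. intros i Hi. specialize (HN2 i ltac:(lia)). simpl in HN2. split_Rabs; lra. }
    assert (D := infle n x Hx). specialize (HN n ltac:(lia)). split_Rabs; lra.
  - split; [|now rewrite (prim_integral _ _ _ _ Hab HPhi)].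
    apply (Lone_ge0 g Phi); auto. intros x Hx.
    apply (is_lim_seq_le (fun _ => 0) (fun k => f k x) 0 (g x)); auto. apply is_lim_seq_const.
Qed.
End Lone.

(** * Square-integrable functions *)

(* Maximum of [n] tangents of slope [2 j / d] to the parabola: an approximation
   of [x ^ 2] from below built with lattice operations only. *)
Fixpoint tangent_max (n : nat) (d x : R) : R :=
  match n with
  | O => 0
  | S n' => Rmax (tangent_max n' d x) (2 * (INR n / d) * Rabs x - (INR n / d) ^ 2)
  end.

Lemma tangent_max_bounds n d x : 0 <= tangent_max n d x <= x ^ 2.
Proof.
  induction n as [|n IH]; [simpl; nra|].
  change (tangent_max (S n) d x) with (Rmax (tangent_max n d x)
    (2 * (INR (S n) / d) * Rabs x - (INR (S n) / d) ^ 2)).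
  split; [eapply Rle_trans; [apply IH|apply Rmax_l]|].
  apply Rmax_lub; [apply IH|].
  assert (H := pow2_ge_0 (Rabs x - INR (S n) / d)).
  rewrite <- (pow2_abs x). nra.
Qed.

Lemma tangent_max_ge n d x j : (j <= n)%nat ->
  2 * (INR j / d) * Rabs x - (INR j / d) ^ 2 <= tangent_max n d x.
Proof.
  intro Hj. destruct j as [|j].
  { replace (INR 0 / d) with 0 by (simpl; unfold Rdiv; ring).
    assert (H := tangent_max_bounds n d x). lra. }
  induction Hj; [apply Rmax_r|].
  eapply Rle_trans; [exact IHHj|apply Rmax_l].
Qed.

(** With mesh 1/d and tangents up to abscissa d, where d = k + 1, the tangent at the grid point just
    below |x| misses [x ^ 2] by (|x| - j/d)^2, at most 1/d^2. The choice d > |x| + 1/e both places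
    |x| inside the grid and makes this error smaller than e. *)
Lemma tangent_max_lim x :
  is_lim_seq (fun k => tangent_max (S k * S k) (INR (S k)) x) (x ^ 2).
Proof.
  apply is_lim_seq_spec. intro e. assert (He := cond_pos e).
  destruct (nfloor_ex (Rabs x + / e)) as [N HN].
  { assert (A := Rabs_pos x). assert (B := Rinv_0_lt_compat e He). lra. }
  exists N. intros k Hk. set (d := INR (S k)).
  assert (HNd : Rabs x + / e < d).
  { unfold d. rewrite S_INR. apply le_INR in Hk. lra. }
  assert (Hx := Rabs_pos x). assert (Hie := Rinv_0_lt_compat e He).
  assert (Hd : 0 < d) by lra.
  destruct (nfloor_ex (Rabs x * d)) as [j Hj]; [nra|].
  assert (Hjn : (j <= S k * S k)%nat).
  { apply INR_le. rewrite mult_INR. fold d. nra. }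
  assert (A := tangent_max_ge _ d x j Hjn).
  assert (B := tangent_max_bounds (S k * S k) d x).
  assert (C : 0 <= Rabs x - INR j / d <= / d).
  { split; apply Rmult_le_reg_r with d; auto.
    - replace ((Rabs x - INR j / d) * d) with (Rabs x * d - INR j) by (field; lra). lra.
    - replace ((Rabs x - INR j / d) * d) with (Rabs x * d - INR j) by (field; lra).
      replace (/ d * d) with 1 by (field; lra). lra. }
  assert (D : / d < e).
  { rewrite <- (Rinv_inv e). apply Rinv_lt_contravar; nra. }
  assert (E : 1 <= d) by (unfold d; rewrite S_INR; assert (Z := pos_INR k); lra).
  assert (F : / d <= 1).
  { rewrite <- Rinv_1. apply Rinv_le_contravar; lra. }
  assert (G : x ^ 2 - (2 * (INR j / d) * Rabs x - (INR j / d) ^ 2) =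
    (Rabs x - INR j / d) ^ 2) by (rewrite <- (pow2_abs x); ring).
  assert (K : (Rabs x - INR j / d) ^ 2 < e) by nra.
  rewrite Rabs_left1; lra.
Qed.

Definition L2f (f : R -> R) (a b : R) : Prop :=
  Lone f a b /\ Lone (fun x => f x ^ 2) a b.

Section L2.
Variables a b : R.
Hypothesis Hab : a <= b.

(** This stands in for measurability of a composition: the square is a limit of maxima of affine
    functions of |f|, integrable by the lattice properties, and Fatou's lemma passes to the limit
    below the majorant [u]. *)
Lemma Lone_sq f u : Lone f a b -> Lone u a b ->
  (forall x, a <= x <= b -> f x ^ 2 <= u x) -> Lone (fun x => f x ^ 2) a b.
Proof.
  intros HF HU H.
  assert (HT : forall n d, Lone (fun x => tangent_max n d (f x)) a b).
  { intros n d; induction n as [|n IH]; [apply (Lone_const a b Hab 0)|].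
    apply (Lone_max a b Hab _ (fun x => 2 * (INR (S n) / d) * Rabs (f x) - (INR (S n) / d) ^ 2)); auto.
    apply Lone_minus; auto; [|now apply Lone_const].
    apply Lone_scal; auto. now apply Lone_abs. }
  apply (fatou a b Hab (fun k x => tangent_max (S k * S k) (INR (S k)) (f x)) _ (integral u a b)).
  - intro; apply HT.
  - intros; apply tangent_max_bounds.
  - intro k. apply integral_le; auto. intros x Hx.
    eapply Rle_trans; [apply tangent_max_bounds|auto].
  - intros; apply tangent_max_lim.
Qed.

Lemma Lone_mult_bounded f g M : Lone f a b -> Lone g a b ->
  (forall x, a <= x <= b -> Rabs (f x) <= M) -> (forall x, a <= x <= b -> Rabs (g x) <= M) ->
  Lone (fun x => f x * g x) a b.
Proof.
  intros HF HG Hf Hg.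
  assert (A : Lone (fun x => (f x + g x) ^ 2) a b).
  { apply Lone_sq with (fun _ => 4 * M ^ 2); [now apply Lone_plus|now apply Lone_const|].
    intros x Hx. specialize (Hf x Hx). specialize (Hg x Hx).
    assert (- M <= f x <= M) by (split_Rabs; lra).
    assert (- M <= g x <= M) by (split_Rabs; lra). nra. }
  assert (B : Lone (fun x => (f x - g x) ^ 2) a b).
  { apply Lone_sq with (fun _ => 4 * M ^ 2); [now apply Lone_minus|now apply Lone_const|].
    intros x Hx. specialize (Hf x Hx). specialize (Hg x Hx).
    assert (- M <= f x <= M) by (split_Rabs; lra).
    assert (- M <= g x <= M) by (split_Rabs; lra). nra. }
  generalize (Lone_scal a b Hab (/ 4) _ (Lone_minus a b Hab _ _ A B)).
  apply Lone_ext; intros; field.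
Qed.

Definition clip (n : nat) (x : R) : R := Rmax (- INR n) (Rmin (INR n) x).

Lemma clip_le n x : Rabs (clip n x) <= Rabs x.
Proof.
  assert (H := pos_INR n). unfold clip, Rmax, Rmin.
  repeat destruct Rle_dec; split_Rabs; lra.
Qed.

Lemma clip_bound n x : Rabs (clip n x) <= INR n.
Proof.
  assert (H := pos_INR n). unfold clip, Rmax, Rmin.
  repeat destruct Rle_dec; split_Rabs; lra.
Qed.

Lemma clip_lim x : exists N, forall n, (N <= n)%nat -> clip n x = x.
Proof.
  destruct (nfloor_ex (Rabs x) (Rabs_pos x)) as [N HN]. exists (S N). intros n Hn.
  apply le_INR in Hn. rewrite S_INR in Hn. unfold clip, Rmax, Rmin.
  repeat destruct Rle_dec; split_Rabs; lra.
Qed.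

(** Clipped factors have an integrable product by polarization, and clipping at [n] is eventually
    the identity at each point. Adding [u] makes the products nonnegative, as Fatou's lemma
    requires; it is subtracted again afterwards. *)
Lemma Lone_mult f g u : Lone f a b -> Lone g a b -> Lone u a b ->
  (forall x, a <= x <= b -> Rabs (f x * g x) <= u x) -> Lone (fun x => f x * g x) a b.
Proof.
  intros HF HG HU H.
  assert (HC : forall n h, Lone h a b -> Lone (fun x => clip n (h x)) a b).
  { intros n h Hh. apply Lone_max; auto; [now apply Lone_const|].
    apply Lone_min; auto; now apply Lone_const. }
  assert (HCm : forall n, Lone (fun x => clip n (f x) * clip n (g x)) a b).
  { intro n. apply Lone_mult_bounded with (INR n); auto; intros; apply clip_bound. }
  assert (Hb : forall n x, a <= x <= b -> Rabs (clip n (f x) * clip n (g x)) <= u x).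
  { intros n x Hx. apply Rle_trans with (2 := H x Hx). rewrite !Rabs_mult.
    apply Rmult_le_compat; try apply Rabs_pos; apply clip_le. }
  destruct (fatou a b Hab (fun k x => u x + clip k (f x) * clip k (g x))
    (fun x => u x + f x * g x) (2 * integral u a b)) as [K _].
  - intro k. now apply Lone_plus.
  - intros k x Hx. specialize (Hb k x Hx). split_Rabs; lra.
  - intro k. rewrite <- integral_scal by auto.
    apply integral_le; auto; [now apply Lone_plus|now apply Lone_scal|].
    intros x Hx. specialize (Hb k x Hx). split_Rabs; lra.
  - intros x Hx. apply is_lim_seq_spec. intro e.
    destruct (clip_lim (f x)) as [N1 H1]. destruct (clip_lim (g x)) as [N2 H2].
    exists (N1 + N2)%nat. intros n Hn. rewrite H1, H2 by lia.
    rewrite Rminus_diag, Rabs_R0. apply cond_pos.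
  - generalize (Lone_minus a b Hab _ _ K HU). apply Lone_ext; intros; ring.
Qed.

Lemma L2f_ext f g : (forall x, a <= x <= b -> f x = g x) -> L2f f a b -> L2f g a b.
Proof.
  intros H [H1 H2]. split; [now apply Lone_ext with f|].
  revert H2; apply Lone_ext. intros; now rewrite H.
Qed.

Lemma L2f_mult f g : L2f f a b -> L2f g a b -> Lone (fun x => f x * g x) a b.
Proof.
  intros [H1 H2] [H3 H4]. apply Lone_mult with (fun x => f x ^ 2 + g x ^ 2); auto.
  - now apply Lone_plus.
  - intros x _. assert (A := pow2_ge_0 (f x - g x)). assert (B := pow2_ge_0 (f x + g x)).
    apply Rabs_le. nra.
Qed.

Lemma L2f_plus f g : L2f f a b -> L2f g a b -> L2f (fun x => f x + g x) a b.
Proof.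
  intros HF HG. split; [apply Lone_plus; auto; [apply HF|apply HG]|].
  generalize (Lone_plus a b Hab _ _ (Lone_plus a b Hab _ _ (proj2 HF) (proj2 HG))
    (Lone_scal a b Hab 2 _ (L2f_mult _ _ HF HG))).
  apply Lone_ext; intros; ring.
Qed.

Lemma L2f_scal c f : L2f f a b -> L2f (fun x => c * f x) a b.
Proof.
  intros [H1 H2]. split; [now apply Lone_scal|].
  generalize (Lone_scal a b Hab (c ^ 2) _ H2). apply Lone_ext; intros; ring.
Qed.

Lemma L2f_minus f g : L2f f a b -> L2f g a b -> L2f (fun x => f x - g x) a b.
Proof.
  intros HF HG. generalize (L2f_plus _ _ HF (L2f_scal (-1) _ HG)).
  apply L2f_ext; intros; ring.
Qed.

Lemma L2f_bounded_mult c f M : Lone c a b -> (forall x, a <= x <= b -> Rabs (c x) <= M) ->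
  L2f f a b -> L2f (fun x => c x * f x) a b.
Proof.
  intros Hc HM [H1 H2].
  assert (HM2 : forall x, a <= x <= b -> c x ^ 2 <= M ^ 2).
  { intros x Hx. rewrite <- (pow2_abs (c x)). specialize (HM x Hx).
    assert (A := Rabs_pos (c x)). nra. }
  split.
  - apply Lone_mult with (fun x => M * Rabs (f x)); auto.
    + apply Lone_scal; auto. now apply Lone_abs.
    + intros x Hx. rewrite Rabs_mult. apply Rmult_le_compat_r; auto. apply Rabs_pos.
  - apply Lone_ext with (fun x => c x ^ 2 * f x ^ 2); [intros; ring|].
    apply Lone_mult with (fun x => M ^ 2 * f x ^ 2); auto.
    + apply Lone_sq with (fun _ => M ^ 2); auto. now apply Lone_const.
    + now apply Lone_scal.
    + intros x Hx. specialize (HM2 x Hx). assert (A := pow2_ge_0 (c x)). assert (B := pow2_ge_0 (f x)).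
      rewrite Rabs_pos_eq; nra.
Qed.

Lemma L2f_cont f : cont_on f a b -> L2f f a b.
Proof.
  intros H. split; [now apply Lone_cont|]. apply Lone_cont; auto.
  intros x Hx eps He.
  destruct (H x Hx (Rmin 1 (eps / (2 * Rabs (f x) + 1)))) as (eta & Heta & H').
  { assert (A := Rabs_pos (f x)). apply Rmin_pos; [lra|]. apply Rdiv_lt_0_compat; lra. }
  exists eta; split; auto. intros y Hy Hyx. specialize (H' y Hy Hyx).
  assert (A := Rlt_le_trans _ _ _ H' (Rmin_l _ _)).
  assert (B := Rlt_le_trans _ _ _ H' (Rmin_r _ _)).
  assert (P := Rabs_pos (f x)).
  replace (f y ^ 2 - f x ^ 2) with ((f y - f x) * (f y + f x)) by ring.
  rewrite Rabs_mult.
  assert (C : Rabs (f y + f x) <= 2 * Rabs (f x) + 1) by (split_Rabs; lra).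
  apply Rle_lt_trans with (Rabs (f y - f x) * (2 * Rabs (f x) + 1)).
  { apply Rmult_le_compat_l; auto. apply Rabs_pos. }
  apply Rmult_lt_compat_r with (r := 2 * Rabs (f x) + 1) in B; [|lra].
  replace (eps / (2 * Rabs (f x) + 1) * (2 * Rabs (f x) + 1)) with eps in B by (field; lra).
  exact B.
Qed.

Lemma L2f_continuous f : (forall x, a <= x <= b -> continuous f x) -> L2f f a b.
Proof. intro; now apply L2f_cont, cont_on_continuous. Qed.

Lemma integral_sq_ge0 f : L2f f a b -> 0 <= integral (fun x => f x ^ 2) a b.
Proof. intros [_ H]. apply integral_ge0; auto. intros; apply pow2_ge_0. Qed.

Lemma integral_sq_plus f g l : L2f f a b -> L2f g a b ->
  integral (fun x => (f x + l * g x) ^ 2) a b =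
  integral (fun x => f x ^ 2) a b + 2 * l * integral (fun x => f x * g x) a b
  + l ^ 2 * integral (fun x => g x ^ 2) a b.
Proof.
  intros HF HG. assert (H := L2f_mult _ _ HF HG).
  rewrite <- !integral_scal by (auto; apply HG).
  assert (A := Lone_scal a b Hab (2 * l) _ H). assert (B := Lone_scal a b Hab (l ^ 2) _ (proj2 HG)).
  cbv beta in A, B. assert (C := Lone_plus a b Hab _ _ (proj2 HF) A).
  rewrite <- (integral_plus a b Hab _ _ (proj2 HF) A), <- (integral_plus a b Hab _ _ C B).
  symmetry; apply integral_ext; auto; [intros; ring|]. now apply Lone_plus.
Qed.

Lemma cauchy_schwarz f g : L2f f a b -> L2f g a b ->
  integral (fun x => f x * g x) a b ^ 2 <=
  integral (fun x => f x ^ 2) a b * integral (fun x => g x ^ 2) a b.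
Proof.
  intros HF HG.
  assert (Q : forall l, 0 <= integral (fun x => f x ^ 2) a b + 2 * l * integral (fun x => f x * g x) a b
    + l ^ 2 * integral (fun x => g x ^ 2) a b).
  { intro l. rewrite <- integral_sq_plus by auto. apply integral_sq_ge0, L2f_plus; auto.
    now apply L2f_scal. }
  assert (PA := integral_sq_ge0 _ HF). assert (PC := integral_sq_ge0 _ HG).
  set (A := integral (fun x => f x ^ 2) a b) in *. set (C := integral (fun x => g x ^ 2) a b) in *.
  set (B := integral (fun x => f x * g x) a b) in *. clearbody A B C.
  destruct (Req_dec C 0) as [->|HC].
  - destruct (Req_dec B 0) as [->|HB]; [lra|].
    (* With [C = 0] the quadratic is affine in [l], and this value of [l] makes it equal to -1. *)
    specialize (Q (- (A + 1) / (2 * B))).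
    replace (2 * (- (A + 1) / (2 * B)) * B) with (- (A + 1)) in Q by (field; auto). lra.
  - assert (0 < C) by lra. specialize (Q (- B / C)).
    replace (A + 2 * (- B / C) * B + (- B / C) ^ 2 * C) with ((A * C - B ^ 2) / C) in Q by (field; auto).
    apply Rmult_le_compat_r with (r := C) in Q; [|lra].
    replace ((A * C - B ^ 2) / C * C) with (A * C - B ^ 2) in Q by (field; auto). lra.
Qed.

(** Fatou's lemma only reaches nonnegative limits. It gives integrability of [v ^ 2] and of
    [(v + 1) ^ 2], and [v] itself is recovered as half of [(v + 1) ^ 2 - v ^ 2 - 1]. *)
Lemma L2f_limit (u : nat -> R -> R) (v : R -> R) C :
  (forall k, L2f (u k) a b) -> (forall k, integral (fun x => u k x ^ 2) a b <= C) ->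
  (forall x, a <= x <= b -> is_lim_seq (fun k => u k x) (v x)) ->
  L2f v a b /\ integral (fun x => v x ^ 2) a b <= C.
Proof.
  intros Hu HC Hv.
  assert (Hlim : forall c x, a <= x <= b ->
    is_lim_seq (fun k => (u k x + c) ^ 2) ((v x + c) ^ 2)).
  { intros c x Hx. apply is_lim_seq_ext with (fun k => (u k x + c) * (u k x + c)); [intro; ring|].
    replace ((v x + c) ^ 2) with ((v x + c) * (v x + c)) by ring.
    assert (A := is_lim_seq_plus' _ _ _ _ (Hv x Hx) (is_lim_seq_const c)).
    apply (is_lim_seq_mult' _ _ _ _ A A). }
  destruct (fatou a b Hab (fun k x => u k x ^ 2) (fun x => v x ^ 2) C) as [A B]; auto.
  - intro; apply Hu.
  - intros; apply pow2_ge_0.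
  - intros x Hx. specialize (Hlim 0 x Hx). rewrite Rplus_0_r in Hlim.
    revert Hlim. apply is_lim_seq_ext. intro; now rewrite Rplus_0_r.
  - assert (U1 : forall k, L2f (fun x => u k x + 1) a b).
    { intro k. apply L2f_plus; auto. apply L2f_continuous. intros; apply continuous_const. }
    destruct (fatou a b Hab (fun k x => (u k x + 1) ^ 2) (fun x => (v x + 1) ^ 2)
      (2 * C + 2 * (b - a))) as [A1 _]; auto.
    + intro; apply U1.
    + intros; apply pow2_ge_0.
    + intro k. specialize (HC k). rewrite <- (integral_const a b Hab 2).
      apply Rle_trans with (integral (fun x => 2 * u k x ^ 2 + 2) a b).
      * assert (P := Lone_scal a b Hab 2 _ (proj2 (Hu k))).
        apply integral_le; auto; [apply U1|apply Lone_plus; auto; now apply Lone_const|].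
        intros x _. assert (Z := pow2_ge_0 (u k x - 1)). nra.
      * rewrite integral_plus, integral_scal; auto; [lra|apply Hu| |now apply Lone_const].
        apply Lone_scal; auto; apply Hu.
    + split; [split; auto|auto].
      generalize (Lone_scal a b Hab (/2) _ (Lone_minus a b Hab _ _ (Lone_minus a b Hab _ _ A1 A)
        (Lone_const a b Hab 1))).
      apply Lone_ext; intros; field.
Qed.

Lemma Lone_null (E : R -> Prop) f g :
  (forall h, (forall x, a <= x <= b -> ~ E x -> h x = 0) -> prim h (fun _ => 0) a b) ->
  (forall x, a <= x <= b -> ~ E x -> f x = g x) -> Lone f a b ->
  Lone g a b /\ integral g a b = integral f a b.
Proof.
  intros HE Hfg (F & V & HF & HV).
  assert (H1 : prim g F a b).
  { assert (A : prim (fun x => g x - f x) (fun _ => 0) a b).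
    { apply HE. intros x Hx Ex. rewrite Hfg by auto; ring. }
    generalize (prim_plus _ _ _ _ _ _ HF A). apply prim_ext; intros; ring. }
  assert (H2 : prim (fun x => Rabs (g x)) V a b).
  { assert (A : prim (fun x => Rabs (g x) - Rabs (f x)) (fun _ => 0) a b).
    { apply HE. intros x Hx Ex. rewrite Hfg by auto; ring. }
    generalize (prim_plus _ _ _ _ _ _ HV A). apply prim_ext; intros; ring. }
  split; [now exists F, V|].
  now rewrite (prim_integral _ _ _ _ Hab H1), (prim_integral _ _ _ _ Hab HF).
Qed.
End L2.

(** * Completeness of L2 *)

Lemma bounded_variation_lim (w : nat -> R) M :
  (forall n, sum_f_R0 (fun k => Rabs (w (S k) - w k)) n <= M) -> ex_finite_lim_seq w.
Proof.
  intros HM. set (d := fun k => w (S k) - w k).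
  assert (Hs : ex_series d).
  { apply ex_series_Rabs.
    destruct (ex_finite_lim_seq_incr (sum_n (fun k => Rabs (d k))) M) as [l Hl].
    - intro n. rewrite sum_Sn. change (plus ?x ?y) with (x + y).
      assert (A := Rabs_pos (d (S n))). lra.
    - intro n. rewrite sum_n_Reals. apply HM.
    - now exists l. }
  destruct Hs as [l Hl]. exists (l + w 0%nat).
  apply is_lim_seq_incr_1.
  apply is_lim_seq_ext with (fun n => sum_n d n + w 0%nat).
  - intro n; induction n as [|n IH].
    + rewrite sum_O. unfold d. ring.
    + rewrite sum_Sn. change (plus ?x ?y) with (x + y). unfold d at 2. lra.
  - apply is_lim_seq_plus'; [exact Hl|apply is_lim_seq_const].
Qed.

(** Along a fast subsequence the successive differences have summable L1 norms, so the set [E] where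
    their absolute sum diverges is null. Off [E] the subsequence converges pointwise, and Fatou's
    lemma turns the Cauchy estimates into distances to the limit. *)
Lemma L2f_complete a b (u : nat -> R -> R) : a <= b ->
  (forall k, L2f (u k) a b) ->
  (forall eps, 0 < eps -> exists N, forall m n, (N <= m)%nat -> (N <= n)%nat ->
    integral (fun x => (u m x - u n x) ^ 2) a b <= eps) ->
  exists v, L2f v a b /\ forall eps, 0 < eps -> exists N, forall n, (N <= n)%nat ->
    integral (fun x => (v x - u n x) ^ 2) a b <= eps.
Proof.
  intros Hab Hu HC.
  assert (HN : forall k, exists N, forall m n, (N <= m)%nat -> (N <= n)%nat ->
    integral (fun x => (u m x - u n x) ^ 2) a b <= (1/4) ^ k).
  { intro k; apply HC, pow_lt; lra. }
  apply ClassicalEpsilon.choice in HN. destruct HN as [N HN].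
  (* A cumulative sum of the thresholds, so that [M j] lies beyond [N k] for every k <= j although
     [N] need not be monotone. *)
  set (M := fix M k := match k with O => N O | S k' => (M k' + N (S k'))%nat end).
  assert (MN : forall k j, (k <= j)%nat -> (N k <= M j)%nat).
  { intros k j Hj; induction Hj; [destruct k; simpl; lia|]. simpl; lia. }
  set (w := fun k => u (M k)).
  assert (Hw : forall k j, (k <= j)%nat -> integral (fun x => (w j x - w k x) ^ 2) a b <= (1/4) ^ k).
  { intros k j Hj. apply HN; apply MN; auto. }
  set (T := fun n x => sum_f_R0 (fun k => Rabs (w (S k) x - w k x)) n).
  assert (dL : forall k j, L2f (fun x => w k x - w j x) a b) by (intros; apply L2f_minus; auto; apply Hu).
  assert (TL : forall n, Lone (T n) a b).
  { induction n as [|n IH]; [apply Lone_abs; auto; apply dL|].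
    apply (Lone_plus a b Hab _ (fun x => Rabs (w (S (S n)) x - w (S n) x))); auto.
    apply Lone_abs; auto; apply dL. }
  assert (Td : forall k, integral (fun x => Rabs (w (S k) x - w k x)) a b <= (1/2) ^ S k * (1 + (b - a))).
  { intro k. specialize (Hw k (S k) ltac:(lia)).
    set (I := integral (fun x => (w (S k) x - w k x) ^ 2) a b) in *.
    assert (P2 : 0 < 2 ^ k) by (apply pow_lt; lra).
    (* AM-GM with weights 2^k and 2^-k *)
    apply Rle_trans with (integral (fun x => (2 ^ k / 2) * (w (S k) x - w k x) ^ 2 + / 2 ^ k / 2) a b).
    - apply integral_le; auto.
      + apply Lone_abs; auto; apply dL.
      + apply Lone_plus; auto; [apply Lone_scal; auto; apply dL|now apply Lone_const].
      + intros x _. set (z := w (S k) x - w k x).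
        rewrite <- (pow2_abs z).
        assert (A := pow2_ge_0 (2 ^ k * Rabs z - 1)).
        assert (B : 0 < / 2 ^ k) by (apply Rinv_0_lt_compat; auto).
        apply Rmult_le_compat_l with (r := / 2 ^ k) in A; [|lra].
        replace (/ 2 ^ k * (2 ^ k * Rabs z - 1) ^ 2) with
          (2 ^ k * Rabs z ^ 2 - 2 * Rabs z + / 2 ^ k) in A by (field; lra). lra.
    - rewrite integral_plus, integral_scal, integral_const; auto; try apply dL;
        [|apply Lone_scal; auto; apply dL|now apply Lone_const].
      fold I.
      apply Rmult_le_compat_l with (r := 2 ^ k / 2) in Hw; [|lra].
      assert (E1 : 2 ^ k / 2 * (1/4) ^ k = (1/2) ^ S k).
      { simpl. replace (1/4) with (1/2 * (1/2)) by field. rewrite Rpow_mult_distr.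
        replace ((1/2) ^ k) with (/ 2 ^ k) by (rewrite <- pow_inv; f_equal; field).
        field. lra. }
      assert (E2 : / 2 ^ k / 2 = (1/2) ^ S k).
      { simpl. replace ((1/2) ^ k) with (/ 2 ^ k) by (rewrite <- pow_inv; f_equal; field).
        field; lra. }
      rewrite E1 in Hw. rewrite E2. lra. }
  assert (TI : forall n, integral (T n) a b <= (1 - (1/2) ^ S n) * (1 + (b - a))).
  { induction n as [|n IH].
    - specialize (Td 0%nat). unfold T. simpl in *. lra.
    - change (T (S n)) with (fun x => T n x + Rabs (w (S (S n)) x - w (S n) x)).
      rewrite integral_plus; auto; [|apply Lone_abs; auto; apply dL].
      specialize (Td (S n)). simpl in *. lra. }
  set (E := fun x => forall c, exists n, c <= T n x).
  assert (HE : forall h, (forall x, a <= x <= b -> ~ E x -> h x = 0) -> prim h (fun _ => 0) a b).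
  { intros h Hh.
    apply (prim_divergence_set T (fun n => integral (T n) a) h a b (1 + (b - a))); auto.
    - intro n; now apply Lone_prim.
    - intros k x _. unfold T; simpl. assert (A := Rabs_pos (w (S (S k)) x - w (S k) x)). lra.
    - intros k x _. unfold T. apply cond_pos_sum. intro; apply Rabs_pos.
    - intro k. assert (A := prim_integral _ _ _ _ Hab (Lone_prim a b Hab _ (TL k))).
      specialize (TI k). assert (B : 0 < (1/2) ^ S k) by (apply pow_lt; lra). nra.
    - intros x Hx Hne. apply NNPP. intro Hn. apply Hne, Hh; auto. }
  (* Setting the functions to 0 on [E] gives convergence at every point, the form in which
     [L2f_limit] is stated; integrals do not change since [E] is null. *)
  set (w' := fun k x => if excluded_middle_informative (E x) then 0 else w k x).
  set (v := fun x => real (Lim_seq (fun k => w' k x))).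
  assert (Hv : forall x, is_lim_seq (fun k => w' k x) (v x)).
  { intro x. apply Lim_seq_correct'. unfold w'. destruct excluded_middle_informative as [Hx|Hx].
    - exists 0. apply is_lim_seq_const.
    - apply not_all_ex_not in Hx. destruct Hx as [c Hc].
      apply bounded_variation_lim with c. intro n. apply Rnot_lt_le. intro Hl.
      apply Hc. exists n. unfold T. lra. }
  assert (Hww : forall k x, ~ E x -> w k x = w' k x).
  { intros k x Hx. unfold w'. destruct excluded_middle_informative; tauto. }
  assert (w'L : forall k, L2f (w' k) a b).
  { intro k. split.
    - apply (Lone_null a b Hab E (w k)); auto. apply Hu.
    - apply (Lone_null a b Hab E (fun x => w k x ^ 2)); auto; [|apply Hu].
      intros; now rewrite Hww. }
  assert (Hvk : forall k, L2f (fun x => v x - w' k x) a b /\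
     integral (fun x => (v x - w' k x) ^ 2) a b <= (1/4) ^ k).
  { intro k. apply (L2f_limit a b Hab (fun j x => w' (j + k)%nat x - w' k x)).
    - intro j. now apply L2f_minus.
    - intro j. specialize (Hw k (j + k)%nat ltac:(lia)).
      destruct (Lone_null a b Hab E (fun x => (w (j + k)%nat x - w k x) ^ 2)
        (fun x => (w' (j + k)%nat x - w' k x) ^ 2)) as [_ ->]; auto.
      + intros; now rewrite !Hww.
      + apply dL.
    - intros x _. apply is_lim_seq_minus'; [|apply is_lim_seq_const].
      now apply (is_lim_seq_incr_n (fun j => w' j x)). }
  assert (vL : L2f v a b).
  { generalize (L2f_plus a b Hab _ _ (proj1 (Hvk 0%nat)) (w'L 0%nat)).
    apply L2f_ext; intros; ring. }
  exists v. split; [exact vL|].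
  intros eps He.
  (* The final distance is split by (p + q)^2 <= 2 p^2 + 2 q^2 into two integrals of at most (1/4)^k
     each, whence the factor 4. *)
  destruct (pow_lt_1_zero (1/4) ltac:(rewrite Rabs_pos_eq; lra) (eps / 4) ltac:(lra)) as [k Hk].
  specialize (Hk k (le_n _)).
  assert (P4 : 0 < (1/4) ^ k) by (apply pow_lt; lra).
  rewrite Rabs_pos_eq in Hk by lra.
  exists (N k). intros n Hn.
  assert (A : integral (fun x => (v x - w k x) ^ 2) a b <= (1/4) ^ k).
  { destruct (Lone_null a b Hab E (fun x => (v x - w' k x) ^ 2)
      (fun x => (v x - w k x) ^ 2)) as [_ ->]; auto; [|apply Hvk|apply Hvk].
    intros; now rewrite Hww. }
  assert (B : integral (fun x => (w k x - u n x) ^ 2) a b <= (1/4) ^ k).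
  { apply HN; auto. }
  assert (L1 : L2f (fun x => v x - w k x) a b) by (apply L2f_minus; auto; apply Hu).
  assert (L2 : L2f (fun x => w k x - u n x) a b) by (apply L2f_minus; auto; apply Hu).
  assert (S1 := Lone_scal a b Hab 2 _ (proj2 L1)). assert (S2 := Lone_scal a b Hab 2 _ (proj2 L2)).
  apply Rle_trans with (integral (fun x => 2 * (v x - w k x) ^ 2 + 2 * (w k x - u n x) ^ 2) a b).
  - apply integral_le; auto; [apply L2f_minus; auto|now apply Lone_plus|].
    intros x _. assert (Z := pow2_ge_0 ((v x - w k x) - (w k x - u n x))). nra.
  - rewrite integral_plus, !integral_scal; auto; [lra|apply L2|apply L1].
Qed.

(** * Absolute continuity and weak derivatives *)

Lemma L1_Lone f a b : L1 f a b -> Lone f a b.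
Proof.
  intros [[I HI] [J HJ]]. exists (integral f a), (integral (fun x => Rabs (f x)) a).
  split; [apply (HKint_prim f a b I HI)|apply (HKint_prim _ a b J HJ)].
Qed.

Lemma Lone_L1 f a b : a <= b -> Lone f a b -> L1 f a b.
Proof.
  intros Hab (F & V & HF & HV). split.
  - exists (F b - F a). now apply prim_HKint.
  - exists (V b - V a). now apply prim_HKint.
Qed.

Lemma L2_L2f f a b : L2 f a b -> L2f f a b.
Proof.
  intros [H1 [I HI]]. split; [now apply L1_Lone|].
  apply (Lone_ge0 a b (proj1 HI) _ (integral (fun x => f x ^ 2) a)).
  - apply (HKint_prim _ a b I HI).
  - intros; apply pow2_ge_0.
Qed.

Lemma L2f_L2 f a b : a <= b -> L2f f a b -> L2 f a b.
Proof.
  intros Hab [H1 H2]. split; [now apply Lone_L1|]. eexists. now apply Lone_HKint.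
Qed.

Lemma Lone_sub f a b c d : Lone f a b -> a <= c -> c <= d -> d <= b -> Lone f c d.
Proof. intros (F & V & HF & HV) H1 H2 H3. exists F, V. split; eapply prim_sub; eauto. Qed.

Lemma L2f_sub f a b c d : L2f f a b -> a <= c -> c <= d -> d <= b -> L2f f c d.
Proof. intros [H1 H2] ? ? ?. split; eapply Lone_sub; eauto. Qed.

Lemma integral_sub_le f a b c d : (forall x, a <= x <= b -> 0 <= f x) -> Lone f a b ->
  a <= c -> c <= d -> d <= b -> integral f c d <= integral f a b.
Proof.
  intros Hf (F & V & HF & _) Hc Hcd Hd.
  assert (HI := prim_ge0_incr f F a b HF Hf).
  rewrite (prim_integral f F a b ltac:(lra) HF),
    (prim_integral f F c d Hcd (prim_sub _ _ _ _ _ _ HF Hc Hcd Hd)).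
  assert (A := HI a c ltac:(lra) ltac:(lra) ltac:(lra)).
  assert (B := HI d b ltac:(lra) ltac:(lra) ltac:(lra)). lra.
Qed.

Lemma cont_on_bounded f a b : a <= b -> cont_on f a b ->
  exists M, 0 <= M /\ forall x, a <= x <= b -> Rabs (f x) <= M.
Proof.
  intros Hab Hf. assert (Hc := cont_on_clamp f a b Hab Hf).
  set (g := fun x => Rabs (f (Rmax a (Rmin b x)))).
  destruct (continuity_ab_maj g a b Hab) as (m & Hm & _).
  { intros c _. apply continuity_pt_filterlim.
    apply (continuous_comp (fun x => f (Rmax a (Rmin b x))) Rabs); auto.
    apply continuous_Rabs. }
  exists (g m). split; [apply Rabs_pos|]. intros x Hx. specialize (Hm x Hx). unfold g in Hm at 1.
  replace (Rmax a (Rmin b x)) with x in Hm; auto.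
  unfold Rmax, Rmin; repeat destruct Rle_dec; lra.
Qed.

Lemma cont_on_comp (phi f : R -> R) a b : (forall x, continuous phi x) -> cont_on f a b ->
  cont_on (fun x => phi (f x)) a b.
Proof.
  intros Hp Hf x Hx eps He. assert (Hc := Hp (f x)).
  apply continuity_pt_filterlim in Hc. destruct (Hc eps He) as (al & Hal & H).
  destruct (Hf x Hx al Hal) as (eta & Heta & H').
  exists eta; split; auto. intros y Hy Hyx.
  destruct (Req_dec (f y) (f x)) as [->|Hne]; [rewrite Rminus_diag, Rabs_R0; auto|].
  apply H. split; [split; [exact I|auto]|]. apply (H' y Hy Hyx).
Qed.

(** Absolute continuity encoded as being an indefinite Lebesgue integral. [prim] sees only
    increments, so [F] is free up to a constant and [f] up to a null set. *)
Definition AC (f F : R -> R) (a b : R) : Prop := Lone f a b /\ prim f F a b.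

Lemma AC_ext f g F G a b :
  (forall x, a <= x <= b -> f x = g x) -> (forall x, a <= x <= b -> F x = G x) ->
  AC f F a b -> AC g G a b.
Proof.
  intros H1 H2 [H3 H4]. split; [now apply Lone_ext with f|now apply prim_ext with f F].
Qed.

Lemma AC_cont f F a b : AC f F a b -> cont_on F a b.
Proof. intros [_ H] x Hx. now apply prim_continuous with f. Qed.

Lemma AC_sub f F a b c d : AC f F a b -> a <= c -> c <= d -> d <= b -> AC f F c d.
Proof.
  intros [H1 H2] ? ? ?. split; [eapply Lone_sub; eauto|eapply prim_sub; eauto].
Qed.

Lemma AC_increment f F a b : a <= b -> AC f F a b -> F b - F a = integral f a b.
Proof. intros Hab [_ H]. symmetry; now apply prim_integral. Qed.

Lemma AC_integral f a b : a <= b -> Lone f a b -> AC f (integral f a) a b.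
Proof. intros Hab H. split; auto. now apply Lone_prim. Qed.

Lemma AC_derive (f F : R -> R) a b : a <= b -> (forall x, a <= x <= b -> is_derive F x (f x)) ->
  (forall x, a <= x <= b -> continuous f x) -> AC f F a b.
Proof.
  intros Hab H1 H2. split; [now apply Lone_continuous|now apply prim_derive].
Qed.

Lemma AC_plus f F g G a b : a <= b -> AC f F a b -> AC g G a b ->
  AC (fun x => f x + g x) (fun x => F x + G x) a b.
Proof.
  intros Hab [H1 H2] [H3 H4]. split; [now apply Lone_plus|now apply prim_plus].
Qed.

Lemma AC_scal c f F a b : a <= b -> AC f F a b -> AC (fun x => c * f x) (fun x => c * F x) a b.
Proof. intros Hab [H1 H2]. split; [now apply Lone_scal|now apply prim_scal]. Qed.

Lemma Lone_cont_mult c f a b : a <= b -> cont_on c a b -> Lone f a b ->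
  Lone (fun x => c x * f x) a b.
Proof.
  intros Hab Hc Hf. destruct (cont_on_bounded c a b Hab Hc) as (M & _ & HM).
  apply Lone_mult with (fun x => M * Rabs (f x)); auto.
  - now apply Lone_cont.
  - apply Lone_scal; auto. now apply Lone_abs.
  - intros x Hx. rewrite Rabs_mult. apply Rmult_le_compat_r; [apply Rabs_pos|auto].
Qed.

Lemma L2f_cont_mult c f a b : a <= b -> cont_on c a b -> L2f f a b ->
  L2f (fun x => c x * f x) a b.
Proof.
  intros Hab Hc Hf. destruct (cont_on_bounded c a b Hab Hc) as (M & _ & HM).
  apply L2f_bounded_mult with M; auto. now apply Lone_cont.
Qed.

Lemma AC_abs_incr f F a b : AC f F a b -> exists V, incr V a b /\
  forall t y, a <= t <= b -> a <= y <= b -> Rabs (F y - F t) <= Rabs (V y - V t).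
Proof.
  intros [(F' & V & _ & HV) HF]. exists V. split.
  - apply (prim_ge0_incr _ _ _ _ HV). intros; apply Rabs_pos.
  - intros t y Ht Hy. apply (prim_abs_le_sub f F (fun x => Rabs (f x)) V a b); auto. intros; lra.
Qed.

(** Besides the two Henstock errors there is the second-order term [(F y - F t) * (G y - G t)]. A
    third gauge makes its first factor at most eps by continuity, and the second is bounded by an
    increment of [W], the primitive of [Rabs (g x)]. *)
Lemma AC_mult f F g G a b : a <= b -> AC f F a b -> AC g G a b ->
  AC (fun x => f x * G x + F x * g x) (fun x => F x * G x) a b.
Proof.
  intros Hab HF HG. assert (CF := AC_cont _ _ _ _ HF). assert (CG := AC_cont _ _ _ _ HG).
  split.
  { apply Lone_plus; auto; [|apply Lone_cont_mult; auto; apply HG].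
    apply Lone_ext with (fun x => G x * f x); [intros; ring|].
    apply Lone_cont_mult; auto; apply HF. }
  destruct (cont_on_bounded F a b Hab CF) as (MF & MF0 & HMF).
  destruct (cont_on_bounded G a b Hab CG) as (MG & MG0 & HMG).
  destruct (AC_abs_incr _ _ _ _ HG) as (W & IW & HW).
  assert (PW : 0 <= W b - W a) by (specialize (IW a b ltac:(lra) ltac:(lra) ltac:(lra)); lra).
  apply prim_intro with (MG + MF + (W b - W a)); [lra|]. intros eps He.
  destruct (proj2 HF eps He) as (d1 & G1 & Hd1 & I1 & E1 & T1).
  destruct (proj2 HG eps He) as (d2 & G2 & Hd2 & I2 & E2 & T2).
  assert (Hd3 : forall t, exists d, 0 < d /\ (a <= t <= b -> forall y, a <= y <= b ->
    Rabs (y - t) < d -> Rabs (F y - F t) < eps)).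
  { intro t. destruct (classic (a <= t <= b)) as [Ht|Ht].
    - destruct (CF t Ht eps He) as (d & Hd & H). exists d; auto.
    - exists 1. split; [lra|tauto]. }
  apply ClassicalEpsilon.choice in Hd3. destruct Hd3 as [d3 Hd3].
  exists (fun x => Rmin (d1 x) (Rmin (d2 x) (d3 x))),
    (fun x => (MG * G1 x + MF * G2 x) + eps * W x).
  assert (J1 := incr_scal MG G1 a b MG0 I1). assert (J2 := incr_scal MF G2 a b MF0 I2).
  assert (J3 := incr_scal eps W a b ltac:(lra) IW).
  assert (J12 := incr_plus _ _ _ _ J1 J2).
  split; [intro x; repeat apply Rmin_pos; auto; apply Hd3|].
  split; [exact (incr_plus _ _ _ _ J12 J3)|]. split; [nra|].
  intros t y Ht Hy Hty.
  rewrite <- (incr_abs_plus _ _ a b _ _ J12 J3), <- (incr_abs_plus _ _ a b _ _ J1 J2) by auto.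
  rewrite <- !incr_abs_scal by lra.
  specialize (T1 t y Ht Hy (Rlt_le_trans _ _ _ Hty (Rmin_l _ _))).
  assert (Hty' := Rlt_le_trans _ _ _ Hty (Rmin_r _ _)).
  specialize (T2 t y Ht Hy (Rlt_le_trans _ _ _ Hty' (Rmin_l _ _))).
  assert (T3 := proj2 (Hd3 t) Ht y Hy (Rlt_le_trans _ _ _ Hty' (Rmin_r _ _))).
  specialize (HW t y Ht Hy). specialize (HMF t Ht). specialize (HMG t Ht).
  replace ((f t * G t + F t * g t) * (y - t) - (F y * G y - F t * G t)) with
    (G t * (f t * (y - t) - (F y - F t)) + F t * (g t * (y - t) - (G y - G t))
     + - ((F y - F t) * (G y - G t))) by ring.
  eapply Rle_trans; [apply Rabs_triang|]. rewrite Rabs_Ropp, (Rabs_mult (F y - F t)).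
  apply Rplus_le_compat.
  - eapply Rle_trans; [apply Rabs_triang|]. rewrite !Rabs_mult.
    apply Rplus_le_compat; apply Rmult_le_compat; auto; apply Rabs_pos.
  - apply Rmult_le_compat; auto; try apply Rabs_pos. lra.
Qed.

(** Differentiability of [phi] at [F t] leaves a remainder of at most eps times [Rabs (F y - F t)].
    That is eps times an increment of the variation, whose total is finite by absolute
    continuity. *)
Lemma AC_comp (phi dphi : R -> R) f F a b : a <= b ->
  (forall x, is_derive phi x (dphi x)) -> (forall x, continuous dphi x) ->
  AC f F a b -> AC (fun x => dphi (F x) * f x) (fun x => phi (F x)) a b.
Proof.
  intros Hab Hphi Hdphi HF. assert (CF := AC_cont _ _ _ _ HF).
  assert (Cd := cont_on_comp _ _ _ _ Hdphi CF).
  split; [apply (Lone_cont_mult _ _ _ _ Hab Cd), HF|].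
  destruct (cont_on_bounded _ a b Hab Cd) as (M & M0 & HM).
  destruct (AC_abs_incr _ _ _ _ HF) as (W & IW & HW).
  assert (PW : 0 <= W b - W a) by (specialize (IW a b ltac:(lra) ltac:(lra) ltac:(lra)); lra).
  apply prim_intro with (M + (W b - W a)); [lra|]. intros eps He.
  destruct (proj2 HF eps He) as (d1 & G1 & Hd1 & I1 & E1 & T1).
  assert (Hd2 : forall t, exists d, 0 < d /\ (a <= t <= b -> forall y, a <= y <= b ->
    Rabs (y - t) < d ->
    Rabs (dphi (F t) * (F y - F t) - (phi (F y) - phi (F t))) <= eps * Rabs (F y - F t))).
  { intro t. destruct (classic (a <= t <= b)) as [Ht|Ht]; [|exists 1; split; [lra|tauto]].
    destruct (Hphi (F t)) as [_ H].
    specialize (H (F t) (fun P HP => HP) (mkposreal eps He)). destruct H as [d Hd].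
    destruct (CF t Ht d (cond_pos d)) as (e & Hpe & H). exists e; split; auto.
    intros _ y Hy Hty. specialize (Hd (F y) (H y Hy Hty)).
    unfold norm, minus, plus, opp, scal in Hd; simpl in Hd.
    unfold abs, mult in Hd; simpl in Hd.
    rewrite <- Rabs_Ropp.
    replace (- (dphi (F t) * (F y - F t) - (phi (F y) - phi (F t)))) with
      (phi (F y) + - phi (F t) + - ((F y + - F t) * dphi (F t))) by ring.
    exact Hd. }
  apply ClassicalEpsilon.choice in Hd2. destruct Hd2 as [d2 Hd2].
  exists (fun x => Rmin (d1 x) (d2 x)), (fun x => M * G1 x + eps * W x).
  assert (J1 := incr_scal M G1 a b M0 I1). assert (J2 := incr_scal eps W a b ltac:(lra) IW).
  split; [intro x; apply Rmin_pos; auto; apply Hd2|].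
  split; [exact (incr_plus _ _ _ _ J1 J2)|]. split; [nra|].
  intros t y Ht Hy Hty.
  rewrite <- (incr_abs_plus _ _ a b _ _ J1 J2) by auto. rewrite <- !incr_abs_scal by lra.
  specialize (T1 t y Ht Hy (Rlt_le_trans _ _ _ Hty (Rmin_l _ _))).
  assert (T2 := proj2 (Hd2 t) Ht y Hy (Rlt_le_trans _ _ _ Hty (Rmin_r _ _))).
  specialize (HW t y Ht Hy). specialize (HM t Ht).
  replace (dphi (F t) * f t * (y - t) - (phi (F y) - phi (F t))) with
    (dphi (F t) * (f t * (y - t) - (F y - F t))
     + (dphi (F t) * (F y - F t) - (phi (F y) - phi (F t)))) by ring.
  eapply Rle_trans; [apply Rabs_triang|]. apply Rplus_le_compat.
  - rewrite Rabs_mult. apply Rmult_le_compat; auto; apply Rabs_pos.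
  - apply Rle_trans with (1 := T2). apply Rmult_le_compat_l; lra.
Qed.

Lemma test_fun_derive phi dphi a b : test_fun phi a b ->
  (forall x, derivable_pt_lim phi x (dphi x)) ->
  (forall x, is_derive phi x (dphi x)) /\ (forall x, continuous dphi x) /\
  exists c d, a < c /\ c < d /\ d < b /\ forall x, x < c \/ d < x -> phi x = 0 /\ dphi x = 0.
Proof.
  intros [(D & HD0 & HD) (c & d & Hc & Hcd & Hd & Hs)] Hphi.
  assert (E : forall x, D 1%nat x = dphi x).
  { intro x. specialize (HD 0%nat x). rewrite HD0 in HD. eapply uniqueness_limite; eauto. }
  split; [intro x; now apply is_derive_Reals|]. split.
  - intro x. apply continuous_ext with (D 1%nat); [exact E|].
    apply (ex_derive_continuous (D 1%nat)). exists (D 2%nat x). now apply is_derive_Reals.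
  - exists c, d. repeat split; auto.
    assert (Hl : locally x (fun y => 0 = phi y)).
    { destruct H as [Hx|Hx].
      - apply filter_imp with (fun y => y < c); [intros; symmetry; auto|].
        now apply open_lt.
      - apply filter_imp with (fun y => d < y); [intros; symmetry; auto|].
        now apply open_gt. }
    apply (is_derive_ext_loc (fun _ => 0)) with (l := 0) in Hl; [|exact (is_derive_const (V := R_NormedModule) 0 x)].
    apply is_derive_Reals in Hl. eapply uniqueness_limite; eauto.
Qed.

Lemma AC_weak_deriv f F a b : a <= b -> AC f F a b -> weak_deriv F f a b.
Proof.
  intros Hab HF. split.
  - intros c d Hc Hcd Hd. assert (H := AC_sub _ _ _ _ c d HF ltac:(lra) ltac:(lra) ltac:(lra)).
    split; apply Lone_L1; try lra; [|apply H]. apply Lone_cont; [lra|]. now apply AC_cont with f.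
  - intros phi dphi Ht Hphi.
    destruct (test_fun_derive _ _ _ _ Ht Hphi) as (H1 & H2 & c & d & Hc & Hcd & Hd & Hs).
    assert (HG : AC dphi phi a b) by (apply AC_derive; auto).
    assert (HM := AC_mult _ _ _ _ _ _ Hab HF HG).
    apply AC_increment in HM; auto.
    rewrite (proj1 (Hs a ltac:(lra))), (proj1 (Hs b ltac:(lra))) in HM.
    assert (L1 : Lone (fun x => F x * dphi x) a b).
    { apply Lone_cont_mult; auto; [now apply AC_cont with f|apply HG]. }
    assert (L2 : Lone (fun x => f x * phi x) a b).
    { apply Lone_ext with (fun x => phi x * f x); [intros; ring|].
      apply Lone_cont_mult; auto; [now apply AC_cont with dphi|apply HF]. }
    rewrite (integral_plus a b Hab _ _ L2 L1) in HM. lra.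
Qed.

(** * Orthogonal series *)

Definition cvgL2 (u : nat -> R -> R) (v : R -> R) (a b : R) : Prop :=
  forall eps, 0 < eps -> exists N, forall n, (N <= n)%nat ->
    integral (fun x => (v x - u n x) ^ 2) a b <= eps.

Section CvgL2.
Variables (a b : R) (u : nat -> R -> R) (v : R -> R).
Hypothesis Hab : a <= b.
Hypothesis Hu : forall n, L2f (u n) a b.
Hypothesis Hv : L2f v a b.
Hypothesis Hc : cvgL2 u v a b.

(** The inequality (p + q)^2 <= (1 + eta) p^2 + (1 + 1/eta) q^2, with the integral of q^2 below
    eta^2, keeps the constant [C] exact as eta tends to 0. The factor 2 of the cruder splitting
    would spoil the final norm bound. *)
Lemma cvgL2_norm_le C : (forall n, integral (fun x => u n x ^ 2) a b <= C) ->
  integral (fun x => v x ^ 2) a b <= C.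
Proof.
  intros HC. assert (C0 : 0 <= C) by (eapply Rle_trans; [apply (integral_sq_ge0 a b Hab _ (Hu 0%nat))|auto]).
  assert (K : forall eta, 0 < eta ->
    integral (fun x => v x ^ 2) a b <= (1 + eta) * C + (1 + / eta) * eta ^ 2).
  { intros eta He. destruct (Hc (eta ^ 2)) as [N HN]; [apply pow_lt; auto|].
    specialize (HN N (le_n _)). specialize (HC N).
    assert (Ie := Rinv_0_lt_compat eta He).
    assert (D := L2f_minus a b Hab _ _ Hv (Hu N)).
    assert (A1 := Lone_scal a b Hab (1 + eta) _ (proj2 (Hu N))).
    assert (A2 := Lone_scal a b Hab (1 + / eta) _ (proj2 D)).
    apply Rle_trans with (integral (fun x => (1 + eta) * u N x ^ 2 + (1 + / eta) * (v x - u N x) ^ 2) a b).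
    - apply integral_le; auto; [apply Hv|now apply Lone_plus|].
      intros x _. set (p := u N x). replace (v x) with (p + (v x - p)) by ring.
      replace (p + (v x - p) - p) with (v x - p) by ring. set (q := v x - p).
      assert (Z := pow2_ge_0 (eta * p - q)).
      apply Rmult_le_compat_l with (r := / eta) in Z; [|lra].
      replace (/ eta * (eta * p - q) ^ 2) with (eta * p ^ 2 - 2 * p * q + / eta * q ^ 2) in Z by (field; lra).
      lra.
    - rewrite integral_plus, !integral_scal; auto; [|apply D|apply Hu].
      apply Rplus_le_compat; apply Rmult_le_compat_l; lra. }
  apply le_epsilon. intros e He.
  set (eta := Rmin 1 (e / (C + 3))).
  assert (E0 : 0 < e / (C + 3)) by (apply Rdiv_lt_0_compat; lra).
  assert (H1 : 0 < eta) by (apply Rmin_pos; lra).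
  assert (H2 : eta <= 1) by apply Rmin_l. assert (H3 : eta <= e / (C + 3)) by apply Rmin_r.
  specialize (K eta H1).
  replace ((1 + / eta) * eta ^ 2) with (eta ^ 2 + eta) in K by (field; lra).
  assert (H4 : eta * (C + 3) <= e).
  { apply Rmult_le_compat_r with (r := C + 3) in H3; [|lra].
    replace (e / (C + 3) * (C + 3)) with e in H3 by (field; lra). exact H3. }
  nra.
Qed.

Lemma cvgL2_inner g : L2f g a b ->
  is_lim_seq (fun n => integral (fun x => u n x * g x) a b) (integral (fun x => v x * g x) a b).
Proof.
  intros Hg. apply is_lim_seq_spec. intro e. assert (He := cond_pos e).
  set (C := integral (fun x => g x ^ 2) a b).
  assert (C0 : 0 <= C) by now apply integral_sq_ge0.
  destruct (Hc (e ^ 2 / (C + 1) / 2)) as [N HN].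
  { assert (0 < e ^ 2 / (C + 1)); [|lra]. apply Rdiv_lt_0_compat; [apply pow_lt; auto|lra]. }
  exists N. intros n Hn. specialize (HN n Hn).
  assert (D := L2f_minus a b Hab _ _ Hv (Hu n)).
  assert (CS := cauchy_schwarz a b Hab _ _ D Hg). fold C in CS. cbv beta in CS.
  assert (E : integral (fun x => (v x - u n x) * g x) a b =
    integral (fun x => v x * g x) a b - integral (fun x => u n x * g x) a b).
  { rewrite <- integral_minus; auto; try now apply L2f_mult.
    apply integral_ext; auto; [intros; ring|]. now apply L2f_mult. }
  rewrite E in CS. rewrite Rabs_minus_sym.
  set (z := integral (fun x => v x * g x) a b - integral (fun x => u n x * g x) a b) in *.
  apply Rnot_le_lt. intro Hle.
  assert (Z : e ^ 2 <= z ^ 2).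
  { rewrite <- (pow2_abs z). apply pow_incr. lra. }
  assert (Y : integral (fun x => (v x - u n x) ^ 2) a b * C <= e ^ 2 / (C + 1) / 2 * C)
    by (apply Rmult_le_compat_r; auto).
  assert (X : e ^ 2 / (C + 1) / 2 * C <= e ^ 2 / 2).
  { apply Rmult_le_reg_r with (C + 1); [lra|].
    replace (e ^ 2 / (C + 1) / 2 * C * (C + 1)) with (e ^ 2 / 2 * C) by (field; lra).
    assert (P := pow_lt e 2 He). nra. }
  assert (P := pow_lt e 2 He). lra.
Qed.

Lemma cvgL2_sub c d : a <= c -> c <= d -> d <= b -> cvgL2 u v c d.
Proof.
  intros H1 H2 H3 eps He. destruct (Hc eps He) as [N HN]. exists N. intros n Hn.
  eapply Rle_trans; [|apply (HN n Hn)].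
  apply integral_sub_le; auto; [intros; apply pow2_ge_0|].
  apply L2f_minus; auto.
Qed.
End CvgL2.

Lemma cvgL2_integral a b u v c d : a <= b -> (forall n, L2f (u n) a b) -> L2f v a b ->
  cvgL2 u v a b -> a <= c -> c <= d -> d <= b ->
  is_lim_seq (fun n => integral (u n) c d) (integral v c d).
Proof.
  intros Hab Hu Hv Hc H1 H2 H3.
  assert (Hu' : forall n, L2f (u n) c d) by (intro; eapply L2f_sub; eauto).
  assert (Hv' : L2f v c d) by (eapply L2f_sub; eauto).
  assert (H := cvgL2_inner c d u v H2 Hu' Hv' (cvgL2_sub a b u v Hab Hu Hv Hc c d H1 H2 H3) (fun _ => 1)).
  rewrite (integral_ext c d H2 v (fun x => v x * 1)) by (intros; try apply Hv'; ring).
  eapply is_lim_seq_ext; [|apply H].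
  - intro n; simpl. symmetry; apply integral_ext; auto; [intros; ring|apply Hu'].
  - apply L2f_continuous; auto. intros; apply continuous_const.
Qed.

Section Orthogonal.
Variables (a b c : R) (e : nat -> R -> R).
Hypothesis Hab : a <= b.
Hypothesis Hc : 0 < c.
Hypothesis eL : forall n, L2f (e n) a b.
Hypothesis eorth : forall n m, n <> m -> integral (fun x => e n x * e m x) a b = 0.
Hypothesis enorm : forall n, integral (fun x => e n x ^ 2) a b = c.

Definition orth_sum (d : nat -> R) (N : nat) (x : R) : R :=
  sum_f_R0 (fun n => d n * e n x) N.

Lemma orth_sum_L2f d N : L2f (orth_sum d N) a b.
Proof.
  induction N as [|N IH]; [now apply (L2f_scal a b Hab (d O) (e O))|].
  apply (L2f_plus a b Hab _ (fun x => d (S N) * e (S N) x)); auto. now apply L2f_scal.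
Qed.

Lemma orth_sum_inner f d N : L2f f a b ->
  integral (fun x => orth_sum d N x * f x) a b =
  sum_f_R0 (fun n => d n * integral (fun x => f x * e n x) a b) N.
Proof.
  intro Hf.
  assert (A : forall n, integral (fun x => d n * e n x * f x) a b =
    d n * integral (fun x => f x * e n x) a b).
  { intro n. rewrite <- integral_scal by (auto; now apply L2f_mult).
    apply integral_ext; auto; [intros; ring|]. apply L2f_mult; auto. now apply L2f_scal. }
  induction N as [|N IH]; [apply A|].
  change (sum_f_R0 (fun n => d n * integral (fun x => f x * e n x) a b) (S N)) with
    (sum_f_R0 (fun n => d n * integral (fun x => f x * e n x) a b) N +
     d (S N) * integral (fun x => f x * e (S N) x) a b).
  rewrite <- IH, <- A, <- integral_plus; auto.
  - apply integral_ext; auto; [intros; unfold orth_sum; simpl; ring|].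
    apply L2f_mult; auto. apply orth_sum_L2f.
  - apply L2f_mult; auto. apply orth_sum_L2f.
  - apply L2f_mult; auto. now apply L2f_scal.
Qed.

Lemma orth_sum_later d N m : (N < m)%nat -> integral (fun x => orth_sum d N x * e m x) a b = 0.
Proof.
  intros Hm. rewrite orth_sum_inner by auto.
  rewrite <- (sum_eq_R0 (fun _ => 0) N) by auto.
  apply sum_eq. intros i Hi. rewrite eorth by lia. ring.
Qed.

Lemma orth_sum_norm d N :
  integral (fun x => orth_sum d N x ^ 2) a b = c * sum_f_R0 (fun n => d n ^ 2) N.
Proof.
  induction N as [|N IH].
  - simpl sum_f_R0. rewrite <- (enorm 0%nat), Rmult_comm.
    rewrite <- integral_scal by (auto; apply eL).
    apply integral_ext; auto; [intros; unfold orth_sum; simpl; ring|apply orth_sum_L2f].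
  - change (sum_f_R0 (fun n => d n ^ 2) (S N)) with (sum_f_R0 (fun n => d n ^ 2) N + d (S N) ^ 2).
    change (orth_sum d (S N)) with (fun x => orth_sum d N x + d (S N) * e (S N) x).
    cbv beta. rewrite integral_sq_plus by (auto; apply orth_sum_L2f).
    rewrite orth_sum_later, enorm, IH by lia. ring.
Qed.

Lemma bessel f N : L2f f a b ->
  c * sum_f_R0 (fun n => (integral (fun x => f x * e n x) a b / c) ^ 2) N <=
  integral (fun x => f x ^ 2) a b.
Proof.
  intros Hf. set (d := fun n => integral (fun x => f x * e n x) a b / c).
  assert (H : 0 <= integral (fun x => (f x + (-1) * orth_sum d N x) ^ 2) a b).
  { apply integral_sq_ge0; auto. apply L2f_plus; auto. apply L2f_scal; auto. apply orth_sum_L2f. }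
  rewrite integral_sq_plus in H by (auto; apply orth_sum_L2f).
  rewrite orth_sum_norm in H.
  replace (integral (fun x => f x * orth_sum d N x) a b) with
    (c * sum_f_R0 (fun n => d n ^ 2) N) in H; [unfold d in *; lra|].
  rewrite <- (integral_ext a b Hab (fun x => orth_sum d N x * f x)); [|intros; ring|].
  - rewrite orth_sum_inner by auto. rewrite scal_sum. apply sum_eq. intros i _.
    unfold d. field. lra.
  - apply L2f_mult; auto. apply orth_sum_L2f.
Qed.

Lemma orth_sum_diff_norm d N M : (N <= M)%nat ->
  integral (fun x => (orth_sum d M x - orth_sum d N x) ^ 2) a b =
  c * (sum_f_R0 (fun n => d n ^ 2) M - sum_f_R0 (fun n => d n ^ 2) N).
Proof.
  intros HNM. set (d' := fun n => if Nat.leb n N then 0 else d n).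
  (* Stated for a general [h] vanishing at 0 because it is used twice: for the squares of the
     coefficients and for the terms of the series at a point. *)
  assert (S1 : forall (h : nat -> R -> R), (forall n, h n 0 = 0) -> forall M, (N <= M)%nat ->
    sum_f_R0 (fun n => h n (d' n)) M = sum_f_R0 (fun n => h n (d n)) M - sum_f_R0 (fun n => h n (d n)) N).
  { intros h Hh M' HM'; induction HM' as [|M' HM' IH].
    - rewrite Rminus_diag. rewrite <- (sum_eq_R0 (fun _ => 0) N) by auto.
      apply sum_eq. intros i Hi. unfold d'. apply Nat.leb_le in Hi. rewrite Hi. apply Hh.
    - simpl. rewrite IH. unfold d' at 1. replace (Nat.leb (S M') N) with false; [ring|].
      symmetry; apply Nat.leb_gt; lia. }
  rewrite <- (integral_ext a b Hab (fun x => orth_sum d' M x ^ 2)).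
  - rewrite orth_sum_norm. f_equal. apply (S1 (fun n z => z ^ 2)); auto. intros; ring.
  - intros x _. f_equal. apply (S1 (fun n z => z * e n x)); auto. intros; ring.
  - apply orth_sum_L2f.
Qed.

Lemma orth_sum_cauchy d B : (forall N, sum_f_R0 (fun n => d n ^ 2) N <= B) ->
  forall eps, 0 < eps -> exists N, forall m n, (N <= m)%nat -> (N <= n)%nat ->
    integral (fun x => (orth_sum d m x - orth_sum d n x) ^ 2) a b <= eps.
Proof.
  intros HB eps He.
  assert (Hs : ex_finite_lim_seq (sum_f_R0 (fun n => d n ^ 2))).
  { apply ex_finite_lim_seq_incr with B; auto. intro n. rewrite tech5.
    assert (Z := pow2_ge_0 (d (S n))). lra. }
  apply ex_lim_seq_cauchy_corr in Hs.
  assert (He' : 0 < eps / c) by (apply Rdiv_lt_0_compat; auto).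
  destruct (Hs (mkposreal _ He')) as [N HN]. exists N.
  assert (K : forall m n, (N <= n)%nat -> (n <= m)%nat ->
    integral (fun x => (orth_sum d m x - orth_sum d n x) ^ 2) a b <= eps).
  { intros m n Hn Hm. rewrite orth_sum_diff_norm by auto.
    specialize (HN m n ltac:(lia) Hn). unfold pos in HN.
    apply Rle_trans with (c * (eps / c)); [|right; field; lra].
    apply Rmult_le_compat_l; [lra|].
    apply Rle_trans with (1 := Rle_abs _). lra. }
  intros m n Hm Hn. destruct (Nat.le_ge_cases n m); [now apply K|].
  rewrite (integral_ext a b Hab _ (fun x => (orth_sum d n x - orth_sum d m x) ^ 2)).
  - now apply K.
  - intros; ring.
  - apply L2f_minus; auto; apply orth_sum_L2f.
Qed.

Lemma orth_sum_cvg d B : (forall N, sum_f_R0 (fun n => d n ^ 2) N <= B) ->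
  exists v, L2f v a b /\ cvgL2 (orth_sum d) v a b /\ integral (fun x => v x ^ 2) a b <= c * B.
Proof.
  intros HB.
  destruct (L2f_complete a b (orth_sum d)) as (v & Hv & Hcv); auto.
  - intro; apply orth_sum_L2f.
  - now apply orth_sum_cauchy with B.
  - exists v. split; [auto|]. split; [exact Hcv|].
    apply (cvgL2_norm_le a b (orth_sum d) v Hab); auto; [intro; apply orth_sum_L2f|].
    intro n. rewrite orth_sum_norm. apply Rmult_le_compat_l; [lra|auto].
Qed.

(** Identifies the L2 sum with the pointwise sum, applying Fatou's lemma to differences of partial
    sums. The exceptional point [p] is the diagonal of the logarithmic kernel, where the series is
    not claimed to converge. *)
Lemma orth_sum_pointwise d B (k : R -> R) p : (forall N, sum_f_R0 (fun n => d n ^ 2) N <= B) ->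
  (forall x, a <= x <= b -> x <> p -> is_lim_seq (fun N => orth_sum d N x) (k x)) ->
  L2f k a b /\ cvgL2 (orth_sum d) k a b.
Proof.
  intros HB Hk.
  set (S' := fun N x => if Req_dec_T x p then k x else orth_sum d N x).
  assert (Hpt : forall h, (forall x, a <= x <= b -> x <> p -> h x = 0) -> prim h (fun _ => 0) a b)
    by (intros; now apply prim_point with p).
  assert (HS : forall N x, x <> p -> orth_sum d N x = S' N x).
  { intros N x Hx. unfold S'. destruct Req_dec_T; tauto. }
  assert (S'L : forall N, L2f (S' N) a b).
  { intro N. split.
    - apply (Lone_null a b Hab (fun x => x = p) (orth_sum d N)); auto. apply orth_sum_L2f.
    - apply (Lone_null a b Hab (fun x => x = p) (fun x => orth_sum d N x ^ 2)); auto.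
      + intros; now rewrite HS.
      + apply orth_sum_L2f. }
  assert (Hlim : forall x, a <= x <= b -> is_lim_seq (fun N => S' N x) (k x)).
  { intros x Hx. unfold S'. destruct Req_dec_T; [apply is_lim_seq_const|now apply Hk]. }
  assert (K : forall eps, 0 < eps -> exists N, forall n, (N <= n)%nat ->
    L2f (fun x => k x - S' n x) a b /\ integral (fun x => (k x - S' n x) ^ 2) a b <= eps).
  { intros eps He. destruct (orth_sum_cauchy d B HB eps He) as [N HN]. exists N. intros n Hn.
    apply (L2f_limit a b Hab (fun j x => S' (j + n)%nat x - S' n x)).
    - intro j. now apply L2f_minus.
    - intro j.
      destruct (Lone_null a b Hab (fun x => x = p)
        (fun x => (orth_sum d (j + n) x - orth_sum d n x) ^ 2)
        (fun x => (S' (j + n)%nat x - S' n x) ^ 2)) as [_ ->]; auto.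
      + intros; now rewrite !HS.
      + apply L2f_minus; auto; apply orth_sum_L2f.
      + apply HN; lia.
    - intros x Hx. apply is_lim_seq_minus'; [|apply is_lim_seq_const].
      now apply (is_lim_seq_incr_n (fun j => S' j x)), Hlim. }
  split.
  - destruct (K 1) as [N HN]; [lra|]. destruct (HN N (le_n _)) as [A _].
    generalize (L2f_plus a b Hab _ _ A (S'L N)). apply L2f_ext; intros; ring.
  - intros eps He. destruct (K eps He) as [N HN]. exists N. intros n Hn.
    destruct (HN n Hn) as [A1 A2].
    destruct (Lone_null a b Hab (fun x => x = p) (fun x => (k x - S' n x) ^ 2)
      (fun x => (k x - orth_sum d n x) ^ 2)) as [_ ->]; auto; [|apply A1].
    intros; now rewrite HS.
Qed.

(** Term-by-term integration: L2 convergence implies convergence of the integrals over each [a,x],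
    so the pointwise sum [U] of the integrated series is a primitive of the L2 sum of the original
    one. *)
Lemma orth_sum_primitive d B (E : nat -> R -> R) (U : R -> R) :
  (forall N, sum_f_R0 (fun n => d n ^ 2) N <= B) ->
  (forall n, AC (e n) (E n) a b) ->
  (forall x, a <= x <= b -> is_lim_seq (fun N => sum_f_R0 (fun n => d n * E n x) N) (U x)) ->
  exists v, L2f v a b /\ AC v U a b /\ integral (fun x => v x ^ 2) a b <= c * B.
Proof.
  intros HB HE HU. destruct (orth_sum_cvg d B HB) as (v & Hv & Hcv & HvB).
  exists v. split; [auto|]. split; [|auto]. split; [apply Hv|].
  assert (Hp := Lone_prim a b Hab v (proj1 Hv)).
  assert (HS : forall N, AC (orth_sum d N) (fun x => sum_f_R0 (fun n => d n * E n x) N) a b).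
  { induction N as [|N IH]; [now apply (AC_scal (d O))|].
    apply (AC_plus _ _ (fun x => d (S N) * e (S N) x) (fun x => d (S N) * E (S N) x)); auto.
    now apply AC_scal. }
  assert (K : forall x, a <= x <= b -> U x - U a = integral v a x).
  { intros x Hx.
    assert (A := is_lim_seq_minus' _ _ _ _ (HU x Hx) (HU a ltac:(lra))).
    assert (B' := cvgL2_integral a b (orth_sum d) v a x Hab (fun n => orth_sum_L2f d n) Hv Hcv
      ltac:(lra) ltac:(lra) ltac:(lra)).
    apply is_lim_seq_unique in A. apply is_lim_seq_unique in B'.
    rewrite (Lim_seq_ext _ (fun n => integral (orth_sum d n) a x)) in A.
    - rewrite A in B'. now injection B'.
    - intro n. apply (AC_increment (orth_sum d n) (fun x => sum_f_R0 (fun n => d n * E n x) n)); [lra|].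
      eapply AC_sub; [apply HS| | |]; lra. }
  assert (Hconst : prim (fun _ => 0) (fun _ => U a) a b).
  { apply prim_derive. intros x _. exact (is_derive_const (V := R_NormedModule) (U a) x). }
  generalize (prim_plus _ _ _ _ _ _ Hp Hconst). apply prim_ext.
  - intros; ring.
  - intros x Hx. specialize (K x Hx). lra.
Qed.
End Orthogonal.

(** * Trigonometric systems and the logarithmic kernel *)

Lemma PI2_ge0 : 0 <= PI / 2.
Proof. assert (H := PI_RGT_0). lra. Qed.

Lemma sin_IZR_PI k : sin (IZR k * PI) = 0.
Proof. apply sin_eq_0_1. now exists k. Qed.

Lemma prim_cos p : p <> 0 -> prim (fun x => cos (p * x)) (fun x => sin (p * x) / p) 0 (PI / 2).
Proof. intros Hp. apply prim_derive. intros x _. auto_derive; [auto|]. field; auto. Qed.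

Lemma AC_cos p : p <> 0 -> AC (fun x => cos (p * x)) (fun x => sin (p * x) / p) 0 (PI / 2).
Proof.
  intros Hp. apply AC_derive; [apply PI2_ge0| |].
  - intros x _. auto_derive; [auto|]. field; auto.
  - intros x _. apply (ex_derive_continuous (fun x => cos (p * x))). auto_derive; auto.
Qed.

Lemma integral_cos_even p k : p = 2 * IZR k -> (k <> 0)%Z ->
  integral (fun x => cos (p * x)) 0 (PI / 2) = 0.
Proof.
  intros E Hk. assert (Hp : p <> 0) by (rewrite E; apply not_0_IZR in Hk; lra).
  rewrite (prim_integral _ _ _ _ PI2_ge0 (prim_cos p Hp)).
  replace (p * (PI / 2)) with (IZR k * PI) by (rewrite E; field).
  rewrite sin_IZR_PI, Rmult_0_r, sin_0. field; auto.
Qed.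

Lemma Lone_cos p : Lone (fun x => cos (p * x)) 0 (PI / 2).
Proof.
  apply Lone_continuous; [apply PI2_ge0|]. intros x _.
  apply (ex_derive_continuous (fun x => cos (p * x))). auto_derive; auto.
Qed.

Lemma L2f_cos p : L2f (fun x => cos (p * x)) 0 (PI / 2).
Proof.
  apply L2f_continuous; [apply PI2_ge0|]. intros x _.
  apply (ex_derive_continuous (fun x => cos (p * x))). auto_derive; auto.
Qed.

Lemma L2f_sin p : L2f (fun x => sin (p * x)) 0 (PI / 2).
Proof.
  apply L2f_continuous; [apply PI2_ge0|]. intros x _.
  apply (ex_derive_continuous (fun x => sin (p * x))). auto_derive; auto.
Qed.

Lemma cos_cos_integral p q :
  integral (fun x => cos (p * x) * cos (q * x)) 0 (PI / 2) =
  / 2 * (integral (fun x => cos ((p - q) * x)) 0 (PI / 2)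
         + integral (fun x => cos ((p + q) * x)) 0 (PI / 2)).
Proof.
  assert (H := PI2_ge0).
  rewrite <- integral_plus, <- integral_scal; auto using Lone_cos.
  - symmetry; apply integral_ext; auto.
    + intros x _. replace ((p - q) * x) with (p * x - q * x) by ring.
      replace ((p + q) * x) with (p * x + q * x) by ring.
      rewrite cos_minus, cos_plus. field.
    + apply Lone_scal; auto. apply Lone_plus; auto using Lone_cos.
  - apply Lone_plus; auto using Lone_cos.
Qed.

Lemma sin_sin_integral p q :
  integral (fun x => sin (p * x) * sin (q * x)) 0 (PI / 2) =
  / 2 * (integral (fun x => cos ((p - q) * x)) 0 (PI / 2)
         - integral (fun x => cos ((p + q) * x)) 0 (PI / 2)).
Proof.
  assert (H := PI2_ge0).
  rewrite <- integral_minus, <- integral_scal; auto using Lone_cos.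
  - symmetry; apply integral_ext; auto.
    + intros x _. replace ((p - q) * x) with (p * x - q * x) by ring.
      replace ((p + q) * x) with (p * x + q * x) by ring.
      rewrite cos_minus, cos_plus. field.
    + apply Lone_scal; auto. apply Lone_minus; auto using Lone_cos.
  - apply Lone_minus; auto using Lone_cos.
Qed.

Lemma integral_cos_0 p : p = 0 -> integral (fun x => cos (p * x)) 0 (PI / 2) = PI / 2.
Proof.
  intros ->. rewrite <- (integral_ext 0 (PI / 2) PI2_ge0 (fun _ => 1)).
  - rewrite integral_const by apply PI2_ge0. ring.
  - intros x _. now rewrite Rmult_0_l, cos_0.
  - apply Lone_const, PI2_ge0.
Qed.

(* A sequence of positive frequencies, all even or all odd. *)
Definition same_parity (f : nat -> R) : Prop :=
  forall n m, exists k l : Z, f n - f m = 2 * IZR k /\ f n + f m = 2 * IZR l /\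
    (n <> m -> k <> 0%Z) /\ (l <> 0)%Z.

Lemma same_parity_intro (f : nat -> R) (z : Z) : (0 < z)%Z ->
  (forall n, f n = 2 * INR n + IZR z) -> same_parity f.
Proof.
  intros Hz H n m. exists (Z.of_nat n - Z.of_nat m)%Z, (Z.of_nat n + Z.of_nat m + z)%Z.
  rewrite !H, !minus_IZR, !plus_IZR, <- !INR_IZR_INZ. repeat split; try ring; lia.
Qed.

Lemma cos_orth f : same_parity f -> forall n m, n <> m ->
  integral (fun x => cos (f n * x) * cos (f m * x)) 0 (PI / 2) = 0.
Proof.
  intros H n m Hnm. destruct (H n m) as (k & l & E1 & E2 & Hk & Hl).
  rewrite cos_cos_integral, (integral_cos_even _ k E1), (integral_cos_even _ l E2) by auto. ring.
Qed.

Lemma sin_orth f : same_parity f -> forall n m, n <> m ->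
  integral (fun x => sin (f n * x) * sin (f m * x)) 0 (PI / 2) = 0.
Proof.
  intros H n m Hnm. destruct (H n m) as (k & l & E1 & E2 & Hk & Hl).
  rewrite sin_sin_integral, (integral_cos_even _ k E1), (integral_cos_even _ l E2) by auto. ring.
Qed.

Lemma cos_norm f : same_parity f -> forall n,
  integral (fun x => cos (f n * x) ^ 2) 0 (PI / 2) = PI / 4.
Proof.
  intros H n. destruct (H n n) as (k & l & _ & E2 & _ & Hl).
  rewrite (integral_ext 0 (PI / 2) PI2_ge0 _ (fun x => cos (f n * x) * cos (f n * x)));
    [|intros; ring|apply L2f_cos].
  rewrite cos_cos_integral, integral_cos_0 by ring. rewrite (integral_cos_even _ l E2) by auto. field.
Qed.

Lemma sin_norm f : same_parity f -> forall n,
  integral (fun x => sin (f n * x) ^ 2) 0 (PI / 2) = PI / 4.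
Proof.
  intros H n. destruct (H n n) as (k & l & _ & E2 & _ & Hl).
  rewrite (integral_ext 0 (PI / 2) PI2_ge0 _ (fun x => sin (f n * x) * sin (f n * x)));
    [|intros; ring|apply L2f_sin].
  rewrite sin_sin_integral, integral_cos_0 by ring. rewrite (integral_cos_even _ l E2) by auto. field.
Qed.

Lemma same_parity_neq0 f : same_parity f -> forall n, f n <> 0.
Proof.
  intros H n E. destruct (H n n) as (k & l & _ & E2 & _ & Hl). rewrite E in E2.
  apply Hl, eq_IZR. lra.
Qed.

Lemma is_derive_sum (f : nat -> R -> R) (df : nat -> R) x N :
  (forall n, is_derive (f n) x (df n)) ->
  is_derive (fun x => sum_f_R0 (fun n => f n x) N) x (sum_f_R0 df N).
Proof.
  intros H; induction N as [|N IH]; [apply H|].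
  apply (is_derive_plus (V := R_NormedModule) (fun x => sum_f_R0 (fun n => f n x) N) (f (S N))); auto.
Qed.

Lemma sin_sum_closed N x :
  2 * sin (x / 2) * sum_f_R0 (fun n => sin (INR (S n) * x)) N =
  cos (x / 2) - cos ((INR N + 3 / 2) * x).
Proof.
  induction N as [|N IH].
  - simpl. replace (1 * x) with (x / 2 + x / 2) by field.
    replace ((0 + 3 / 2) * x) with (x / 2 + x / 2 + x / 2) by field.
    rewrite !cos_plus, !sin_plus. assert (E := sin2_cos2 (x / 2)). unfold Rsqr in E.
    set (s := sin (x / 2)) in *. set (c := cos (x / 2)) in *.
    apply Rminus_diag_uniq. transitivity (c * (s * s + c * c - 1)); [ring|]. rewrite E; ring.
  - rewrite tech5, Rmult_plus_distr_l, IH.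
    replace ((INR N + 3 / 2) * x) with (INR (S (S N)) * x - x / 2) by (rewrite !S_INR; field).
    replace ((INR (S N) + 3 / 2) * x) with (INR (S (S N)) * x + x / 2) by (rewrite !S_INR; field).
    rewrite cos_minus, cos_plus. ring.
Qed.

(** The derivative of [D N + ln (sin (t / 2))] is the oscillating term cos((N + 3/2) t) / (2
    sin(t/2)). Once its approximate primitive [Q] is removed, a derivative of order 1/N remains, and
    the mean value theorem concludes. Working with a difference of two points avoids the constant ln
    2 of the classical expansion. *)
Lemma log_sine_series x y : 0 < x -> x <= y -> y < 2 * PI ->
  is_lim_seq (fun N => sum_f_R0 (fun n => cos (INR (S n) * x) / INR (S n)) N
                       - sum_f_R0 (fun n => cos (INR (S n) * y) / INR (S n)) N)
    (ln (sin (y / 2)) - ln (sin (x / 2))).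
Proof.
  intros Hx Hxy Hy.
  destruct (continuity_ab_min (fun t => sin (t / 2)) x y Hxy) as (mx & Hm & Hmx).
  { intros t _. apply continuity_pt_filterlim.
    apply (ex_derive_continuous (fun t => sin (t / 2))). auto_derive; auto. }
  set (m := sin (mx / 2)) in *.
  assert (m0 : 0 < m) by (apply sin_gt_0; lra).
  set (D := fun N t => sum_f_R0 (fun n => cos (INR (S n) * t) / INR (S n)) N).
  (* One integration by parts of the oscillating term. The shift is 3/2 because the sum up to index
     N has N + 1 terms, the last of frequency N + 1. *)
  set (Q := fun N t => sin ((INR N + 3 / 2) * t) / (2 * (INR N + 3 / 2) * sin (t / 2))).
  set (Rm := fun N t => D N t + ln (sin (t / 2)) - Q N t).
  assert (HR : forall N t, x <= t <= y -> is_derive (Rm N) t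
    (sin ((INR N + 3 / 2) * t) * cos (t / 2) / (4 * (INR N + 3 / 2) * sin (t / 2) ^ 2))).
  { intros N t Ht. assert (Hs := Hm t Ht).
    assert (HN := pos_INR N).
    assert (HD : is_derive (D N) t (- sum_f_R0 (fun n => sin (INR (S n) * t)) N)).
    { replace (- sum_f_R0 (fun n => sin (INR (S n) * t)) N) with
        (sum_f_R0 (fun n => - sin (INR (S n) * t)) N).
      - apply (is_derive_sum (fun n t => cos (INR (S n) * t) / INR (S n))). intro n.
        assert (Hk : INR (S n) <> 0) by (apply not_0_INR; lia).
        revert Hk. generalize (INR (S n)). intros k Hk.
        auto_derive; [auto|]. field; auto.
      - rewrite <- (Rmult_1_l (sum_f_R0 (fun n => sin _) N)), Ropp_mult_distr_l, scal_sum.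
        apply sum_eq; intros; ring. }
    assert (HL : is_derive (fun t => ln (sin (t / 2)) - Q N t) t
      (cos (t / 2) / (2 * sin (t / 2)) - (cos ((INR N + 3 / 2) * t) / (2 * sin (t / 2)) -
        sin ((INR N + 3 / 2) * t) * cos (t / 2) / (4 * (INR N + 3 / 2) * sin (t / 2) ^ 2)))).
    { unfold Q. auto_derive.
      - repeat split; try lra. apply Rgt_not_eq. apply Rmult_lt_0_compat; lra.
      - unfold Rdiv. field. split; lra. }
    assert (HS := is_derive_plus (V := R_NormedModule) _ _ _ _ _ HD HL).
    replace (plus _ _) with
      (sin ((INR N + 3 / 2) * t) * cos (t / 2) / (4 * (INR N + 3 / 2) * sin (t / 2) ^ 2)) in HS.
    - revert HS. apply is_derive_ext. intro u. unfold plus, Rm; simpl. ring.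
    - change (plus ?u ?v) with (u + v).
      assert (HC := sin_sum_closed N t).
      replace (sum_f_R0 (fun n => sin (INR (S n) * t)) N) with
        ((cos (t / 2) - cos ((INR N + 3 / 2) * t)) / (2 * sin (t / 2))) by (rewrite <- HC; field; lra).
      field. split; lra. }
  assert (HB : forall N, Rabs ((D N x - D N y) - (ln (sin (y / 2)) - ln (sin (x / 2))))
    <= ((y - x) / (4 * m ^ 2) + 1 / m) * / (INR N + 3 / 2)).
  { intro N. assert (HN := pos_INR N).
    assert (W0 : 0 < / (INR N + 3 / 2)) by (apply Rinv_0_lt_compat; lra).
    assert (Hder : forall t, x <= t <= y ->
      Rabs (sin ((INR N + 3 / 2) * t) * cos (t / 2) / (4 * (INR N + 3 / 2) * sin (t / 2) ^ 2))
      <= / (4 * m ^ 2) * / (INR N + 3 / 2)).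
    { intros t Ht. assert (Hs := Hm t Ht).
      unfold Rdiv. rewrite Rabs_mult, Rabs_mult.
      assert (P1 : Rabs (sin ((INR N + 3 / 2) * t)) <= 1) by (apply Rabs_le; apply SIN_bound).
      assert (P2 : Rabs (cos (t / 2)) <= 1) by (apply Rabs_le; apply COS_bound).
      assert (P3 : m ^ 2 <= sin (t / 2) ^ 2) by (apply pow_incr; lra).
      assert (P4 : 0 < m ^ 2) by (apply pow_lt; auto).
      assert (P5 : 0 < 4 * (INR N + 3 * / 2) * m ^ 2) by (apply Rmult_lt_0_compat; lra).
      assert (P6 : 4 * (INR N + 3 * / 2) * m ^ 2 <= 4 * (INR N + 3 * / 2) * sin (t * / 2) ^ 2)
        by (apply Rmult_le_compat_l; [lra|exact P3]).
      rewrite (Rabs_pos_eq (/ (4 * _ * _))).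
      2:{ apply Rlt_le, Rinv_0_lt_compat. lra. }
      rewrite <- (Rmult_1_l (/ (4 * m ^ 2) * _)).
      apply Rmult_le_compat; try (apply Rmult_le_pos; apply Rabs_pos).
      - apply Rlt_le, Rinv_0_lt_compat. lra.
      - rewrite <- (Rmult_1_l 1). apply Rmult_le_compat; auto; apply Rabs_pos.
      - rewrite <- Rinv_mult.
        replace (4 * m ^ 2 * (INR N + 3 * / 2)) with (4 * (INR N + 3 * / 2) * m ^ 2) by ring.
        apply Rinv_le_contravar; auto. }
    assert (HM : Rabs (Rm N y - Rm N x) <= (y - x) / (4 * m ^ 2) * / (INR N + 3 / 2)).
    { destruct (Req_dec x y) as [<-|Hne].
      - rewrite !Rminus_diag, Rabs_R0. unfold Rdiv. rewrite !Rmult_0_l. lra.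
      - destruct (MVT_cor2 (Rm N) _ x y ltac:(lra) (fun t Ht => proj1 (is_derive_Reals _ _ _) (HR N t Ht)))
          as (c & E & Hc). rewrite E, Rabs_mult, (Rabs_pos_eq (y - x)) by lra.
        replace ((y - x) / (4 * m ^ 2) * / (INR N + 3 / 2)) with
          (/ (4 * m ^ 2) * / (INR N + 3 / 2) * (y - x)) by (unfold Rdiv; ring).
        apply Rmult_le_compat_r; [lra|]. apply Hder; lra. }
    assert (HQ : forall t, x <= t <= y -> Rabs (Q N t) <= / (2 * m) * / (INR N + 3 / 2)).
    { intros t Ht. assert (Hs := Hm t Ht). unfold Q, Rdiv. rewrite Rabs_mult.
      assert (P1 : Rabs (sin ((INR N + 3 * / 2) * t)) <= 1) by (apply Rabs_le; apply SIN_bound).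
      assert (P5 : 0 < 2 * (INR N + 3 * / 2) * m) by (apply Rmult_lt_0_compat; lra).
      assert (P6 : 2 * (INR N + 3 * / 2) * m <= 2 * (INR N + 3 * / 2) * sin (t * / 2))
        by (apply Rmult_le_compat_l; [lra|exact Hs]).
      rewrite (Rabs_pos_eq (/ _)) by (apply Rlt_le, Rinv_0_lt_compat; lra).
      rewrite <- (Rmult_1_l (/ (2 * m) * _)).
      apply Rmult_le_compat; auto; try apply Rabs_pos.
      - apply Rlt_le, Rinv_0_lt_compat. lra.
      - rewrite <- Rinv_mult.
        replace (2 * m * (INR N + 3 * / 2)) with (2 * (INR N + 3 * / 2) * m) by ring.
        apply Rinv_le_contravar; auto. }
    assert (Q1 := HQ x ltac:(lra)). assert (Q2 := HQ y ltac:(lra)).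
    replace ((D N x - D N y) - (ln (sin (y / 2)) - ln (sin (x / 2)))) with
      (- (Rm N y - Rm N x) + (Q N x - Q N y)) by (unfold Rm; ring).
    replace (((y - x) / (4 * m ^ 2) + 1 / m) * / (INR N + 3 / 2)) with
      ((y - x) / (4 * m ^ 2) * / (INR N + 3 / 2) +
       (/ (2 * m) * / (INR N + 3 / 2) + / (2 * m) * / (INR N + 3 / 2))) by (field; lra).
    eapply Rle_trans; [apply Rabs_triang|]. rewrite Rabs_Ropp.
    apply Rplus_le_compat; auto. split_Rabs; lra. }
  assert (H0 : is_lim_seq (fun N => ((y - x) / (4 * m ^ 2) + 1 / m) * / (INR N + 3 / 2)) 0).
  { replace (Finite 0) with (Rbar_mult ((y - x) / (4 * m ^ 2) + 1 / m) 0)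
      by (simpl; f_equal; ring).
    apply is_lim_seq_scal_l. apply (is_lim_seq_inv _ p_infty); [|discriminate].
    apply (is_lim_seq_plus _ _ p_infty (3 / 2)); [apply is_lim_seq_INR|apply is_lim_seq_const|easy]. }
  assert (H1 := is_lim_seq_abs_0 (fun N => (D N x - D N y) - (ln (sin (y / 2)) - ln (sin (x / 2))))).
  apply is_lim_seq_ext with (fun N => ((D N x - D N y) - (ln (sin (y / 2)) - ln (sin (x / 2))))
    + (ln (sin (y / 2)) - ln (sin (x / 2)))); [intro; unfold D; ring|].
  replace (Finite (ln (sin (y / 2)) - ln (sin (x / 2)))) with
    (Finite (0 + (ln (sin (y / 2)) - ln (sin (x / 2))))) by (f_equal; ring).
  apply is_lim_seq_plus'; [|apply is_lim_seq_const].
  apply H1. apply is_lim_seq_le_le with (fun _ => 0)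
    (fun N => ((y - x) / (4 * m ^ 2) + 1 / m) * / (INR N + 3 / 2)); auto.
  - intro N. split; [apply Rabs_pos|apply HB].
  - apply is_lim_seq_const.
Qed.

(** Starts at 2, leaving out the zero mode, on which the sine vanishes; the neighbours of
    [odd_freq n] are then [even_freq n] above and [2 * INR n] below. *)
Definition even_freq (n : nat) : R := 2 * INR (S n).
Definition odd_freq (n : nat) : R := 2 * INR n + 1.

Lemma even_freq_parity : same_parity even_freq.
Proof.
  apply same_parity_intro with 2%Z; [lia|]. intro n. unfold even_freq. rewrite S_INR. ring.
Qed.

Lemma odd_freq_parity : same_parity odd_freq.
Proof. apply same_parity_intro with 1%Z; [lia|]. reflexivity. Qed.

Lemma sum_inv_sq_le N : sum_f_R0 (fun n => (/ INR (S n)) ^ 2) N <= 2 - / INR (S N).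
Proof.
  induction N as [|N IH]; [simpl; lra|]. rewrite tech5.
  assert (P : 0 < INR (S N)) by (apply lt_0_INR; lia).
  rewrite (S_INR (S N)). set (k := INR (S N)) in *.
  assert (E : 2 - / (k + 1) - (2 - / k + (/ (k + 1)) ^ 2) = / (k * (k + 1) ^ 2)) by (field; lra).
  assert (0 < / (k * (k + 1) ^ 2)); [|lra].
  apply Rinv_0_lt_compat, Rmult_lt_0_compat; [auto|]. apply pow_lt; lra.
Qed.

Definition kernel_coef (sigma : R) (n : nat) : R := 2 * sin (even_freq n * sigma) / INR (S n).

Lemma kernel_coef_sq_sum sigma N : sum_f_R0 (fun n => kernel_coef sigma n ^ 2) N <= 8.
Proof.
  apply Rle_trans with (4 * sum_f_R0 (fun n => (/ INR (S n)) ^ 2) N).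
  - rewrite scal_sum. apply sum_Rle. intros n _. unfold kernel_coef, Rdiv.
    rewrite Rpow_mult_distr. assert (A := pow2_ge_0 (/ INR (S n))).
    assert (B := SIN_bound (even_freq n * sigma)). rewrite Rmult_comm.
    apply Rmult_le_compat_l; auto. nra.
  - assert (A := sum_inv_sq_le N).
    assert (0 < / INR (S N)) by (apply Rinv_0_lt_compat, lt_0_INR; lia). lra.
Qed.

(** The log-sine series between the angles 2|s - sigma| and 2(s + sigma), followed by cos(A - B) -
    cos(A + B) = 2 sin A sin B. Distinctness of [s] and [sigma] keeps the smaller angle positive and
    the larger one below 2 PI. *)
Lemma kernel_series s sigma : 0 <= s <= PI / 2 -> 0 <= sigma <= PI / 2 -> s <> sigma ->
  is_lim_seq (fun N => orth_sum (fun n x => sin (even_freq n * x)) (kernel_coef sigma) N s)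
    (Kker s sigma).
Proof.
  intros Hs Hsig Hne.
  assert (Habs : 0 < Rabs (s - sigma) <= PI / 2).
  { split; [apply Rabs_pos_lt; lra|split_Rabs; lra]. }
  assert (Hle : Rabs (s - sigma) <= s + sigma) by (split_Rabs; lra).
  assert (Hlt : s + sigma < PI) by lra.
  assert (H := log_sine_series (2 * Rabs (s - sigma)) (2 * (s + sigma)) ltac:(lra) ltac:(lra) ltac:(lra)).
  replace (2 * (s + sigma) / 2) with (s + sigma) in H by field.
  replace (2 * Rabs (s - sigma) / 2) with (Rabs (s - sigma)) in H by field.
  assert (P1 : 0 < sin (s + sigma)) by (apply sin_gt_0; lra).
  assert (P2 : 0 < sin (Rabs (s - sigma))) by (apply sin_gt_0; lra).
  assert (E2 : sin (Rabs (s - sigma)) = Rabs (sin (s - sigma))).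
  { rewrite <- (Rabs_pos_eq (sin (Rabs (s - sigma)))) by lra.
    unfold Rabs at 2; destruct Rcase_abs; auto. now rewrite sin_neg, Rabs_Ropp. }
  replace (Kker s sigma) with (ln (sin (s + sigma)) - ln (sin (Rabs (s - sigma)))).
  - revert H. apply is_lim_seq_ext. intro N. rewrite <- minus_sum.
    apply sum_eq. intros n _. unfold kernel_coef, even_freq.
    assert (Hk : INR (S n) <> 0) by (apply not_0_INR; lia). set (k := INR (S n)) in *.
    replace (cos (k * (2 * Rabs (s - sigma)))) with (cos (2 * k * s - 2 * k * sigma)).
    + replace (k * (2 * (s + sigma))) with (2 * k * s + 2 * k * sigma) by ring.
      rewrite cos_minus, cos_plus. field; auto.
    + unfold Rabs; destruct Rcase_abs; [rewrite <- cos_neg|]; f_equal; ring.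
  - assert (Hn : sin (s - sigma) <> 0) by (intro E; rewrite E, Rabs_R0 in E2; lra).
    unfold Kker. rewrite (Rabs_div _ _ Hn), <- E2, (Rabs_pos_eq (sin (s + sigma))) by lra.
    unfold Rdiv. rewrite ln_mult, ln_Rinv by (auto; now apply Rinv_0_lt_compat). reflexivity.
Qed.

Definition sine_coef (f : R -> R) (freq : R) : R :=
  integral (fun x => f x * sin (freq * x)) 0 (PI / 2) / (PI / 4).

(** For fixed [sigma] the kernel series converges in L2 in the variable [s], so it may be paired
    with [zeta] term by term; the result holds at every [sigma], endpoints included. The constants
    combine as (1/PI)(2/(n+1))(PI/4) = 1/(2(n+1)). *)
Lemma Hop_series zeta sigma : L2f zeta 0 (PI / 2) -> 0 <= sigma <= PI / 2 ->
  is_lim_seq (fun N => sum_f_R0 (fun n => sine_coef zeta (even_freq n) *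
      (sin (even_freq n * sigma) / even_freq n)) N) (Hop zeta sigma).
Proof.
  intros Hz Hsig. assert (HP := PI_RGT_0).
  assert (Hpar := even_freq_parity).
  destruct (orth_sum_pointwise 0 (PI / 2) (PI / 4) (fun n x => sin (even_freq n * x))
    PI2_ge0 ltac:(lra) (fun n => L2f_sin _) (sin_orth _ Hpar) (sin_norm _ Hpar)
    (kernel_coef sigma) 8 (fun s => Kker s sigma) sigma) as [KL Kc].
  - apply kernel_coef_sq_sum.
  - intros. now apply kernel_series.
  - assert (H := cvgL2_inner 0 (PI / 2) _ _ PI2_ge0
      (fun n => orth_sum_L2f 0 (PI / 2) _ PI2_ge0 (fun n => L2f_sin (even_freq n)) (kernel_coef sigma) n)
      KL Kc zeta Hz).
    apply (is_lim_seq_scal_l _ (/ PI)) in H.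
    change (Rbar_mult (/ PI) (integral (fun x => Kker x sigma * zeta x) 0 (PI / 2)))
      with (Finite (Hop zeta sigma)) in H.
    revert H. apply is_lim_seq_ext. intro N.
    rewrite (orth_sum_inner 0 (PI / 2) _ PI2_ge0 (fun n => L2f_sin (even_freq n))) by auto.
    rewrite scal_sum. apply sum_eq. intros n _. unfold sine_coef, kernel_coef, even_freq.
    assert (INR (S n) <> 0) by (apply not_0_INR; lia). field. split; lra.
Qed.

Lemma sine_bessel f freq N : L2f f 0 (PI / 2) -> same_parity freq ->
  sum_f_R0 (fun n => sine_coef f (freq n) ^ 2) N <=
  integral (fun x => f x ^ 2) 0 (PI / 2) / (PI / 4).
Proof.
  intros Hf Hp. assert (HP := PI_RGT_0).
  assert (H := bessel 0 (PI / 2) (PI / 4) (fun n x => sin (freq n * x)) PI2_ge0 ltac:(lra)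
    (fun n => L2f_sin _) (sin_orth _ Hp) (sin_norm _ Hp) f N Hf).
  apply Rmult_le_reg_l with (PI / 4); [lra|].
  replace (PI / 4 * (integral (fun x => f x ^ 2) 0 (PI / 2) / (PI / 4))) with
    (integral (fun x => f x ^ 2) 0 (PI / 2)) by (field; lra). exact H.
Qed.

(** Bessel in the sine system and Riesz-Fischer in the cosine system meet here: both have squared
    norm PI/4, so conjugation does not increase the norm. It serves twice, with even frequencies for
    [zeta] and with odd ones for [h]. *)
Lemma conjugate_AC f freq (U : R -> R) : L2f f 0 (PI / 2) -> same_parity freq ->
  (forall x, 0 <= x <= PI / 2 -> is_lim_seq (fun N => sum_f_R0 (fun n =>
     sine_coef f (freq n) * (sin (freq n * x) / freq n)) N) (U x)) ->
  exists v, L2f v 0 (PI / 2) /\ AC v U 0 (PI / 2) /\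
    integral (fun x => v x ^ 2) 0 (PI / 2) <= integral (fun x => f x ^ 2) 0 (PI / 2).
Proof.
  intros Hf Hp HU. assert (HP := PI_RGT_0).
  destruct (orth_sum_primitive 0 (PI / 2) (PI / 4) (fun n x => cos (freq n * x)) PI2_ge0 ltac:(lra)
    (fun n => L2f_cos _) (cos_orth _ Hp) (cos_norm _ Hp) (fun n => sine_coef f (freq n))
    (integral (fun x => f x ^ 2) 0 (PI / 2) / (PI / 4))
    (fun n x => sin (freq n * x) / freq n) U) as (v & Hv & HA & HB); auto.
  - intro N. now apply sine_bessel.
  - intro n. now apply AC_cos, same_parity_neq0.
  - exists v. split; [auto|]. split; [auto|].
    replace (PI / 4 * (integral (fun x => f x ^ 2) 0 (PI / 2) / (PI / 4))) with
      (integral (fun x => f x ^ 2) 0 (PI / 2)) in HB by (field; lra). exact HB.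
Qed.

(** * Local regularity *)

Lemma prim_glue f F a c b : a <= c -> c <= b -> prim f F a c -> prim f F c b -> prim f F a b.
Proof.
  intros Hac Hcb H1 H2. apply prim_intro with 2; [lra|]. intros eps He.
  destruct (H1 eps He) as (d1 & G1 & Hd1 & I1 & E1 & T1).
  destruct (H2 eps He) as (d2 & G2 & Hd2 & I2 & E2 & T2).
  set (G := fun x => if Rle_dec x c then G1 x else G1 c + (G2 x - G2 c)).
  assert (GL : forall x, x <= c -> G x = G1 x) by (intros; unfold G; destruct Rle_dec; lra).
  assert (GR : forall x, c <= x -> G x = G1 c + (G2 x - G2 c)).
  { intros x Hx; unfold G; destruct Rle_dec; [|lra]. replace x with c by lra. ring. }
  (* Unless the tag is [c] itself, the gauge does not let [y] cross [c], so each estimate stays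
     within one of the two pieces. *)
  exists (fun t => if Req_dec_T t c then Rmin (d1 t) (d2 t)
                   else Rmin (Rabs (t - c)) (if Rle_dec t c then d1 t else d2 t)), G.
  split.
  { intro t. destruct Req_dec_T; [apply Rmin_pos; auto|].
    apply Rmin_pos; [apply Rabs_pos_lt; lra|]. destruct Rle_dec; auto. }
  split.
  { intros x y Hx Hxy Hy. destruct (Rle_dec y c).
    - rewrite !GL by lra. apply I1; lra.
    - destruct (Rle_dec c x).
      + rewrite !GR by lra. assert (A := I2 x y ltac:(lra) ltac:(lra) ltac:(lra)). lra.
      + rewrite (GL x), (GR y) by lra.
        assert (A := I1 x c ltac:(lra) ltac:(lra) ltac:(lra)).
        assert (B := I2 c y ltac:(lra) ltac:(lra) ltac:(lra)). lra. }
  split; [rewrite (GL a), (GR b) by lra; lra|].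
  assert (L : forall t y, a <= t <= c -> a <= y <= c -> Rabs (y - t) < d1 t ->
    Rabs (f t * (y - t) - (F y - F t)) <= Rabs (G y - G t)).
  { intros t y Ht Hy Hd. rewrite !GL by lra. now apply T1. }
  assert (K : forall t y, c <= t <= b -> c <= y <= b -> Rabs (y - t) < d2 t ->
    Rabs (f t * (y - t) - (F y - F t)) <= Rabs (G y - G t)).
  { intros t y Ht Hy Hd. rewrite !GR by lra.
    replace (G1 c + (G2 y - G2 c) - (G1 c + (G2 t - G2 c))) with (G2 y - G2 t) by ring.
    now apply T2. }
  intros t y Ht Hy Hty. destruct Req_dec_T as [->|Hne].
  - assert (A := Rlt_le_trans _ _ _ Hty (Rmin_l _ _)).
    assert (B := Rlt_le_trans _ _ _ Hty (Rmin_r _ _)).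
    destruct (Rle_dec y c); [apply L|apply K]; lra.
  - assert (A := Rlt_le_trans _ _ _ Hty (Rmin_l _ _)).
    assert (B := Rlt_le_trans _ _ _ Hty (Rmin_r _ _)).
    destruct Rle_dec; [apply L|apply K]; auto; split; split_Rabs; lra.
Qed.

(** Meant for [Q s / sin s], controlled only away from 0. A test function vanishes on a
    neighbourhood of 0, so the product rule on [c/2, b] glues with the zero function on [0, c/2]. *)
Lemma AC_local_weak_deriv f F b : 0 < b -> cont_on F 0 b ->
  (forall delta, 0 < delta < b -> AC f F delta b) -> weak_deriv F f 0 b.
Proof.
  intros Hb HC HA. split.
  - intros c d Hc Hcd Hd. destruct (HA c ltac:(lra)) as [H1 _].
    split; apply Lone_L1; try lra.
    + apply Lone_cont; [lra|]. apply AC_cont with f.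
      apply (AC_sub f F c b); try lra. apply HA; lra.
    + apply (Lone_sub f c b); auto; lra.
  - intros phi dphi Ht Hphi.
    destruct (test_fun_derive _ _ _ _ Ht Hphi) as (H1 & H2 & c & d & Hc & Hcd & Hd & Hs).
    assert (L1 : Lone (fun x => F x * dphi x) 0 b).
    { apply Lone_cont_mult; auto; [lra|]. apply Lone_continuous; auto; lra. }
    assert (HM : prim (fun x => f x * phi x + F x * dphi x) (fun x => F x * phi x) 0 b).
    { apply prim_glue with (c / 2); try lra.
      - apply prim_ext with (fun _ => 0) (fun _ => 0).
        + intros x Hx. destruct (Hs x ltac:(lra)) as [-> ->]. ring.
        + intros x Hx. destruct (Hs x ltac:(lra)) as [-> _]. ring.
        + apply prim_point with 0; [lra|auto].
      - assert (HG : AC dphi phi (c / 2) b) by (apply AC_derive; auto; lra).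
        apply (AC_mult f F dphi phi (c / 2) b); auto; [lra|]. apply HA; lra. }
    assert (HP := prim_minus _ _ _ _ _ _ HM (Lone_prim 0 b ltac:(lra) _ L1)).
    apply (prim_ext_l _ (fun x => f x * phi x)) in HP; [|intros; ring].
    rewrite (prim_integral _ _ 0 b ltac:(lra) HP).
    rewrite (proj1 (Hs b ltac:(lra))), (proj1 (Hs 0 ltac:(lra))).
    assert (E := prim_integral _ _ 0 b ltac:(lra) (Lone_prim 0 b ltac:(lra) _ L1)). lra.
Qed.

Lemma AC_uniform_limit (f F : nat -> R -> R) (g G : R -> R) a b : a <= b -> Lone g a b ->
  (forall n, AC (f n) (F n) a b) ->
  (forall eps, 0 < eps -> exists N, forall n x, (N <= n)%nat -> a <= x <= b ->
    Rabs (g x - f n x) <= eps) ->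
  (forall x, a <= x <= b -> is_lim_seq (fun n => F n x) (G x)) ->
  AC g G a b.
Proof.
  intros Hab Hg Hf Hu HG. split; auto.
  assert (Hp := Lone_prim a b Hab g Hg).
  assert (K : forall x, a <= x <= b -> G x - G a = integral g a x).
  { intros x Hx. assert (A := is_lim_seq_minus' _ _ _ _ (HG x Hx) (HG a ltac:(lra))).
    assert (E : integral g a a = 0).
    { rewrite (prim_integral g (integral g a) a a (Rle_refl a)); [ring|].
      apply (prim_sub _ _ a b); auto; lra. }
    assert (B : is_lim_seq (fun n => F n x - F n a) (integral g a x)).
    { apply is_lim_seq_spec. intro e. assert (He := cond_pos e).
      assert (He' : 0 < e / 2 / (b - a + 1)) by (apply Rdiv_lt_0_compat; lra).
      destruct (Hu _ He') as [N HN].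
      exists N. intros n Hn.
      assert (D := prim_minus _ _ _ _ _ _ Hp (proj2 (Hf n))).
      assert (C := proj2 (AC_derive (fun _ => e / 2 / (b - a + 1)) (fun x => e / 2 / (b - a + 1) * x) a b Hab
        (fun x _ => ltac:(auto_derive; [auto|ring])) (fun x _ => continuous_const _ x))).
      assert (Q := prim_abs_le_sub _ _ _ _ a b a x D C (fun x Hx => HN n x Hn Hx) ltac:(lra) Hx).
      cbv beta in Q. rewrite E in Q.
      replace (F n x - F n a - integral g a x) with (- (integral g a x - F n x - (0 - F n a))) by ring.
      rewrite Rabs_Ropp. apply Rle_lt_trans with (1 := Q).
      rewrite <- Rmult_minus_distr_l, Rabs_mult, !Rabs_pos_eq by lra.
      apply Rle_lt_trans with (e / 2 / (b - a + 1) * (b - a + 1)).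
      - apply Rmult_le_compat_l; lra.
      - replace (e / 2 / (b - a + 1) * (b - a + 1)) with (e / 2) by (field; lra). lra. }
    apply is_lim_seq_unique in A. apply is_lim_seq_unique in B. rewrite A in B.
    now injection B. }
  assert (Hconst : prim (fun _ => 0) (fun _ => G a) a b).
  { apply prim_derive. intros x _. exact (is_derive_const (V := R_NormedModule) (G a) x). }
  generalize (prim_plus _ _ _ _ _ _ Hp Hconst). apply prim_ext.
  - intros; ring.
  - intros x Hx. specialize (K x Hx). lra.
Qed.

Lemma AC_holder f F a b M : a <= b -> 0 <= M -> L2f f a b -> AC f F a b ->
  integral (fun x => f x ^ 2) a b <= M ^ 2 ->
  forall x y, a <= x <= b -> a <= y <= b -> Rabs (F x - F y) <= M * sqrt (Rabs (x - y)).
Proof.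
  intros Hab HM Hf HF HI.
  assert (K : forall x y, a <= x -> x <= y -> y <= b -> Rabs (F y - F x) <= M * sqrt (y - x)).
  { intros x y Hx Hxy Hy.
    assert (Hf' := L2f_sub f a b x y Hf Hx Hxy Hy).
    assert (H1 : L2f (fun _ => 1) x y) by (apply L2f_continuous; auto; intros; apply continuous_const).
    assert (CS := cauchy_schwarz x y Hxy _ _ Hf' H1). cbv beta in CS.
    rewrite <- (integral_ext x y Hxy f (fun z => f z * 1)) in CS by (intros; try apply Hf'; ring).
    rewrite <- (integral_ext x y Hxy (fun _ => 1) (fun z => 1 ^ 2)) in CS
      by (intros; try (apply Lone_const; auto); ring).
    rewrite integral_const in CS by auto.
    rewrite <- (AC_increment f F x y Hxy (AC_sub _ _ _ _ _ _ HF Hx Hxy Hy)) in CS.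
    assert (B := integral_sub_le (fun x => f x ^ 2) a b x y (fun z _ => pow2_ge_0 (f z)) (proj2 Hf) Hx Hxy Hy).
    apply Rsqr_incr_0; [|apply Rabs_pos|apply Rmult_le_pos; [auto|apply sqrt_pos]].
    rewrite <- Rsqr_abs, Rsqr_mult, Rsqr_sqrt by lra. unfold Rsqr.
    apply Rle_trans with (integral (fun z => f z ^ 2) x y * (1 * (y - x))); [lra|].
    rewrite Rmult_1_l. apply Rmult_le_compat_r; lra. }
  intros x y Hx Hy. destruct (Rle_dec x y).
  - rewrite Rabs_minus_sym, (Rabs_minus_sym x y), (Rabs_pos_eq (y - x)) by lra. apply K; lra.
  - rewrite (Rabs_pos_eq (x - y)) by lra. apply K; lra.
Qed.

Lemma AC_holder_deriv f F a b C : AC f F a b -> 0 <= C ->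
  (forall x y, a <= x <= b -> a <= y <= b -> Rabs (f x - f y) <= C * sqrt (Rabs (x - y))) ->
  forall x, a <= x <= b -> deriv_within F a b x (f x).
Proof.
  intros HF HC Hh x Hx eps He.
  set (r := eps / (C + 1)). assert (Hr : 0 < r) by (apply Rdiv_lt_0_compat; lra).
  (* The square turns |y - x| < r^2 into sqrt|y - x| < r, and [C * r] is below eps by the choice of
     [r]. *)
  exists (r ^ 2). split; [apply pow_lt; auto|]. intros y Hy [Hy0 Hyr].
  assert (Hs : sqrt (Rabs (y - x)) < r).
  { rewrite <- (sqrt_pow2 r) by lra. apply sqrt_lt_1; auto; [lra|]. apply pow2_ge_0. }
  set (e := C * sqrt (Rabs (y - x))).
  assert (He' : e < eps).
  { unfold e. apply Rle_lt_trans with (C * r); [apply Rmult_le_compat_l; lra|].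
    unfold r. apply Rmult_lt_reg_r with (C + 1); [lra|].
    replace (C * (eps / (C + 1)) * (C + 1)) with (C * eps) by (field; lra). nra. }
  assert (Hy' : y - x <> 0) by (intro E; rewrite E, Rabs_R0 in Hy0; lra).
  assert (K : Rabs (F y - F x - f x * (y - x)) <= e * Rabs (y - x)).
  { set (p := Rmin x y). set (q := Rmax x y).
    assert (Hpq : a <= p /\ p <= q /\ q <= b).
    { unfold p, q, Rmin, Rmax; repeat destruct Rle_dec; lra. }
    assert (D : prim (fun z => f z - f x) (fun z => F z - f x * z) p q).
    { apply (prim_minus f F (fun _ => f x) (fun z => f x * z)).
      - apply (prim_sub f F a b); try lra. apply HF.
      - apply prim_derive. intros; auto_derive; [auto|ring]. }
    assert (U : prim (fun _ => e) (fun z => e * z) p q).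
    { apply prim_derive. intros; auto_derive; [auto|ring]. }
    assert (Q := prim_abs_le_sub _ _ _ _ p q x y D U).
    replace (F y - F x - f x * (y - x)) with (F y - f x * y - (F x - f x * x)) by ring.
    assert (e0 : 0 <= e) by (apply Rmult_le_pos; [auto|apply sqrt_pos]).
    rewrite <- Rmult_minus_distr_l, Rabs_mult, (Rabs_pos_eq e) in Q by auto.
    apply Q; [|unfold p, q, Rmin, Rmax; repeat destruct Rle_dec; lra
              |unfold p, q, Rmin, Rmax; repeat destruct Rle_dec; lra].
    intros z Hz. apply Rle_trans with (C * sqrt (Rabs (z - x))).
    - apply Hh; lra.
    - apply Rmult_le_compat_l; auto. apply sqrt_le_1_alt.
      revert Hz; unfold p, q, Rmin, Rmax; repeat destruct Rle_dec; intros; split_Rabs; lra. }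
  replace ((F y - F x) / (y - x) - f x) with ((F y - F x - f x * (y - x)) * / (y - x)) by (field; auto).
  rewrite Rabs_mult, Rabs_inv. apply Rle_lt_trans with (2 := He').
  apply Rmult_le_reg_r with (Rabs (y - x)); auto.
  rewrite Rmult_assoc, Rinv_l, Rmult_1_r by lra. exact K.
Qed.

Lemma sin_lipschitz x y : Rabs (sin x - sin y) <= Rabs (x - y).
Proof.
  assert (K : forall x y, x < y -> Rabs (sin y - sin x) <= y - x).
  { intros u v Huv. destruct (MVT_cor2 sin cos u v Huv) as (c & E & _).
    - intros; apply derivable_pt_lim_sin.
    - rewrite E, Rabs_mult, (Rabs_pos_eq (v - u)) by lra.
      assert (B : Rabs (cos c) <= 1) by (apply Rabs_le, COS_bound).
      rewrite <- (Rmult_1_l (v - u)) at 2. apply Rmult_le_compat_r; lra. }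
  destruct (Rtotal_order x y) as [H|[->|H]].
  - specialize (K x y H). split_Rabs; lra.
  - rewrite !Rminus_diag. lra.
  - specialize (K y x H). split_Rabs; lra.
Qed.

(** On [delta, PI/2] the factor 1/sin is bounded and Lipschitz. Its Lipschitz term is weakened to
    exponent 1/2 by writing |x - y| = w * w <= 2 w, valid since PI/2 <= 4. *)
Lemma quotient_sin_holder F M delta : 0 <= M -> 0 < delta < PI / 2 -> cont_on F 0 (PI / 2) ->
  (forall x y, 0 <= x <= PI / 2 -> 0 <= y <= PI / 2 -> Rabs (F x - F y) <= M * sqrt (Rabs (x - y))) ->
  exists C, 0 <= C /\ forall x y, delta <= x <= PI / 2 -> delta <= y <= PI / 2 ->
    Rabs (F x / sin x - F y / sin y) <= C * sqrt (Rabs (x - y)).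
Proof.
  intros HM Hd HC HF. assert (HP := PI_RGT_0). assert (HP4 := PI_4).
  destruct (cont_on_bounded F 0 (PI / 2) PI2_ge0 HC) as (B & B0 & HB).
  set (s := sin delta). assert (s0 : 0 < s) by (apply sin_gt_0; lra).
  assert (Hs : forall x, delta <= x <= PI / 2 -> s <= sin x) by (intros; apply sin_incr_1; lra).
  assert (is0 : 0 < / s) by (apply Rinv_0_lt_compat; auto).
  exists (M * / s + B * (/ s * / s) * 2). split.
  { apply Rplus_le_le_0_compat; [apply Rmult_le_pos; lra|].
    repeat apply Rmult_le_pos; lra. }
  intros x y Hx Hy. assert (X := Hs x Hx). assert (Y := Hs y Hy).
  set (w := sqrt (Rabs (x - y))).
  assert (Hw : 0 <= w) by apply sqrt_pos.
  assert (Hw2 : Rabs (x - y) = w * w) by (symmetry; apply sqrt_sqrt, Rabs_pos).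
  assert (Hwb : w <= 2).
  { unfold w. rewrite <- (sqrt_pow2 2) by lra. apply sqrt_le_1_alt. split_Rabs; lra. }
  replace (F x / sin x - F y / sin y) with
    ((F x - F y) * / sin x + F y * (/ sin x * / sin y) * (sin y - sin x)) by (field; lra).
  assert (IX : 0 < / sin x <= / s) by (split; [apply Rinv_0_lt_compat|apply Rinv_le_contravar]; lra).
  assert (IY : 0 < / sin y <= / s) by (split; [apply Rinv_0_lt_compat|apply Rinv_le_contravar]; lra).
  eapply Rle_trans; [apply Rabs_triang|]. rewrite !Rabs_mult, (Rabs_pos_eq (/ sin x)), (Rabs_pos_eq (/ sin y)) by lra.
  assert (A1 : Rabs (F x - F y) * / sin x <= M * w * / s).
  { apply Rmult_le_compat; try lra; [apply Rabs_pos|]. apply HF; lra. }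
  assert (A2 : Rabs (F y) * (/ sin x * / sin y) * Rabs (sin y - sin x) <= B * (/ s * / s) * (w * w)).
  { assert (Z := sin_lipschitz y x). rewrite (Rabs_minus_sym y x), Hw2 in Z.
    apply Rmult_le_compat; auto; try apply Rabs_pos.
    - repeat apply Rmult_le_pos; try lra. apply Rabs_pos.
    - apply Rmult_le_compat; try apply Rabs_pos; [apply Rmult_le_pos; lra|apply HB; lra|].
      apply Rmult_le_compat; lra. }
  assert (A3 : B * (/ s * / s) * (w * w) <= B * (/ s * / s) * (2 * w)).
  { apply Rmult_le_compat_l; [|nra]. repeat apply Rmult_le_pos; lra. }
  lra.
Qed.

Lemma L2norm_le f a b C : 0 <= C -> integral (fun x => f x ^ 2) a b <= C ^ 2 -> L2norm f a b <= C.
Proof.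
  intros HC H. unfold L2norm. rewrite <- (sqrt_pow2 C) by auto. now apply sqrt_le_1_alt.
Qed.

(** * The conjugate function *)

Lemma dominated_series (u : nat -> R -> R) (w : nat -> R) B :
  (forall n x, Rabs (u n x) <= w n) -> (forall N, sum_f_R0 w N <= B) ->
  exists Q : R -> R, (forall x, is_lim_seq (fun N => sum_f_R0 (fun n => u n x) N) (Q x)) /\
    forall eps, 0 < eps -> exists N, forall n x, (N <= n)%nat ->
      Rabs (Q x - sum_f_R0 (fun n => u n x) n) <= eps.
Proof.
  intros Huw HB.
  assert (w0 : forall n, 0 <= w n).
  { intro n. eapply Rle_trans; [apply Rabs_pos|apply (Huw n 0)]. }
  assert (HQ : forall x, ex_finite_lim_seq (fun N => sum_f_R0 (fun n => u n x) N)).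
  { intro x. apply bounded_variation_lim with B. intro n.
    apply Rle_trans with (sum_f_R0 (fun k => w (S k)) n).
    - apply sum_Rle. intros k _. rewrite tech5.
      replace (_ + u (S k) x - _) with (u (S k) x) by ring. apply Huw.
    - apply Rle_trans with (2 := HB (S n)). rewrite (decomp_sum w (S n)) by lia.
      simpl pred. assert (A := w0 0%nat). lra. }
  exists (fun x => real (Lim_seq (fun N => sum_f_R0 (fun n => u n x) N))).
  assert (HL : forall x, is_lim_seq (fun N => sum_f_R0 (fun n => u n x) N)
    (real (Lim_seq (fun N => sum_f_R0 (fun n => u n x) N)))) by (intro; now apply Lim_seq_correct').
  split; [exact HL|]. intros eps He.
  assert (HW : ex_finite_lim_seq (sum_f_R0 w)).
  { apply ex_finite_lim_seq_incr with B; auto. intro n. rewrite tech5.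
    specialize (w0 (S n)). lra. }
  apply ex_lim_seq_cauchy_corr in HW. destruct (HW (mkposreal eps He)) as [N HN].
  exists N. intros n x Hn.
  assert (K : forall m, Rabs (sum_f_R0 (fun n => u n x) (m + n) - sum_f_R0 (fun n => u n x) n)
    <= sum_f_R0 w (m + n) - sum_f_R0 w n).
  { induction m as [|m IH]; [simpl; rewrite !Rminus_diag, Rabs_R0; lra|].
    replace (S m + n)%nat with (S (m + n)) by lia. rewrite !tech5.
    set (p := sum_f_R0 (fun n => u n x) (m + n)) in *. set (q := sum_f_R0 (fun n => u n x) n) in *.
    replace (p + u (S (m + n)) x - q) with ((p - q) + u (S (m + n)) x) by ring.
    eapply Rle_trans; [apply Rabs_triang|]. specialize (Huw (S (m + n)) x). lra. }
  assert (L : is_lim_seq (fun m => Rabs (sum_f_R0 (fun n => u n x) (m + n) - sum_f_R0 (fun n => u n x) n))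
    (Rabs (real (Lim_seq (fun N => sum_f_R0 (fun n => u n x) N)) - sum_f_R0 (fun n => u n x) n))).
  { apply (is_lim_seq_abs _ (Finite _)). apply is_lim_seq_minus'; [|apply is_lim_seq_const].
    apply (is_lim_seq_incr_n (fun N => sum_f_R0 (fun n => u n x) N)), HL. }
  apply (fun H => is_lim_seq_le _ (fun _ => eps) _ (Finite eps) H L (is_lim_seq_const eps)).
  intro m. apply Rle_trans with (1 := K m).
  specialize (HN (m + n)%nat n ltac:(lia) Hn). unfold pos in HN.
  apply Rle_trans with (1 := Rle_abs _). lra.
Qed.

Lemma sine_coef_0 f : sine_coef f 0 = 0.
Proof.
  unfold sine_coef. rewrite <- (integral_ext 0 (PI / 2) PI2_ge0 (fun _ => 0)).
  - rewrite integral_const by apply PI2_ge0. unfold Rdiv. ring.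
  - intros x _. now rewrite Rmult_0_l, sin_0, Rmult_0_r.
  - apply Lone_const, PI2_ge0.
Qed.

(** Riemann-Lebesgue, obtained from Bessel's inequality. It removes the boundary term of the Abel
    summation. *)
Lemma sine_coef_lim_0 f : L2f f 0 (PI / 2) ->
  is_lim_seq (fun n => sine_coef f (even_freq n)) 0.
Proof.
  intros Hf. assert (H := fun N => sine_bessel f even_freq N Hf even_freq_parity).
  assert (HS : ex_series (fun n => sine_coef f (even_freq n) ^ 2)).
  { destruct (ex_finite_lim_seq_incr (sum_n (fun n => sine_coef f (even_freq n) ^ 2))
      (integral (fun x => f x ^ 2) 0 (PI / 2) / (PI / 4))) as [l Hl].
    - intro n. rewrite sum_Sn. change (plus ?x ?y) with (x + y).
      assert (Z := pow2_ge_0 (sine_coef f (even_freq (S n)))). lra.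
    - intro n. rewrite sum_n_Reals. apply H.
    - now exists l. }
  apply ex_series_lim_0 in HS. apply is_lim_seq_spec in HS. apply is_lim_seq_spec.
  intro e. assert (He := cond_pos e).
  destruct (HS (mkposreal (e ^ 2) (pow_lt e 2 He))) as [N HN]. exists N. intros n Hn.
  specialize (HN n Hn). simpl pos in HN. rewrite Rminus_0_r in *.
  rewrite Rabs_pos_eq in HN by apply pow2_ge_0.
  apply Rnot_le_lt. intro Hle. rewrite <- (pow2_abs (sine_coef f (even_freq n))) in HN.
  assert (e ^ 2 <= Rabs (sine_coef f (even_freq n)) ^ 2) by (apply pow_incr; lra). lra.
Qed.

Lemma L2f_mult_sin f p : L2f f 0 (PI / 2) -> Lone (fun x => f x * sin (p * x)) 0 (PI / 2).
Proof. intro; apply L2f_mult; auto using PI2_ge0, L2f_sin. Qed.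

(* Multiplying by [sin] shifts even frequencies to odd ones; an integration by
   parts then expresses the sine coefficients of [h = F'] through those of [zeta]. *)
Lemma sine_coef_shift zeta F h n : L2f zeta 0 (PI / 2) -> L2f h 0 (PI / 2) ->
  AC h F 0 (PI / 2) -> F (PI / 2) = 0 ->
  (forall x, 0 <= x <= PI / 2 -> F x = zeta x / 3 * sin x) ->
  sine_coef h (odd_freq n) / odd_freq n =
  - (sine_coef zeta (even_freq n) - sine_coef zeta (2 * INR n)) / 6.
Proof.
  intros Hz Hh HF HF0 HFz. assert (HP := PI_RGT_0). assert (P2 := PI2_ge0).
  set (p := odd_freq n). assert (Hp : p <> 0) by apply (same_parity_neq0 _ odd_freq_parity).
  assert (HS : AC (fun x => p * cos (p * x)) (fun x => sin (p * x)) 0 (PI / 2)).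
  { apply AC_derive; auto.
    - intros x _. auto_derive; auto; ring.
    - intros x _. apply (ex_derive_continuous (fun x => p * cos (p * x))). auto_derive; auto. }
  assert (HM := AC_increment _ _ _ _ P2 (AC_mult _ _ _ _ _ _ P2 HF HS)).
  (* Both boundary terms vanish: at PI/2 because [F] does, at 0 because of the sine. *)
  cbv beta in HM. rewrite HF0, Rmult_0_r, sin_0, Rmult_0_r, Rmult_0_l in HM.
  assert (L1 : Lone (fun x => h x * sin (p * x)) 0 (PI / 2)) by now apply L2f_mult_sin.
  set (g := fun x => p / 6 * (zeta x * sin (even_freq n * x) - zeta x * sin (2 * INR n * x))).
  assert (Lg' : Lone (fun x => zeta x * sin (even_freq n * x) - zeta x * sin (2 * INR n * x)) 0 (PI / 2))
    by (apply Lone_minus; auto; now apply L2f_mult_sin).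
  assert (Lg : Lone g 0 (PI / 2)) by now apply Lone_scal.
  assert (Eg : forall x, 0 <= x <= PI / 2 -> g x = F x * (p * cos (p * x))).
  { intros x Hx. rewrite HFz by auto. unfold g, p, even_freq, odd_freq.
    replace (2 * INR (S n) * x) with ((2 * INR n + 1) * x + x) by (rewrite S_INR; ring).
    replace (2 * INR n * x) with ((2 * INR n + 1) * x - x) by ring.
    rewrite sin_plus, sin_minus. field. }
  rewrite (integral_plus 0 (PI / 2) P2 _ _ L1 (Lone_ext _ _ _ _ Eg Lg)) in HM.
  rewrite <- (integral_ext 0 (PI / 2) P2 _ _ Eg Lg) in HM. unfold g in HM.
  rewrite integral_scal, integral_minus in HM by (auto; now apply L2f_mult_sin).
  unfold sine_coef.
  set (I1 := integral (fun x => zeta x * sin (even_freq n * x)) 0 (PI / 2)) in *.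
  set (I2 := integral (fun x => zeta x * sin (2 * INR n * x)) 0 (PI / 2)) in *.
  replace (integral (fun x => h x * sin (p * x)) 0 (PI / 2)) with (- (p / 6 * (I1 - I2))) by lra.
  field. split; lra.
Qed.

Lemma abel_summation (beta s : nat -> R) N : beta 0%nat = 0 ->
  sum_f_R0 (fun n => beta (S n) * (s (S n) - s n)) N =
  beta (S N) * s (S N) - sum_f_R0 (fun n => (beta (S n) - beta n) * s n) N.
Proof. intros H0. induction N as [|N IH]; simpl in *; [rewrite H0|rewrite IH]; ring. Qed.

(** The differentiated partial sums of [theta], multiplied by sin, equal the partial sums of [Q]
    plus a boundary term tending to 0. The series of [Q] converges uniformly, and on [delta, PI/2]
    division by sin is harmless; hence uniform convergence of the derivatives to [Q s / sin s]. *)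
Lemma conjugate_regular zeta F h : L2f zeta 0 (PI / 2) -> L2f h 0 (PI / 2) ->
  AC h F 0 (PI / 2) -> F (PI / 2) = 0 ->
  (forall x, 0 <= x <= PI / 2 -> F x = zeta x / 3 * sin x) ->
  exists Q g, L2f g 0 (PI / 2) /\ AC g Q 0 (PI / 2) /\ Q 0 = 0 /\
    integral (fun x => g x ^ 2) 0 (PI / 2) <= integral (fun x => h x ^ 2) 0 (PI / 2) /\
    forall delta, 0 < delta < PI / 2 ->
      AC (fun s => Q s / sin s) (fun s => / 3 * Hop zeta s) delta (PI / 2).
Proof.
  intros Hz Hh HF HF0 HFz. assert (HP := PI_RGT_0). assert (P2 := PI2_ge0).
  set (c := fun n => sine_coef h (odd_freq n)).
  set (beta := fun n => sine_coef zeta (2 * INR n)).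
  assert (Hc : forall n, c n / odd_freq n = - (beta (S n) - beta n) / 6).
  { intro n. now apply (sine_coef_shift zeta F h n). }
  assert (Hmu : forall n, INR (S n) <= odd_freq n /\ 0 < INR (S n)).
  { intro n. unfold odd_freq. rewrite S_INR. assert (A := pos_INR n). lra. }
  (* The majorant comes from |c n| / (n + 1) <= (c n ^ 2 + 1 / (n + 1)^2) / 2, summable by Bessel's
     inequality and the bound 2 on the sum of inverse squares. *)
  destruct (dominated_series (fun n x => c n * (sin (odd_freq n * x) / odd_freq n))
    (fun n => (c n ^ 2 + (/ INR (S n)) ^ 2) * / 2)
    ((integral (fun x => h x ^ 2) 0 (PI / 2) / (PI / 4) + 2) * / 2)) as (Q & HQ & HQu).
  { intros n x. destruct (Hmu n) as [M1 M2].
    unfold Rdiv. rewrite !Rabs_mult, Rabs_inv, (Rabs_pos_eq (odd_freq n)) by lra.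
    assert (B : Rabs (sin (odd_freq n * x)) <= 1) by (apply Rabs_le, SIN_bound).
    assert (I1 : / odd_freq n <= / INR (S n)) by (apply Rinv_le_contravar; lra).
    assert (I0 : 0 < / odd_freq n) by (apply Rinv_0_lt_compat; lra).
    assert (A := Rabs_pos (c n)). assert (A' := Rabs_pos (sin (odd_freq n * x))).
    apply Rle_trans with (Rabs (c n) * / INR (S n)).
    - apply Rmult_le_compat_l; auto. nra.
    - rewrite <- (pow2_abs (c n)).
      assert (Z := pow2_ge_0 (Rabs (c n) - / INR (S n))). nra. }
  { intro N. rewrite <- scal_sum, sum_plus, Rmult_comm.
    apply Rmult_le_compat_r; [lra|]. apply Rplus_le_compat.
    - apply sine_bessel; auto. apply odd_freq_parity.
    - assert (A := sum_inv_sq_le N).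
      assert (0 < / INR (S N)) by (apply Rinv_0_lt_compat, lt_0_INR; lia). lra. }
  destruct (conjugate_AC h odd_freq Q Hh odd_freq_parity (fun x _ => HQ x)) as (g & Hg & HgQ & HgB).
  exists Q, g. split; [auto|]. split; [auto|]. split.
  { assert (A := is_lim_seq_unique _ _ (HQ 0)).
    rewrite (Lim_seq_ext _ (fun _ => 0)) in A.
    - rewrite Lim_seq_const in A. injection A; auto.
    - intro N. apply sum_eq_R0. intros n _. rewrite Rmult_0_r, sin_0. unfold Rdiv; ring. }
  split; [auto|]. intros delta Hd.
  set (s0 := sin delta). assert (s00 : 0 < s0) by (apply sin_gt_0; lra).
  assert (Hs : forall x, delta <= x <= PI / 2 -> s0 <= sin x) by (intros; apply sin_incr_1; lra).
  apply (AC_uniform_limit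
    (fun N x => / 3 * sum_f_R0 (fun n => sine_coef zeta (even_freq n) * cos (even_freq n * x)) N)
    (fun N x => / 3 * sum_f_R0 (fun n => sine_coef zeta (even_freq n) * (sin (even_freq n * x) / even_freq n)) N)).
  - lra.
  - apply Lone_ext with (fun x => / sin x * Q x); [intros; unfold Rdiv; ring|].
    apply Lone_cont_mult; [lra| |].
    + apply cont_on_continuous. intros x Hx. specialize (Hs x Hx).
      apply (ex_derive_continuous (fun x => / sin x)). auto_derive. lra.
    + apply (Lone_sub Q 0 (PI / 2)); try lra. apply Lone_cont; auto. now apply AC_cont with g.
  - intro N. apply (AC_sub _ _ 0 (PI / 2)); try lra. apply AC_scal; auto.
    induction N as [|N IH].
    + apply (AC_scal (sine_coef zeta (even_freq 0))); auto.
      apply AC_cos, (same_parity_neq0 _ even_freq_parity).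
    + apply (AC_plus _ _ (fun x => sine_coef zeta (even_freq (S N)) * cos (even_freq (S N) * x))
        (fun x => sine_coef zeta (even_freq (S N)) * (sin (even_freq (S N) * x) / even_freq (S N)))); auto.
      apply AC_scal; auto. apply AC_cos, (same_parity_neq0 _ even_freq_parity).
  - intros eps He.
    (* One half for the tail of [Q], one for the boundary term; the factor [s0], a lower bound of
       sin on [delta, PI/2], is spent when dividing by [sin x]. *)
    assert (He1 : 0 < eps * s0 / 2) by (apply Rdiv_lt_0_compat; [apply Rmult_lt_0_compat; auto|lra]).
    destruct (HQu _ He1) as [N1 H1].
    assert (H2 := sine_coef_lim_0 zeta Hz). apply is_lim_seq_spec in H2.
    destruct (H2 (mkposreal _ He1)) as [N2 H2']. simpl pos in H2'.
    exists (N1 + N2)%nat. intros n x Hn Hx. assert (Hsx := Hs x Hx).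
    specialize (H1 n x ltac:(lia)). specialize (H2' n ltac:(lia)). rewrite Rminus_0_r in H2'.
    (* The product 2 cos(2m x) sin x = sin((2m+1) x) - sin((2m-1) x) produces differences of odd
       sines; Abel summation moves the difference onto [beta], where [Hc] recognises the
       coefficients of [h]. *)
    assert (E : / 3 * sum_f_R0 (fun n => sine_coef zeta (even_freq n) * cos (even_freq n * x)) n * sin x =
      beta (S n) * sin (odd_freq (S n) * x) / 6
      + sum_f_R0 (fun n => c n * (sin (odd_freq n * x) / odd_freq n)) n).
    { assert (A := abel_summation beta (fun n => sin (odd_freq n * x)) n).
      assert (T1 : sum_f_R0 (fun n => sine_coef zeta (even_freq n) * cos (even_freq n * x)) n * sin x * 2 =
        sum_f_R0 (fun n => beta (S n) * (sin (odd_freq (S n) * x) - sin (odd_freq n * x))) n).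
      { rewrite Rmult_assoc, Rmult_comm, scal_sum. apply sum_eq. intros i _.
        change (sine_coef zeta (even_freq i)) with (beta (S i)). unfold even_freq, odd_freq.
        replace ((2 * INR (S i) + 1) * x) with (2 * INR (S i) * x + x) by ring.
        replace ((2 * INR i + 1) * x) with (2 * INR (S i) * x - x) by (rewrite S_INR; ring).
        rewrite sin_plus, sin_minus. ring. }
      assert (T2 : sum_f_R0 (fun n => c n * (sin (odd_freq n * x) / odd_freq n)) n =
        - / 6 * sum_f_R0 (fun n => (beta (S n) - beta n) * sin (odd_freq n * x)) n).
      { rewrite scal_sum. apply sum_eq. intros i _. destruct (Hmu i) as [M1 M2].
        replace (c i * (sin (odd_freq i * x) / odd_freq i)) with
          (c i / odd_freq i * sin (odd_freq i * x)) by (field; lra).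
        rewrite Hc. field. }
      assert (B0 : beta 0%nat = 0).
      { unfold beta. simpl INR. rewrite Rmult_0_r. apply sine_coef_0. }
      specialize (A B0). lra. }
    set (fn := / 3 * sum_f_R0 (fun n => sine_coef zeta (even_freq n) * cos (even_freq n * x)) n) in *.
    set (Qn := sum_f_R0 (fun n => c n * (sin (odd_freq n * x) / odd_freq n)) n) in *.
    assert (B : Rabs (beta (S n) * sin (odd_freq (S n) * x) / 6) <= eps * s0 / 2).
    { change (beta (S n)) with (sine_coef zeta (even_freq n)).
      unfold Rdiv. rewrite !Rabs_mult, (Rabs_pos_eq (/ 6)) by lra.
      assert (Z : Rabs (sin (odd_freq (S n) * x)) <= 1) by (apply Rabs_le, SIN_bound).
      assert (Z0 := Rabs_pos (sin (odd_freq (S n) * x))).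
      assert (Y0 := Rabs_pos (sine_coef zeta (even_freq n))). nra. }
    assert (D : Rabs ((Q x / sin x - fn) * sin x) <= eps * s0).
    { replace ((Q x / sin x - fn) * sin x) with (Q x - fn * sin x) by (field; lra).
      rewrite E. clear - H1 B. split_Rabs; lra. }
    rewrite Rabs_mult, (Rabs_pos_eq (sin x)) in D by lra.
    apply Rmult_le_reg_r with (sin x); [lra|]. apply Rle_trans with (1 := D).
    apply Rmult_le_compat_l; lra.
  - intros x Hx. apply (is_lim_seq_scal_l _ (/ 3) (Finite (Hop zeta x))).
    apply Hop_series; auto; lra.
Qed.

(** * The fixed point equation and the final estimates *)

Lemma integral_point f a : integral f a a = 0.
Proof.
  apply integral_eq. split; [lra|]. intros eps He. exists (fun _ => 1). split; [intro; lra|].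
  intros [|[t x] q] Hp; simpl in *.
  - rewrite Rminus_diag, Rabs_R0; auto.
  - destruct Hp as (H1 & _ & _ & _ & H5). apply fine_part_le in H5. lra.
Qed.

(** The sign of [zeta] is given only on the half-open interval; changing the value at 0 leaves the
    primitive unchanged. *)
Lemma integral_ge0_off_0 f b : 0 <= b -> Lone f 0 b -> (forall s, 0 < s <= b -> 0 <= f s) ->
  forall x, 0 <= x <= b -> 0 <= integral f 0 x.
Proof.
  intros Hb Hf H0 x Hx.
  assert (HI : incr (integral f 0) 0 b).
  { apply (prim_ge0_incr (fun s => if Req_dec_T s 0 then 0 else f s)).
    - apply (prim_ext_point f _ _ 0); auto; [|now apply Lone_prim].
      intros s Hs Hn. destruct Req_dec_T; tauto.
    - intros s Hs. destruct Req_dec_T; [lra|]. apply H0; lra. }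
  assert (A := HI 0 x ltac:(lra) ltac:(lra) ltac:(lra)). now rewrite integral_point in A.
Qed.

Lemma Hop_0 zeta : L2f zeta 0 (PI / 2) -> Hop zeta 0 = 0.
Proof.
  intros Hz. assert (P2 := PI2_ge0).
  assert (A := is_lim_seq_unique _ _ (Hop_series zeta 0 Hz ltac:(lra))).
  rewrite (Lim_seq_ext _ (fun _ => 0)) in A.
  - rewrite Lim_seq_const in A. injection A; auto.
  - intro N. apply sum_eq_R0. intros n _. rewrite Rmult_0_r, sin_0. unfold Rdiv; ring.
Qed.

(** Of the four terms of the product rule, the two without [v] and [z] merge by the addition formula
    into the single cosine of 2s + theta. This gives one term bounded by 1, where estimating them
    separately would give 2. *)
Lemma AC_profile v theta z Z a b : a <= b -> AC v theta a b -> AC z Z a b ->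
  AC (fun s => exp (- Z s) * (cos (s + theta s + s) + cos (s + theta s) * (cos s * v s)
               - sin (s + theta s) * (cos s * z s)))
     (fun s => sin (s + theta s) * cos s * exp (- Z s)) a b.
Proof.
  intros Hab Hv Hz.
  assert (H1 : AC (fun _ => 1) (fun s => s) a b).
  { apply AC_derive; auto; intros; [auto_derive; auto|apply continuous_const]. }
  assert (Hc : AC (fun s => - sin s) cos a b).
  { apply AC_derive; auto; intros x _.
    - auto_derive; auto; ring.
    - apply (ex_derive_continuous (fun x => - sin x)). auto_derive; auto. }
  assert (HA := AC_plus _ _ _ _ _ _ Hab H1 Hv).
  apply (AC_comp sin cos) in HA; auto.
  2:{ intro x; auto_derive; auto; ring. }
  2:{ intro x. apply (ex_derive_continuous cos). auto_derive; auto. }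
  apply (AC_comp (fun x => exp (- x)) (fun x => - exp (- x))) in Hz; auto.
  2:{ intro x; auto_derive; auto; ring. }
  2:{ intro x. apply (ex_derive_continuous (fun x => - exp (- x))). auto_derive; auto. }
  generalize (AC_mult _ _ _ _ _ _ Hab (AC_mult _ _ _ _ _ _ Hab HA Hc) Hz).
  apply AC_ext; intros x _; [|auto]. rewrite (cos_plus (x + theta x) x). ring.
Qed.

Lemma L2f_profile v theta z Z a b : a <= b -> L2f v a b -> L2f z a b ->
  cont_on theta a b -> cont_on Z a b ->
  L2f (fun s => exp (- Z s) * (cos (s + theta s + s) + cos (s + theta s) * (cos s * v s)
               - sin (s + theta s) * (cos s * z s))) a b.
Proof.
  intros Hab Hv Hz Ht HZ.
  assert (Cs : cont_on (fun s => s) a b) by (apply cont_on_continuous; intros; apply continuous_id).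
  assert (Cadd : forall f g, cont_on f a b -> cont_on g a b -> cont_on (fun x => f x + g x) a b).
  { intros f g Hf Hg x Hx eps He.
    destruct (Hf x Hx (eps / 2) ltac:(lra)) as (e1 & P1 & Q1).
    destruct (Hg x Hx (eps / 2) ltac:(lra)) as (e2 & P2 & Q2).
    exists (Rmin e1 e2). split; [now apply Rmin_pos|]. intros y Hy Hyx.
    specialize (Q1 y Hy (Rlt_le_trans _ _ _ Hyx (Rmin_l _ _))).
    specialize (Q2 y Hy (Rlt_le_trans _ _ _ Hyx (Rmin_r _ _))).
    split_Rabs; lra. }
  assert (Csin : forall x, continuous sin x)
    by (intro x; apply (ex_derive_continuous sin); auto_derive; auto).
  assert (Ccos : forall x, continuous cos x)
    by (intro x; apply (ex_derive_continuous cos); auto_derive; auto).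
  assert (CA := Cadd _ _ Cs Ht).
  apply L2f_cont_mult; auto.
  { apply (cont_on_comp (fun x => exp (- x))); auto.
    intro x. apply (ex_derive_continuous (fun x => exp (- x))). auto_derive; auto. }
  apply L2f_minus; auto; [apply L2f_plus; auto|].
  - apply L2f_cont; auto. apply (cont_on_comp cos); auto.
  - apply L2f_cont_mult; auto; [now apply (cont_on_comp cos)|].
    apply L2f_cont_mult; auto. now apply cont_on_continuous.
  - apply L2f_cont_mult; auto; [now apply (cont_on_comp sin)|].
    apply L2f_cont_mult; auto. now apply cont_on_continuous.
Qed.

(* Cauchy-Schwarz with the weights 1 + 3/2 + 9/2 = 7. *)
Lemma profile_sq_le E p q r x y : 0 <= E <= 1 -> -1 <= p <= 1 -> -1 <= q <= 1 -> -1 <= r <= 1 ->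
  (E * (p + q * x - r * y)) ^ 2 <= 7 * (1 + 2 / 3 * x ^ 2 + 2 / 9 * y ^ 2).
Proof.
  intros HE Hp Hq Hr.
  assert (A : (p + q * x - r * y) ^ 2 <= 7 * (p ^ 2 + 2 / 3 * (q * x) ^ 2 + 2 / 9 * (r * y) ^ 2)).
  { set (u := q * x). set (w := r * y).
    (* An exact sum of squares: right side minus left side is one sixth, one eighteenth and one
       third of the squares in [Z1], [Z2] and [Z3]. *)
    assert (Z1 := pow2_ge_0 (3 * p - 2 * u)). assert (Z2 := pow2_ge_0 (9 * p + 2 * w)).
    assert (Z3 := pow2_ge_0 (3 * u + w)). nra. }
  assert (Bp : p ^ 2 <= 1) by nra. assert (Bq : q ^ 2 <= 1) by nra. assert (Br : r ^ 2 <= 1) by nra.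
  assert (BE : 0 <= E ^ 2 <= 1) by nra.
  assert (X := pow2_ge_0 x). assert (Y := pow2_ge_0 y).
  assert (Cx : (q * x) ^ 2 <= x ^ 2) by (rewrite Rpow_mult_distr; nra).
  assert (Cy : (r * y) ^ 2 <= y ^ 2) by (rewrite Rpow_mult_distr; nra).
  rewrite Rpow_mult_distr. assert (W := pow2_ge_0 (p + q * x - r * y)).
  apply Rle_trans with ((p + q * x - r * y) ^ 2); nra.
Qed.

Theorem theorem4p3 (alpha : R) (zeta : R -> R) :
  2 / PI * (1 + 1 / (3 * sqrt PI)) <= alpha ->
  L2 zeta 0 (PI / 2) ->
  (forall s, 0 < s <= PI / 2 -> 0 <= zeta s) ->
  (forall s, 0 < s <= PI / 2 -> zeta s = Phi alpha zeta s) ->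
  L2norm zeta 0 (PI / 2) <= 9 * sqrt PI / 2 ->
  let theta := fun s => / 3 * Hop zeta s in
  let tau := fun s => ln (PI / 2) + / 3 * integral zeta 0 s in
  ((exists h, L2 h 0 (PI / 2) /\
      weak_deriv (fun s => zeta s / 3 * sin s) h 0 (PI / 2) /\
      L2norm h 0 (PI / 2) <= 7 / (alpha * sqrt PI)) /\
   left_deriv tau (PI / 2) 0 /\
   (forall delta, 0 < delta < PI / 2 -> C11half tau delta (PI / 2))) /\
  ((exists dtheta h, weak_deriv theta dtheta 0 (PI / 2) /\
      L2 h 0 (PI / 2) /\
      weak_deriv (fun s => dtheta s * sin s) h 0 (PI / 2) /\
      L2norm h 0 (PI / 2) <= 7 / (alpha * sqrt PI)) /\
   (forall delta, 0 < delta < PI / 2 -> C11half theta delta (PI / 2))).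
Proof.
  intros Halpha HL2 Hpos Hfix Hnorm theta tau.
  assert (HP := PI_RGT_0). assert (P2 := PI2_ge0).
  assert (HsP : 0 < sqrt PI) by now apply sqrt_lt_R0.
  assert (Ha : 0 < alpha).
  { apply Rlt_le_trans with (2 := Halpha). apply Rmult_lt_0_compat.
    - apply Rdiv_lt_0_compat; lra.
    - assert (0 < 1 / (3 * sqrt PI)) by (apply Rdiv_lt_0_compat; lra). lra. }
  assert (Hz := L2_L2f _ _ _ HL2).
  assert (Hz2 : integral (fun x => zeta x ^ 2) 0 (PI / 2) <= 81 * PI / 4).
  { unfold L2norm in Hnorm. assert (I0 := integral_sq_ge0 _ _ P2 _ Hz).
    rewrite <- (sqrt_sqrt _ I0). assert (S0 := sqrt_pos (integral (fun x => zeta x ^ 2) 0 (PI / 2))).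
    replace (81 * PI / 4) with ((9 * sqrt PI / 2) * (9 * sqrt PI / 2)).
    - apply Rmult_le_compat; auto.
    - replace (9 * sqrt PI / 2 * (9 * sqrt PI / 2)) with (81 / 4 * (sqrt PI * sqrt PI)) by field.
      rewrite sqrt_sqrt by lra. field. }
  set (Z := integral zeta 0).
  assert (HZ : AC zeta Z 0 (PI / 2)) by (apply AC_integral; auto; apply Hz).
  assert (Z0 : forall x, 0 <= x <= PI / 2 -> 0 <= Z x)
    by (apply integral_ge0_off_0; auto; apply Hz).
  destruct (conjugate_AC zeta even_freq (Hop zeta) Hz even_freq_parity
    (fun x Hx => Hop_series zeta x Hz Hx)) as (V & HV & HVA & HVB).
  set (v := fun x => / 3 * V x).
  assert (Hv : L2f v 0 (PI / 2)) by now apply L2f_scal.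
  assert (Hth : AC v theta 0 (PI / 2)) by now apply AC_scal.
  assert (Hv2 : integral (fun x => v x ^ 2) 0 (PI / 2) <= 9 * PI / 4).
  { rewrite <- (integral_ext 0 (PI / 2) P2 (fun x => / 9 * V x ^ 2)).
    - rewrite integral_scal by (auto; apply HV). lra.
    - intros; unfold v; field.
    - apply Lone_scal; auto; apply HV. }
  (* The prefactor 3/(alpha PI) of [Phi], divided by the 3 in [tau' = zeta / 3]. *)
  set (k := / (alpha * PI)).
  assert (HaP : 0 < alpha * PI) by now apply Rmult_lt_0_compat.
  assert (Hk : 0 < k) by now apply Rinv_0_lt_compat.
  set (h0 := fun s => exp (- Z s) * (cos (s + theta s + s) + cos (s + theta s) * (cos s * v s)
               - sin (s + theta s) * (cos s * zeta s))).
  set (h := fun s => k * h0 s).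
  assert (Hh0 : L2f h0 0 (PI / 2)).
  { apply L2f_profile; auto; [now apply AC_cont with v|now apply AC_cont with zeta]. }
  assert (Hh : L2f h 0 (PI / 2)) by now apply L2f_scal.
  set (F := fun s => zeta s / 3 * sin s).
  assert (HF : AC h F 0 (PI / 2)).
  { generalize (AC_scal k _ _ _ _ P2 (AC_profile _ _ _ _ _ _ P2 Hth HZ)).
    apply AC_ext; [reflexivity|]. intros s Hs. unfold F.
    (* The fixed point equation says nothing at 0. There [F] vanishes through sin and the profile
       through [Hop zeta 0 = 0], so the identity holds on the closed interval. *)
    destruct (Req_dec s 0) as [->|Hn].
    - rewrite sin_0. unfold theta. rewrite Hop_0 by auto. rewrite Rmult_0_r, Rplus_0_r, sin_0. ring.
    - assert (S0 : 0 < sin s) by (apply sin_gt_0; lra).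
      rewrite Hfix by lra. unfold Phi, k. fold (theta s). fold Z.
      rewrite exp_Ropp. assert (E0 := exp_pos (Z s)). field. repeat split; lra. }
  assert (F0 : F (PI / 2) = 0).
  { unfold F. rewrite Hfix by lra. unfold Phi. rewrite cos_PI2. unfold Rdiv. ring. }
  set (M := 7 / (alpha * sqrt PI)).
  assert (HM : 0 <= M) by (apply Rlt_le, Rdiv_lt_0_compat; [lra|now apply Rmult_lt_0_compat]).
  assert (HM2 : M ^ 2 = k ^ 2 * (49 * PI)).
  { unfold M, k. replace ((7 / (alpha * sqrt PI)) ^ 2) with (49 / (alpha ^ 2 * (sqrt PI * sqrt PI)))
      by (field; split; lra). rewrite sqrt_sqrt by lra. field. split; lra. }
  assert (HhB : integral (fun x => h x ^ 2) 0 (PI / 2) <= M ^ 2).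
  { rewrite HM2. rewrite <- (integral_ext 0 (PI / 2) P2 (fun x => k ^ 2 * h0 x ^ 2)).
    2:{ intros; unfold h; ring. }
    2:{ apply Lone_scal; auto; apply Hh0. }
    rewrite integral_scal by (auto; apply Hh0).
    apply Rmult_le_compat_l; [apply pow2_ge_0|].
    assert (L1 := Lone_scal 0 (PI / 2) P2 (2 / 3) _ (proj2 Hv)).
    assert (L2 := Lone_scal 0 (PI / 2) P2 (2 / 9) _ (proj2 Hz)).
    assert (L0 := Lone_const 0 (PI / 2) P2 1). cbv beta in L1, L2.
    assert (L01 := Lone_plus _ _ P2 _ _ L0 L1).
    assert (L012 := Lone_plus _ _ P2 _ _ L01 L2).
    (* The three integrals are at most PI/2, (2/3)(9 PI/4) = 3 PI/2 and (2/9)(81 PI/4) = 9 PI/2;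
       their sum is below 7 PI, which gives 49 PI after multiplication by 7. *)
    apply Rle_trans with (integral (fun x => 7 * (1 + 2 / 3 * v x ^ 2 + 2 / 9 * zeta x ^ 2)) 0 (PI / 2)).
    - apply integral_le; auto; [apply Hh0|now apply Lone_scal|]. intros x Hx.
      unfold h0. rewrite <- !Rmult_assoc.
      assert (C1 := COS_bound (x + theta x)). assert (C2 := COS_bound x).
      assert (C3 := SIN_bound (x + theta x)).
      apply profile_sq_le; [|apply COS_bound|nra|nra].
      split; [apply Rlt_le, exp_pos|]. rewrite <- exp_0. specialize (Z0 x Hx).
      destruct (Req_dec (Z x) 0) as [->|Hn]; [rewrite Ropp_0; lra|].
      apply Rlt_le, exp_increasing. lra.
    - rewrite integral_scal by auto.
      rewrite (integral_plus _ _ P2 _ _ L01 L2), (integral_plus _ _ P2 _ _ L0 L1).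
      rewrite integral_const, !integral_scal by (auto; first [apply Hv|apply Hz]). lra. }
  assert (HFc : cont_on F 0 (PI / 2)) by now apply AC_cont with h.
  assert (HFh := AC_holder h F 0 (PI / 2) M P2 HM Hh HF HhB).
  destruct (conjugate_regular zeta F h Hz Hh HF F0 (fun x _ => eq_refl))
    as (Q & g & Hg & HgQ & Q0 & HgB & HQth).
  assert (HgM : integral (fun x => g x ^ 2) 0 (PI / 2) <= M ^ 2) by lra.
  assert (HQc : cont_on Q 0 (PI / 2)) by now apply AC_cont with g.
  assert (HQh := AC_holder g Q 0 (PI / 2) M P2 HM Hg HgQ HgM).
  assert (Htau : AC (fun s => / 3 * zeta s) tau 0 (PI / 2)).
  { assert (HC : AC (fun _ => 0) (fun _ => ln (PI / 2)) 0 (PI / 2)).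
    { apply AC_derive; auto; intros x _;
        [exact (is_derive_const (V := R_NormedModule) (ln (PI / 2)) x)|apply continuous_const]. }
    generalize (AC_plus _ _ _ _ _ _ P2 HC (AC_scal (/ 3) _ _ _ _ P2 HZ)).
    apply AC_ext; intros; [ring|reflexivity]. }
  assert (Hzs : forall s, 0 < s <= PI / 2 -> / 3 * zeta s = F s / sin s).
  { intros s Hs. unfold F. assert (0 < sin s) by (apply sin_gt_0; lra). field; lra. }
  assert (Hder : forall delta, 0 < delta < PI / 2 -> exists C, 0 <= C /\
    (forall x y, delta <= x <= PI / 2 -> delta <= y <= PI / 2 ->
      Rabs (/ 3 * zeta x - / 3 * zeta y) <= C * sqrt (Rabs (x - y))) /\
    forall x, delta <= x <= PI / 2 -> deriv_within tau delta (PI / 2) x (/ 3 * zeta x)).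
  { intros delta Hd.
    destruct (quotient_sin_holder F M delta HM Hd HFc HFh) as (C & C0 & HC).
    assert (HC' : forall x y, delta <= x <= PI / 2 -> delta <= y <= PI / 2 ->
      Rabs (/ 3 * zeta x - / 3 * zeta y) <= C * sqrt (Rabs (x - y))).
    { intros x y Hx Hy. rewrite !Hzs by lra. now apply HC. }
    exists C. split; [auto|]. split; [auto|].
    apply (AC_holder_deriv (fun s => / 3 * zeta s) tau delta (PI / 2) C); auto.
    apply (AC_sub _ _ 0 (PI / 2)); auto; lra. }
  split; [split; [|split]|split].
  - exists h. split; [now apply L2f_L2|]. split; [now apply AC_weak_deriv|].
    now apply L2norm_le.
  - destruct (Hder (PI / 4) ltac:(lra)) as (C & C0 & _ & HD).
    specialize (HD (PI / 2) ltac:(lra)).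
    rewrite Hzs, F0 in HD by lra.
    replace (0 / sin (PI / 2)) with 0 in HD by (unfold Rdiv; ring).
    intros eps He. destruct (HD eps He) as (eta & Heta & H).
    exists (Rmin eta (PI / 4)). split; [apply Rmin_pos; lra|]. intros y Hy.
    assert (R1 := Rmin_l eta (PI / 4)). assert (R2 := Rmin_r eta (PI / 4)).
    apply H; [lra|]. split_Rabs; lra.
  - intros delta Hd. destruct (Hder delta Hd) as (C & C0 & HC & HD).
    exists (fun s => / 3 * zeta s). split; [auto|]. now exists C.
  (* With this version of [theta'], the product with sin is [Q] at every point of [0, PI/2]. At 0
     the value of the quotient is immaterial, as it is multiplied by sin 0 and [Q 0 = 0]. *)
  - exists (fun s => Q s / sin s), g. split; [|split; [|split]].
    + apply AC_local_weak_deriv; auto; [lra|]. now apply AC_cont with v.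
    + now apply L2f_L2.
    + apply AC_weak_deriv; auto. apply AC_ext with (3 := HgQ); [auto|].
      intros s Hs. destruct (Req_dec s 0) as [->|Hn].
      * rewrite Q0, sin_0. ring.
      * assert (0 < sin s) by (apply sin_gt_0; lra). field. lra.
    + now apply L2norm_le.
  - intros delta Hd.
    destruct (quotient_sin_holder Q M delta HM Hd HQc HQh) as (C & C0 & HC).
    exists (fun s => Q s / sin s). split; [|now exists C].
    apply (AC_holder_deriv (fun s => Q s / sin s) theta delta (PI / 2) C); auto.
Qed.
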